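(* Let $\tau>0$, let $\Theta=(\alpha,\beta)$ be a bounded interval, and let $\{\lambda(\vartheta,t),0\le t\le\tau\}$, $\vartheta\in\Theta$, be a parametric family of bounded positive intensity functions. Suppose that one observes $n$ independent Poisson processes $X^n=(X_1,\ldots,X_n)$, $X_j=\{X_j(t),0\le t\le\tau\}$, each with intensity function $\lambda(\vartheta_0,\cdot)$, where the true value $\vartheta_0$ is an interior point of $\Theta$. Suppose that: (i) $\sqrt{\lambda(\vartheta,t)}$, $0\le t\le\tau$, has two continuous bounded derivatives with respect to $\vartheta$, and $\lambda(\vartheta,t)$ is four times continuously differentiable with respect to $\vartheta$; (ii) for any $\nu>0$, $\inf_{|\vartheta-\vartheta_0|>\nu}\int_0^\tau\left[\sqrt{\lambda(\vartheta,t)}-\sqrt{\lambda(\vartheta_0,t)}\right]^2dt>0$; (iii) $\dot\lambda(\vartheta_0,t)=0$ and $\ddot\lambda(\vartheta_0,t)=0$ for all $t\in[0,\tau]$ (so that the Fisher information at $\vartheta_0$ is zero), and $$0<\mathrm{I}_3(\vartheta_0)=\int_0^\tau\frac{\dddot\lambda(\vartheta_0,t)^2}{(3!)^2\,\lambda(\vartheta_0,t)}\,dt<\infty .$$ Let $\zeta(\vartheta_0)\sim\mathcal N(0,\mathrm{I}_3(\vartheta_0))$. Then the maximum likelihood estimator $\hat\vartheta_n$ satisfies, as $n\to\infty$, $$n^{1/6}\left(\hat\vartheta_n-\vartheta_0\right)\Longrightarrow\left(\frac{\zeta(\vartheta_0)}{\mathrm{I}_3(\vartheta_0)}\right)^{1/3},$$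 where $\Longrightarrow$ is convergence in distribution and $x^{1/3}$ is the real cube root.
   Context: A Poisson process with intensity function $\lambda$ on $[0,\tau]$ is a c\`adl\`ag counting process $X$ with $X(0)=0$, independent increments on disjoint intervals, and $X(t)-X(s)$ Poisson distributed with mean $\int_s^t\lambda(r)\,dr$ for $s<t$. Dots denote derivatives with respect to $\vartheta$. The Fisher information is $\mathrm I(\vartheta)=\int_0^\tau\dot\lambda(\vartheta,t)^2/\lambda(\vartheta,t)\,dt$. The likelihood ratio function is $$L(\vartheta,X^n)=\exp\left\{\sum_{j=1}^n\int_0^\tau\ln\lambda(\vartheta,t)\,dX_j(t)-n\int_0^\tau[\lambda(\vartheta,t)-1]\,dt\right\},$$ and the maximum likelihood estimator $\hat\vartheta_n$ is defined by $L(\hat\vartheta_n,X^n)=\sup_{\vartheta\in\Theta}L(\vartheta,X^n)$.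
   Formalization: ''Bounded positive'' is taken as bounded and bounded away from zero on [0,τ] for each ϑ, and the ϑ-derivatives in (i) as continuous in ϑ uniformly in t (both follow from joint continuity on Θ×[0,τ]); read pointwise in t the claim is false. *)

(* Defs.v *)
From HB Require Import structures.
From mathcomp Require Import all_boot all_order all_algebra.
From mathcomp Require Import all_classical all_reals all_analysis.

Set Implicit Arguments.
Unset Strict Implicit.
Unset Printing Implicit Defensive.

Import Order.TTheory GRing.Theory Num.Theory.
Import numFieldNormedType.Exports.

Local Open Scope classical_set_scope.
Local Open Scope ring_scope.

(* With A i ranging over sigma-algebras (which contain setT), the product rule
   over the whole index type covers all subfamilies. *)
Definition mutually_independent (R : realType) (d : measure_display)
    (T : measurableType d) (P : probability T R) (I : finType)
    (G : I -> set (set T)) : Prop :=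
  forall A : I -> set T, (forall i, G i (A i)) ->
    P (\bigcap_(i in [set: I]) A i) = (\prod_(i : I) P (A i))%E.

Definition sigma_of (R : realType) (T : Type) (Y : T -> R) : set (set T) :=
  preimage_set_system setT Y measurable.

(* Sample paths are nondecreasing and right-continuous functions on the whole
   real line ([cumulative R R]), so that they carry a Lebesgue-Stieltjes
   measure; only their values on [0, tau] are observed. *)
Definition sigma_of_process (R : realType) (tau : R) (T : Type)
    (X : T -> cumulative R R) : set (set T) :=
  <<s \bigcup_(t in `[0, tau]) sigma_of (fun w => X w t) >>.

(* For s < t the mean is positive as soon as f is; at nonpositive rates
   [poisson_pmf] takes the junk value 1. *)
Record poisson_process (R : realType) (tau : R) (f : R -> R)
    (d : measure_display) (T : measurableType d) (P : probability T R)
    (X : T -> cumulative R R) : Prop := PoissonProcess {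
  poisson_measurable : forall t, t \in `[0, tau] ->
    measurable_fun setT (fun w => X w t) ;
  poisson_start : forall w, X w 0 = 0 ;
  poisson_counting : forall w t, t \in `[0, tau] ->
    exists k : nat, X w t = k%:R ;
  poisson_indep_increments : forall (k : nat) (s : nat -> R),
    (forall i, (i <= k)%N -> s i \in `[0, tau]) ->
    (forall i, (i < k)%N -> s i <= s i.+1) ->
    mutually_independent P
      (fun i : 'I_k => sigma_of (fun w => X w (s i.+1) - X w (s i))) ;
  poisson_increments : forall s t, 0 <= s -> s < t -> t <= tau ->
    forall k : nat,
      P [set w | X w t - X w s = k%:R] =
      (poisson_pmf (\int[lebesgue_measure]_(r in `]s, t]) f r) k)%:E }.

(* The k-th partial derivative of g(th, t) with respect to th. *)
Definition dtheta (R : realType) (k : nat) (g : R -> R -> R) (th t : R) : R :=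
  derive1n k (fun u => g u t) th.

(* g is k times continuously differentiable with respect to th on Theta,
   continuity of the derivatives at each th being uniform in t; this follows
   from joint continuity of the derivatives on Theta x [0, tau], but requires
   no regularity in t. *)
Definition continuously_differentiable (R : realType) (Theta : set R) (tau : R)
    (k : nat) (g : R -> R -> R) : Prop :=
  (forall j th t, (j < k)%N -> Theta th -> t \in `[0, tau] ->
     derivable (fun u => dtheta j g u t) th 1) /\
  (forall j th (eps : R), (j <= k)%N -> Theta th -> 0 < eps ->
     \forall u \near th, forall t, t \in `[0, tau] ->
       `|dtheta j g u t - dtheta j g th t| < eps).

(* "Bounded positive" is read as bounded and bounded away from zero. *)
Definition bounded_positive (R : realType) (tau : R) (f : R -> R) : Prop :=
  exists c C : R, 0 < c /\ forall t, t \in `[0, tau] -> c <= f t <= C.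

Definition likelihood (R : realType) (tau : R) (lam : R -> R -> R) (n : nat)
    (x : 'I_n -> cumulative R R) (th : R) : R :=
  expR (\sum_(j < n)
          \int[lebesgue_stieltjes_measure (x j)]_(t in `]0, tau]) ln (lam th t)
        - n%:R * \int[lebesgue_measure]_(t in `[0, tau]) (lam th t - 1)).

Definition maximizes_likelihood (R : realType) (Theta : set R) (tau : R)
    (lam : R -> R -> R) (n : nat) (x : 'I_n -> cumulative R R) (th : R) :
    Prop :=
  Theta th /\
  (likelihood tau lam x th)%:E =
    ereal_sup [set (likelihood tau lam x u)%:E | u in Theta].

(* The parameter set being open, the supremum may fail to be attained for some
   samples; the estimator is unconstrained there, so that estimators with this
   property exist for every n. *)
Definition is_mle (R : realType) (Theta : set R) (tau : R) (lam : R -> R -> R)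
    (n : nat) (d : measure_display) (T : measurableType d)
    (P : probability T R) (X : 'I_n -> T -> cumulative R R)
    (est : {RV P >-> R}) : Prop :=
  {ae P, forall w,
    (exists th, maximizes_likelihood Theta tau lam (fun j => X j w) th) ->
    maximizes_likelihood Theta tau lam (fun j => X j w) (est w)}.

Definition info3 (R : realType) (tau : R) (lam : R -> R -> R) (th : R) :
    \bar R :=
  (\int[lebesgue_measure]_(t in `[0%R, tau])
     (dtheta 3 lam th t ^+ 2 / (3`!%:R ^+ 2 * lam th t))%:E)%E.

Definition cbrt (R : realType) (x : R) : R := Num.sg x * `|x| `^ (3%:R^-1).

Definition cvg_in_distribution (R : realType) (d : nat -> measure_display)
    (T : forall n, measurableType (d n)) (P : forall n, probability (T n) R)
    (Y : forall n, T n -> R) (d' : measure_display) (T' : measurableType d')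
    (Q : probability T' R) (Z : T' -> R) : Prop :=
  forall f : R -> R, continuous f -> (exists M : R, forall x, `|f x| <= M) ->
    ('E_(P n)[f \o Y n] @[n --> \oo] --> 'E_Q[f \o Z])%E.

(* Main.v *)
Require Import Defs.
From HB Require Import structures.
From mathcomp Require Import all_boot all_order all_algebra.
From mathcomp Require Import all_classical all_reals all_analysis.
From mathcomp Require Import measurable_realfun ring lra zify.

Set Implicit Arguments.
Unset Strict Implicit.
Unset Printing Implicit Defensive.

Import Order.TTheory GRing.Theory Num.Theory.
Import numFieldNormedType.Exports.

Local Open Scope classical_set_scope.
Local Open Scope ring_scope.

(** Write h for theta - theta0, v for sqrt n h^3 and g for
    lambda'''(theta0) / (6 lambda(theta0)). As the first two derivatives of
    lambda vanish at theta0,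
      ln (lambda(theta0 + h) / lambda(theta0)) = h^3 (g + rho_h),
    where rho_0 = 0 and rho_h is Lipschitz in h, uniformly in t
    ([local_expansion]). The log-likelihood ratio at theta0 + h is therefore
      v (Delta_n + R_n(h)) - v^2 (I / 2 + k(h)),
    where Delta_n and R_n(h) are the centred sums of the stochastic integrals
    of g and of rho_h divided by sqrt n, I is the integral of
    g^2 lambda(theta0), that is, the third-order information, and k(h) = O(h)
    ([likelihood_quadratic]). Near theta0 both perturbations are small, so that
    a maximizer v of this expression is close to Delta_n / I, the maximizer of
    the unperturbed parabola ([quadratic_maximizer], [mle_linearization]). Since
    n^(1/6) h is the cube root of v, the limit law follows from the central
    limit theorem for Delta_n, Slutsky's lemma and the continuity of the cube
    root.

    To compute the moments of a stochastic integral, Campbell's formula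
    ([campbell]) identifies measures on ]0, tau] that agree on the intervals
    ]0, t], on which they are moments of the counts. The smallness of R_n,
    uniformly in h, is an oscillation bound for the empirical process indexed by
    a one-parameter Lipschitz family ([empirical_oscillation]). The same bound
    gives consistency, that is, uniform negativity of the log-likelihood ratio
    away from theta0: the mean of the ratio is bounded through the Hellinger
    distance, and replacing lambda(theta) by lambda(theta) plus a constant makes
    its logarithm Lipschitz in theta ([consistency]). With consistency, the
    likelihood attains its supremum with probability tending to 1
    ([likelihood_maximizer]), which is where the definition of the estimator
    has content.

    The central limit theorem is proved for the means of cos (a Z + b)
    ([central_limit_cos]); these determine weak limits because a bounded
    continuous function is approximated, on a large interval and with the same
    bound everywhere, by Bernstein polynomials in (1 + sin (s x)) / 2
    ([weak_convergence_of_cosines]). *)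

(** * Mixtures of measures *)

(** The measure U |-> integral of w(x) l(x, U) against mu. The proof arguments
    let its measure structure be inferred. Dirac masses l(x) give the measures
    with a density, and the jump measures of the paths give mean measures. *)
Definition mixture d d' (X : measurableType d) (Y : measurableType d')
    (R : realType) (mu : {measure set X -> \bar R}) (w : X -> R)
    (l : X -> {measure set Y -> \bar R})
    (mw : measurable_fun [set: X] w) (w0 : forall x, 0 <= w x)
    (ml : forall U, measurable U -> measurable_fun [set: X] (l ^~ U)) :=
  fun U : set Y => (\int[mu]_x ((w x)%:E * l x U))%E.

Section mixture_measure.
Context d d' (X : measurableType d) (Y : measurableType d') (R : realType).
Variables (mu : {measure set X -> \bar R}) (w : X -> R)
  (l : X -> {measure set Y -> \bar R}).
Hypotheses (mw : measurable_fun [set: X] w) (w0 : forall x, 0 <= w x)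
  (ml : forall U, measurable U -> measurable_fun [set: X] (l ^~ U)).
Local Open Scope ereal_scope.

Local Notation mix := (mixture mu mw w0 ml).

Let mix0 : mix set0 = 0.
Proof. by apply: integral0_eq => x _; rewrite measure0 mule0. Qed.

Let mix_ge0 U : 0 <= mix U.
Proof. by apply: integral_ge0 => x _; rewrite mule_ge0// lee_fin. Qed.

Let mwl U : measurable U -> measurable_fun [set: X] (fun x => (w x)%:E * l x U).
Proof. by move=> mU; apply: emeasurable_funM; [exact/measurable_EFinP|exact: ml]. Qed.

Let mix_sigma_additive : semi_sigma_additive mix.
Proof.
move=> U mU tU mUU; rewrite [X in _ --> X](_ : _ =
  \int[mu]_x (\sum_(n <oo) (w x)%:E * l x (U n))); last first.
  apply: eq_integral => x _; rewrite nneseriesZl//; congr (_ * _).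
  by apply/esym/cvg_lim => //; exact/measure_semi_sigma_additive.
apply/cvg_closeP; split.
  by apply: is_cvg_nneseries => n _ _; apply: mix_ge0.
rewrite closeE// integral_nneseries//; first by move=> n; exact: mwl.
by move=> n x _; rewrite mule_ge0// lee_fin.
Qed.

HB.instance Definition _ := isMeasure.Build _ _ R mix mix0 mix_ge0
  mix_sigma_additive.

Import HBNNSimple.

Let ge0_integral_mixture_nnsfun (f : {nnsfun Y >-> R}) :
  \int[mix]_y (f y)%:E = \int[mu]_x ((w x)%:E * \int[l x]_y (f y)%:E).
Proof.
under [in LHS]eq_integral do rewrite fimfunE -fsumEFin//.
rewrite ge0_integral_fsum//; last 2 first.
  - by move=> r; exact/measurable_EFinP/measurableT_comp.
  - by move=> r z _; rewrite EFinM nnfun_muleindic_ge0.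
under [in RHS]eq_integral.
  move=> x _.
  under eq_integral.
    by move=> z _; rewrite fimfunE -fsumEFin//; over.
  rewrite /= ge0_integral_fsum//; last 2 first.
    - by move=> r; exact/measurable_EFinP/measurableT_comp.
    - by move=> r z _; rewrite EFinM nnfun_muleindic_ge0.
  under eq_fsbigr.
    move=> r _.
    rewrite (integralZl_indic _ (fun r => f @^-1` [set r]))//; last first.
      by move=> r0; rewrite preimage_nnfun0.
    rewrite integral_indic// setIT.
    over.
  rewrite ge0_mule_fsumr; last first.
    move=> r; have := mulemu_ge0 (fun n => f @^-1` [set n]).
    by apply; exact: preimage_nnfun0.
  over.
rewrite /= ge0_integral_fsum//; last 2 first.
  - move=> r; apply: emeasurable_funM; first exact/measurable_EFinP.
    by apply: measurable_funeM; exact: ml.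
  - move=> n y _; rewrite mule_ge0 ?lee_fin//.
    have := mulemu_ge0 (fun n => f @^-1` [set n]).
    by apply; exact: preimage_nnfun0.
apply: eq_fsbigr => r _.
rewrite (integralZl_indic _ (fun r => f @^-1` [set r]))//; last first.
  exact: preimage_nnfun0.
rewrite /= integral_indic// setIT.
under [in RHS]eq_integral do rewrite muleCA.
have [r0|r0] := leP 0%R r.
  rewrite ge0_integralZl//; first exact: mwl.
  by move=> x _; rewrite mule_ge0// lee_fin.
rewrite integral0_eq ?mule0.
  by rewrite (_ : f @^-1` [set r] = set0) ?measure0 ?mule0// preimage_nnfun0.
by move=> y _; rewrite preimage_nnfun0// measure0 !mule0.
Qed.

(** For simple functions this is linearity; monotone convergence extends it. *)
Lemma ge0_integral_mixture (f : Y -> \bar R) :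
  (forall y, 0 <= f y) -> measurable_fun setT f ->
  \int[mix]_y f y = \int[mu]_x ((w x)%:E * \int[l x]_y f y).
Proof.
move=> f0 mf.
pose f_ := nnsfun_approx measurableT mf.
have fE z : f z = lim ((f_ n z)%:E @[n --> \oo]).
  by apply/esym/cvg_lim => //=; exact: cvg_nnsfun_approx.
transitivity (\int[mix]_z (lim ((f_ n z)%:E @[n --> \oo]))).
  by apply/eq_integral => z _; rewrite -fE.
rewrite monotone_convergence//; last 3 first.
  by move=> n; exact/measurable_EFinP.
  by move=> n z _; rewrite lee_fin.
  by move=> z _ a b ab; rewrite lee_fin; exact/lefP/nd_nnsfun_approx.
under eq_fun do rewrite ge0_integral_mixture_nnsfun.
have int_nd x a b : (a <= b)%N ->
    \int[l x]_z (f_ a z)%:E <= \int[l x]_z (f_ b z)%:E.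
  move=> ab; apply: ge0_le_integral => //.
  - by move=> z _; rewrite lee_fin.
  - exact/measurable_EFinP.
  - exact/measurable_EFinP.
  - by move=> z _; rewrite lee_fin; exact/lefP/nd_nnsfun_approx.
rewrite -monotone_convergence//; last 3 first.
- move=> n; apply: emeasurable_funM; first exact/measurable_EFinP.
  apply: measurable_fun_integral_kernel => //.
    by move=> z; rewrite lee_fin.
  exact/measurable_EFinP.
- move=> n x _; rewrite mule_ge0 ?lee_fin//; apply: integral_ge0 => // z _.
  by rewrite lee_fin.
- by move=> x _ a b ab; rewrite lee_wpmul2l ?lee_fin// int_nd.
apply: eq_integral => x _.
rewrite limeMl//; last first.
  by apply: ereal_nondecreasing_is_cvgn => a b; exact: int_nd.
congr (_ * _); rewrite -monotone_convergence//; last 3 first.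
- by move=> n; exact/measurable_EFinP.
- by move=> n z _; rewrite lee_fin.
- by move=> z _ a b ab; rewrite lee_fin; exact/lefP/nd_nnsfun_approx.
by apply: eq_integral => z _; rewrite -fE.
Qed.

End mixture_measure.

(** * Campbell's formula *)

Lemma measurable_dirac d (T : measurableType d) (R : realType) (U : set T) :
  measurable U -> measurable_fun [set: T] ((fun x => \d_x : {measure set T -> \bar R}) ^~ U).
Proof.
move=> mU; rewrite (_ : (fun _ => _) = (fun x => (\1_U x)%:E)); last first.
  by apply/funext => x; rewrite /= diracE indicE.
by apply/measurable_EFinP; exact: measurable_indic.
Qed.

Definition density d (T : measurableType d) (R : realType)
  (mu : {measure set T -> \bar R}) (w : T -> R)
  (mw : measurable_fun [set: T] w) (w0 : forall x, 0 <= w x) :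
    {measure set T -> \bar R} :=
  mixture mu mw w0 (@measurable_dirac d T R).

Lemma ge0_integral_density d (T : measurableType d) (R : realType)
  (mu : {measure set T -> \bar R}) (w : T -> R)
  (mw : measurable_fun [set: T] w) (w0 : forall x, 0 <= w x) (f : T -> \bar R) :
  (forall y, 0 <= f y)%E -> measurable_fun [set: T] f ->
  (\int[density mu mw w0]_y f y = \int[mu]_x ((w x)%:E * f x))%E.
Proof.
move=> f0 mf; rewrite ge0_integral_mixture//; apply: eq_integral => x _.
by rewrite integral_dirac// diracT mul1e.
Qed.

Lemma ge0_integral_mrestr d (T : measurableType d) (R : realType)
  (mu : {measure set T -> \bar R}) (D : set T) (mD : measurable D)
  (f : T -> \bar R) :
  (forall y, 0 <= f y)%E -> measurable_fun [set: T] f ->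
  (\int[mrestr mu mD]_y f y = \int[mu]_(x in D) f x)%E.
Proof.
move=> f0 mf.
have m1 : measurable_fun [set: T] (\1_D : T -> R) by exact: measurable_indic.
have p1 x : 0 <= (\1_D : T -> R) x by rewrite indicE.
transitivity (\int[density mu m1 p1]_y f y)%E.
  apply: eq_measure_integral => A mA _ /=.
  rewrite /mrestr /density /mixture -integral_indic// -(setTI D).
  rewrite integral_mkcondr; apply: eq_integral => x _.
  by rewrite /= setTI patchE diracE !indicE; case: (x \in D); rewrite ?mul1e ?mul0e.
rewrite ge0_integral_density// [RHS]integral_mkcond.
apply: eq_integral => x _; rewrite patchE indicE.
by case: (x \in D); rewrite ?mul1e ?mul0e.
Qed.

Section jump_measure.
Context (R : realType) (tau : R).
Let D : set (measurableTypeR R) := `]0, tau]%classic.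
Let mD : measurable D.
Proof. exact: measurable_itv. Qed.

Lemma ocitv_setI_itv (A : set R) : ocitv A ->
  A `&` `]0, tau] = set0 \/
  exists a b : R, [/\ 0 <= a, a < b, b <= tau & A `&` `]0, tau] = `]a, b]%classic].
Proof.
move=> [[a b] _ <-] /=.
have E : `]a, b]%classic `&` `]0, tau] = `]Num.max a 0, Num.min b tau]%classic.
  apply/seteqP; split => [t /=|t /=]; rewrite !in_itv/= gt_max le_min.
    by move=> [/andP[-> ->] /andP[-> ->]].
  by move=> /andP[/andP[-> ->] /andP[-> ->]].
have [lt_ba|le_ba] := ltP (Num.max a 0) (Num.min b tau).
  right; exists (Num.max a 0), (Num.min b tau); split => //.
    by rewrite le_max lexx orbT.
  by rewrite ge_min lexx orbT.
by left; rewrite E set_itv_ge// bnd_simp -leNgt.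
Qed.

Local Notation oc a b := (`]a, b]%classic : set (measurableTypeR R)).

(** The intervals ]a, b] form a pi-system that generates the Borel sets, and
    their traces on ]0, tau] are differences of intervals ]0, t]. *)
Lemma itv0_measure_unique (m1 m2 : {measure set (measurableTypeR R) -> \bar R}) :
  (m1 D < +oo)%E ->
  (forall t : R, 0 < t -> t <= tau -> m1 (oc 0 t) = m2 (oc 0 t)) ->
  forall A, measurable A -> m1 (A `&` D) = m2 (A `&` D).
Proof.
move=> m1D m12 A mA.
have m1lt t : t <= tau -> (m1 (oc 0%R t) < +oo)%E.
  move=> tt; apply: le_lt_trans m1D; apply: le_measure => //; rewrite ?inE//.
  by move=> x; rewrite /D/= !in_itv/= => /andP[-> /le_trans]; apply.
have m12' a b : 0 <= a -> a < b -> b <= tau -> m1 (oc a b) = m2 (oc a b).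
  move=> a0 ab bt; have b0 : 0 < b by exact: le_lt_trans ab.
  move: a0; rewrite le_eqVlt => /predU1P[<-|a0]; first exact: m12.
  have -> : oc a b = oc 0 b `\` oc 0 a .
    apply/seteqP; split => x /=; rewrite !in_itv/=.
      move=> /andP[ax ->]; rewrite (lt_trans a0 ax); split => //.
      by rewrite leNgt ax.
    move=> [/andP[-> ->] /negP]; rewrite andbT/= leNgt negbK => ->//.
  have sab : oc 0 b `&` oc 0 a = oc 0 a .
    apply: setIidr => x /=; rewrite !in_itv/= => /andP[-> /le_trans]; apply.
    exact: ltW.
  have alt := le_trans (ltW ab) bt.
  rewrite !measureD//=; try exact: measurable_itv; last 2 first.
  - by rewrite -m12// m1lt.
  - exact: m1lt.
  by rewrite sab !m12.
pose g (n : nat) : set (measurableTypeR R) := `]- n%:R, n%:R]%classic.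
apply: (@measure_unique _ R (measurableTypeR R) (@ocitv R) g _ _ _ _
  (mrestr m1 mD) (mrestr m2 mD)) => //.
- exact: ocitvI.
- by move=> i; exists (- i%:R, i%:R).
- apply/seteqP; split => // x _; exists (Num.bound `|x : R|) => //.
  have := archi_boundP (normr_ge0 (x : R)).
  by rewrite ltr_norml /g/= in_itv/= => /andP[-> /ltW].
- move=> B /ocitv_setI_itv; rewrite /= /mrestr.
  by case=> [->|[a [b [a0 ab bt ->]]]]; rewrite ?measure0//; exact: m12'.
- move=> k; apply: le_lt_trans m1D; apply: le_measure; rewrite ?inE//=.
  by apply: measurableI => //; exact: measurable_itv.
Qed.

Hypothesis tau0 : 0 < tau.
Variables (d : measure_display) (T : measurableType d) (X : T -> cumulative R R).
Hypothesis mX : forall t, t \in `[0, tau] -> measurable_fun [set: T] (fun w => X w t).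

Lemma lsm_oc (f : cumulative R R) (a b : R) : a <= b ->
  lebesgue_stieltjes_measure f (oc a b) = (f b - f a)%:E.
Proof.
move=> ab; rewrite /lebesgue_stieltjes_measure /measure_extension/=.
by rewrite measurable_mu_extE/= ?wlength_itv_bnd//; exact: is_ocitv.
Qed.

(** The sets with this property form a Dynkin system that contains the half-open
    intervals, whose measure is an increment of the path. *)
Lemma measurable_jump A : measurable A ->
  measurable_fun [set: T] (fun w => lebesgue_stieltjes_measure (X w) (A `&` D)).
Proof.
have mX0 (a b : R) : 0 <= a -> a <= b -> b <= tau ->
    measurable_fun [set: T] (fun w => lebesgue_stieltjes_measure (X w) (oc a b)).
  move=> a0 ab bt; under eq_fun do rewrite lsm_oc//.
  apply/measurable_EFinP; apply: measurable_funB; apply: mX.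
    by rewrite in_itv/= bt (le_trans a0).
  by rewrite in_itv/= a0 (le_trans ab).
have mD0 : measurable_fun [set: T] (fun w => lebesgue_stieltjes_measure (X w) D).
  by apply: mX0 => //; exact: ltW.
have fin w : (lebesgue_stieltjes_measure (X w) D < +oo)%E.
  by rewrite lsm_oc ?ltry// ltW.
move=> mA.
apply: (@dynkin_induction _ (measurableTypeR R) (@ocitv R)
  [set A | measurable_fun [set: T] (fun w => lebesgue_stieltjes_measure (X w) (A `&` D))]) => //=.
- exact: ocitvI.
- by under eq_fun do rewrite setTI.
- move=> B /ocitv_setI_itv[|[a [b [a0 ab bt]]]] /= ->.
    by under eq_fun do rewrite measure0; exact: measurable_cst.
  by apply: mX0 => //; exact: ltW.
- move=> S mS mSD.
  rewrite (_ : (fun _ => _) = (fun w => lebesgue_stieltjes_measure (X w) D -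
      lebesgue_stieltjes_measure (X w) (S `&` D)))%E; first exact: emeasurable_funB.
  apply/funext => w; rewrite setIC -setDE measureD//; last exact: fin.
  by rewrite (setIC D).
- move=> F mF tF mFD.
  have mFDn n : measurable (F n `&` D) by exact: measurableI.
  rewrite (_ : (fun _ => _) = (fun w => \sum_(n <oo)
      lebesgue_stieltjes_measure (X w) (F n `&` D)))%E.
    by apply: ge0_emeasurable_sum => // n _; exact: mFD.
  apply/funext => w; rewrite setI_bigcupl measure_bigcup//.
    by apply: eq_eseriesl => n; rewrite in_setT.
  exact: trivIset_setIr.
Qed.

Definition jump_measure (w : T) : {measure set (measurableTypeR R) -> \bar R} :=
  mrestr (lebesgue_stieltjes_measure (X w)) mD.

(** Both sides integrate phi against measures on ]0, tau], the mixture of the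
    jump measures with weights Y and nu, which agree on every ]0, t] and hence
    everywhere. With Y = 1 this computes the mean of a stochastic integral; with
    Y a count or a stochastic integral, it computes covariances. *)
Lemma campbell (P : {measure set T -> \bar R}) (Y : T -> R)
    (nu : {measure set (measurableTypeR R) -> \bar R})
    (phi : measurableTypeR R -> \bar R) :
  measurable_fun [set: T] Y -> (forall w, 0 <= Y w) -> (forall w, X w 0 = 0) ->
  (nu D < +oo)%E ->
  (forall t : R, 0 < t -> t <= tau ->
     (\int[P]_w (Y w * X w t)%:E)%E = nu (oc 0 t)) ->
  (forall t, 0 <= phi t)%E -> measurable_fun D phi ->
  (\int[P]_w ((Y w)%:E * \int[lebesgue_stieltjes_measure (X w)]_(t in D) phi t)
   = \int[nu]_(t in D) phi t)%E.
Proof.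
move=> mY Y0 X0 nuD YX phi0 mphi.
have mj A : measurable A -> measurable_fun [set: T] (jump_measure ^~ A).
  exact: measurable_jump.
have phi0' y : (0 <= (phi \_ D) y)%E by rewrite patchE; case: ifPn.
have mphi' : measurable_fun setT (phi \_ D) by exact/(measurable_restrictT phi mD).
transitivity (\int[P]_w ((Y w)%:E * \int[jump_measure w]_t (phi \_ D) t))%E.
  apply: eq_integral => w _; congr (_ * _)%E.
  by rewrite ge0_integral_mrestr// -integral_mkcondr setIid.
rewrite -(ge0_integral_mixture P mY Y0 mj phi0' mphi').
transitivity (\int[mrestr nu mD]_t (phi \_ D) t)%E; last first.
  by rewrite ge0_integral_mrestr// -integral_mkcondr setIid.
apply: eq_measure_integral => A mA _.
transitivity (mixture P mY Y0 mj (A `&` D)).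
  by apply: eq_integral => w _; rewrite /= /mrestr -setIA setIid.
have m12 t : 0 < t -> t <= tau ->
    mixture P mY Y0 mj (oc 0 t) = nu (oc 0 t).
  move=> t0 tt; rewrite -YX//; apply: eq_integral => w _.
  rewrite /= /mrestr EFinM; congr (_ * _)%E.
  rewrite -[X in lebesgue_stieltjes_measure _ X]/(oc 0 t `&` oc 0 tau).
  rewrite setIidl; last by move=> x /=; rewrite !in_itv/= => /andP[-> /le_trans]; apply.
  by rewrite lsm_oc ?X0 ?subr0// ltW.
by apply: itv0_measure_unique => //=; rewrite m12.
Qed.

End jump_measure.

(** * Moments of a Poisson variable *)

Section poisson_variable.
Context d (T : measurableType d) (R : realType) (P : probability T R).
Variables (N : T -> R) (rate : R).
Hypothesis mN : measurable_fun [set: T] N.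
Hypothesis Nnat : forall w, exists k : nat, N w = k%:R.
Hypothesis rate0 : 0 < rate.
Hypothesis PN : forall k : nat, P [set w | N w = k%:R] = (poisson_pmf rate k)%:E.
Local Open Scope ereal_scope.

Lemma ge0_integral_poisson_variable (g : R -> R) :
  measurable_fun [set: R] g -> (forall k : nat, 0 <= g k%:R)%R ->
  \int[P]_w (g (N w))%:E = \sum_(k <oo) (g k%:R * poisson_pmf rate k)%:E.
Proof.
move=> mg g0.
have mF k : measurable [set w | N w = k%:R].
  rewrite -[X in measurable X]setTI.
  have -> : [set w | N w = k%:R] = N @^-1` [set k%:R] by [].
  by apply: mN => //; exact: measurable_set1.
have FT : [set: T] = \bigcup_k [set w | N w = k%:R].
  by apply/seteqP; split => // w _; have [k wk] := Nnat w; exists k.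
rewrite [in LHS]FT ge0_integral_bigcup//=.
- apply: eq_eseriesr => k _; rewrite EFinM -PN.
  transitivity (\int[P]_(w in [set w | N w = k%:R]) (cst (g k%:R)%:E) w).
    by apply: eq_integral => w; rewrite inE/= => ->.
  by rewrite integral_cst//; exact: mF.
- rewrite -FT; apply/measurable_EFinP; exact: measurableT_comp.
- by move=> w [k _ /= ->]; rewrite lee_fin.
- move=> i j _ _ [w [/= -> /eqP]]; by rewrite eqr_nat => /eqP.
Qed.

Let pmf0 k : (0 <= poisson_pmf rate k)%R.
Proof. exact: poisson_pmf_ge0. Qed.

Lemma term_ge0 m k : 0 <= ((k ^_ m)%:R * poisson_pmf rate k)%:E.
Proof. by rewrite lee_fin mulr_ge0// pmf0. Qed.

(** Shifting the summation index by one turns the factorial moment of order m +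
    1 into rate times that of order m. *)
Lemma factorial_moment m :
  \sum_(k <oo) ((k ^_ m)%:R * poisson_pmf rate k)%:E = (rate ^+ m)%:E.
Proof.
elim: m => [|m IH].
  have I1 : \int[P]_w (cst 1 w) = 1 by rewrite integral_cst//= probability_setT mule1.
  rewrite expr0 -[RHS]I1.
  rewrite (@ge0_integral_poisson_variable (cst 1%R) (measurable_cst _) (fun=> ler01)).
  by apply: eq_eseriesr => k _; rewrite ffactn0.
rewrite nneseries_recl//; last by move=> *; exact: term_ge0.
rewrite ffact0n/= mul0r add0e -nneseries_addn; last by move=> *; exact: term_ge0.
rewrite exprS EFinM -IH -nneseriesZl; last by move=> *; exact: term_ge0.
apply: eq_eseriesr => k _; rewrite -EFinM; congr EFin.
rewrite addn1 ffactnS succnK natrM /poisson_pmf rate0 factS natrM exprS.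
have k1 : (k.+1%:R != 0 :> R)%R by rewrite pnatr_eq0.
have k2 : (k`!%:R != 0 :> R)%R by rewrite pnatr_eq0 -lt0n fact_gt0.
move: k1 k2; move: (k.+1%:R)%R (k`!%:R)%R => a b a0 b0.
by field; rewrite a0 b0.
Qed.

Lemma poisson_mean : \int[P]_w (N w)%:E = rate%:E.
Proof.
rewrite (@ge0_integral_poisson_variable idfun)//; last exact: measurable_id.
rewrite -[rate]expr1 -factorial_moment.
by apply: eq_eseriesr => k _; rewrite ffactn1.
Qed.

Lemma poisson_moment2 : \int[P]_w (N w ^+ 2)%:E = (rate ^+ 2 + rate)%:E.
Proof.
rewrite (@ge0_integral_poisson_variable (fun x => x ^+ 2)%R)//.
rewrite [RHS](_ : _ = (rate ^+ 2)%:E + (rate ^+ 1)%:E)// -!factorial_moment -nneseriesD; try by move=> *; exact: term_ge0.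
apply: eq_eseriesr => k _; rewrite -EFinD; congr EFin.
rewrite -mulrDl -natrD; congr (_ * _)%R; rewrite -natrX; congr (_%:R)%R.
by rewrite ffactn1 ffactnS ffactn1; case: k => // k; rewrite succnK; lia.
Qed.

Lemma poisson_moment3 :
  \int[P]_w (N w ^+ 3)%:E = (rate ^+ 3 + 3 * rate ^+ 2 + rate)%:E.
Proof.
rewrite (@ge0_integral_poisson_variable (fun x => x ^+ 3)%R)//.
rewrite [RHS](_ : _ = (rate ^+ 3)%:E + 3%:E * (rate ^+ 2)%:E + (rate ^+ 1)%:E)//.
rewrite -!factorial_moment.
rewrite -nneseriesZl; last by move=> *; exact: term_ge0.
have t0 k : 0 <= 3%:E * ((k ^_ 2)%:R * poisson_pmf rate k)%:E.
  by rewrite mule_ge0// ?lee_fin//; exact: term_ge0.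
rewrite -!nneseriesD; try by move=> *; rewrite ?adde_ge0//; exact: term_ge0.
apply: eq_eseriesr => k _; rewrite -EFinM -!EFinD; congr EFin.
rewrite mulrA -!mulrDl; congr (_ * _)%R.
rewrite -natrM -!natrD -natrX; congr (_%:R)%R.
rewrite !ffactnSr ffactn0 !subn0 mul1n.
by case: k => [//|[//|k]]; rewrite !subSS subn0; nia.
Qed.

End poisson_variable.

(** * Independence and expectations *)

Section bounded_integrals.
Context d (T : measurableType d) (R : realType) (P : probability T R).

Lemma bounded_integrable (f : T -> R) (M : R) :
  measurable_fun [set: T] f -> (forall w, `|f w| <= M) ->
  P.-integrable [set: T] (EFin \o f).
Proof.
move=> mf fM; apply: measurable_bounded_integrable => //.
  by rewrite (le_lt_trans (probability_le1 _ _)) ?ltry.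
by exists M; split; [exact: num_real|move=> x Mx w _; exact: le_trans (fM w) (ltW Mx)].
Qed.

Lemma Rintegral_setT_cst (c : R) : \int[P]_w c = c.
Proof. by rewrite Rintegral_cst//= probability_setT mulr1. Qed.

Lemma RintegralD_setT (f g : T -> R) :
  P.-integrable [set: T] (EFin \o f) -> P.-integrable [set: T] (EFin \o g) ->
  \int[P]_w (f w + g w) = \int[P]_w f w + \int[P]_w g w.
Proof. by move=> If Ig; rewrite RintegralD. Qed.

End bounded_integrals.

Section weights.
Context d (T : measurableType d) (R : realType) (P : probability T R).

(** If weighting by Y multiplies the law of W by the constant c, the same holds
    for nonnegative functions of W, since both sides integrate g against
    mixtures of Dirac masses at W. *)
Lemma ge0_integral_weight d' (S : measurableType d') (W : T -> S) (Y : T -> R)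
    (c : R) (g : S -> \bar R) :
  measurable_fun [set: T] W -> measurable_fun [set: T] Y ->
  (forall w, 0 <= Y w) -> 0 <= c ->
  (forall B, measurable B ->
     \int[P]_w ((Y w)%:E * (\1_B (W w))%:E) = c%:E * P (W @^-1` B))%E ->
  (forall x, 0 <= g x)%E -> measurable_fun [set: S] g ->
  (\int[P]_w ((Y w)%:E * g (W w)) = c%:E * \int[P]_w g (W w))%E.
Proof.
move=> mW mY Y0 c0 H g0 mg.
pose l (w : T) : {measure set S -> \bar R} := \d_(W w).
have ml U : measurable U -> measurable_fun [set: T] (l ^~ U).
  move=> mU; have := @measurable_dirac _ _ R _ mU.
  by move=> mU1; exact: (measurableT_comp mU1 mW).
have mc : measurable_fun [set: T] (cst c) by exact: measurable_cst.
have l1 w : (\int[l w]_x g x = g (W w))%E by rewrite integral_dirac// diracT mul1e.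
transitivity (\int[mixture P mY Y0 ml]_x g x)%E.
  by rewrite ge0_integral_mixture//; apply: eq_integral => w _; rewrite l1.
transitivity (\int[mixture P mc (fun=> c0) ml]_x g x)%E.
  apply: eq_measure_integral => B mB _; rewrite /= /mixture.
  transitivity (\int[P]_w ((Y w)%:E * (\1_B (W w))%:E))%E.
    by apply: eq_integral => w _; rewrite /l/= diracE indicE.
  rewrite H// -[RHS]/(\int[P]_x (c%:E * l x B))%E ge0_integralZl//.
  - congr (_ * _)%E.
    have mWB : measurable (W @^-1` B) by rewrite -[X in measurable X]setTI; exact: mW.
    by rewrite -[X in P X]setIT -integral_indic.
  - exact: ml.
rewrite ge0_integral_mixture// -ge0_integralZl//.
- by apply: eq_integral => w _; rewrite l1.
- exact: measurableT_comp.
Qed.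

(** Adding constants to Y and g reduces the claim to nonnegative functions. *)
Lemma bounded_Rintegral_weight (W : T -> R) (Y : T -> R) (K M c : R) (g : R -> R) :
  measurable_fun [set: T] W -> measurable_fun [set: T] Y ->
  (forall w, `|Y w| <= K) ->
  (forall B, measurable B ->
     \int[P]_w (Y w * \1_B (W w)) = c * \int[P]_w (\1_B (W w))) ->
  (forall x, `|g x| <= M) -> measurable_fun [set: R] g ->
  \int[P]_w (Y w * g (W w)) = c * \int[P]_w g (W w).
Proof.
move=> mW mY YK H gM mg.
have mgW : measurable_fun [set: T] (fun w => g (W w)) by exact: measurableT_comp.
have IY := bounded_integrable P mY YK.
have Ig := bounded_integrable P mgW (fun w => gM (W w)).
have IYg : P.-integrable [set: T] (EFin \o (fun w => Y w * g (W w))).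
  apply: (@bounded_integrable _ _ _ _ _ (K * M)); first exact: measurable_funM.
  by move=> w; rewrite normrM ler_pM.
have Icst (k : R) : P.-integrable [set: T] (EFin \o (fun=> k)).
  exact: (@bounded_integrable _ _ _ _ _ `|k|).
have IZ (k : R) f : P.-integrable [set: T] (EFin \o f) ->
    P.-integrable [set: T] (EFin \o (fun w => k * f w)).
  by move=> If; have := integrableZl measurableT k If.
have EY : \int[P]_w Y w = c.
  have := H _ measurableT.
  under eq_Rintegral do rewrite indicT mulr1.
  by under [X in _ = _ * X]eq_Rintegral do rewrite indicT; rewrite Rintegral_setT_cst mulr1.
have Y0 w : 0 <= Y w + K by rewrite -lerBlDr sub0r; have := YK w; rewrite ler_norml => /andP[].
have g0 x : (0 <= (g x + M)%:E)%E.
  by rewrite lee_fin -lerBlDr sub0r; have := gM x; rewrite ler_norml => /andP[].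
have mYK : measurable_fun [set: T] (fun w => Y w + K) by exact: measurable_funD.
have cK : 0 <= c + K.
  rewrite -EY -(Rintegral_setT_cst P K) -RintegralD_setT//.
  exact: Rintegral_ge0.
have mgM : measurable_fun [set: R] (fun x => (g x + M)%:E).
  by apply/measurable_EFinP; exact: measurable_funD.
have H' B : measurable B ->
     (\int[P]_w ((Y w + K)%:E * (\1_B (W w))%:E) = (c + K)%:E * P (W @^-1` B))%E.
  move=> mB.
  have mWB : measurable (W @^-1` B) by rewrite -[X in measurable X]setTI; exact: mW.
  have m1 : measurable_fun [set: T] (fun w => \1_B (W w) : R).
    by apply: measurableT_comp => //; exact: measurable_indic.
  have b1 w : `|\1_B (W w) : R| <= 1 by rewrite indicE; case: (_ \in _); rewrite ?normr1 ?normr0.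
  have I1 := bounded_integrable P m1 b1.
  have IY1 : P.-integrable [set: T] (EFin \o (fun w => Y w * \1_B (W w))).
    apply: (@bounded_integrable _ _ _ _ _ (K * 1)); first exact: measurable_funM.
    by move=> w; rewrite normrM ler_pM.
  have P1 : \int[P]_w (\1_B (W w) : R) = fine (P (W @^-1` B)).
    rewrite /Rintegral -[in RHS](setIT (W @^-1` B)) -integral_indic//.
  under eq_integral do rewrite -EFinM mulrDl.
  rewrite -[X in (_ * X)%E]fineK ?fin_num_measure// -P1 -EFinM mulrDl -H//.
  rewrite -RintegralZl// -RintegralD_setT//; last exact: IZ.
  rewrite /Rintegral fineK//; apply: integrable_fin_num => //.
  by apply: (integrableD measurableT IY1 (IZ K _ I1)).
have := ge0_integral_weight mW mYK Y0 cK H' g0 mgM.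
move=> /(congr1 fine).
rewrite (_ : fine (\int[P]_w _)%E = \int[P]_w ((Y w * g (W w) + M * Y w) + (K * g (W w) + K * M))); last first.
  by rewrite /Rintegral; congr fine; apply: eq_integral => w _; rewrite -EFinM; congr EFin; ring.
rewrite (_ : fine (_ * _)%E = (c + K) * \int[P]_w (g (W w) + M)); last first.
  rewrite fineM//; apply: integrable_fin_num => //.
  exact: (integrableD measurableT Ig (Icst M)).
have I1 := integrableD measurableT IYg (IZ M _ IY).
have I2 := integrableD measurableT (IZ K _ Ig) (Icst (K * M)).
rewrite (RintegralD_setT I1 I2) (RintegralD_setT IYg (IZ M _ IY)).
rewrite (RintegralD_setT (IZ K _ Ig) (Icst (K * M))) (RintegralD_setT Ig (Icst M)).
rewrite !RintegralZl// !Rintegral_setT_cst EY => E.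
by apply/(addIr (M * c + (K * \int[P]_x g (W x) + K * M))); rewrite addrA E; ring.
Qed.

End weights.

Section independent_variables.
Context d (T : measurableType d) (R : realType) (P : probability T R).

Definition independent_variables (I : finType) (W : I -> T -> R) : Prop :=
  mutually_independent P (fun i => sigma_of (W i)).

(** Indicators are replaced by general bounded functions one factor at a time:
    in the induction, the factors of index at least k are indicators. *)
Lemma expectation_prod n (W : 'I_n -> T -> R) (g : 'I_n -> R -> R) (M : R) :
  (forall i, measurable_fun [set: T] (W i)) -> independent_variables W ->
  (forall i, measurable_fun [set: R] (g i)) -> (forall i x, `|g i x| <= M) ->
  \int[P]_w (\prod_i g i (W i w)) = \prod_i \int[P]_w g i (W i w).
Proof.
move=> mW iW mg gM.
wlog M1 : M gM / 1 <= M.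
  move=> H; apply: (H (Num.max M 1)); last by rewrite le_max lexx orbT.
  by move=> i x; rewrite le_max gM.
have mprod (J : pred 'I_n) (h : 'I_n -> R -> R) : (forall i, measurable_fun [set: R] (h i)) ->
    measurable_fun [set: T] (fun w => \prod_(i | J i) h i (W i w)).
  move=> mh; under eq_fun do rewrite -big_filter.
  move: [seq i <- index_enum _ | J i] => s; elim: s => [|i s IH].
    by under eq_fun do rewrite big_nil; exact: measurable_cst.
  under eq_fun do rewrite big_cons; apply: measurable_funM => //.
  exact: measurableT_comp.
have bprod (J : pred 'I_n) (h : 'I_n -> R -> R) : (forall i x, `|h i x| <= M) ->
    forall w, `|\prod_(i | J i) h i (W i w)| <= M ^+ n.
  move=> hM w; rewrite normr_prod.
  apply: (@le_trans _ _ (\prod_(i < n | J i) M)).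
    by apply: ler_prod => i _; rewrite normr_ge0 hM.
  rewrite prodr_const; apply: ler_weXn2l => //.
  by rewrite -[n in (_ <= n)%N]card_ord max_card.
have ind (B : set R) : measurable B -> measurable_fun [set: R] (\1_B : R -> R).
  by move=> mB; exact: measurable_indic.
have b1 (B : set R) x : `|\1_B x : R| <= M.
  by rewrite indicE; case: (_ \in _); rewrite ?normr1 ?normr0 ?(le_trans ler01 M1).
suff main k : forall g : 'I_n -> R -> R,
    (forall i, measurable_fun [set: R] (g i)) -> (forall i x, `|g i x| <= M) ->
    (forall i : 'I_n, (k <= i)%N -> exists2 B, measurable B & g i = \1_B) ->
  \int[P]_w (\prod_i g i (W i w)) = \prod_i \int[P]_w g i (W i w).
  by apply: (main n) => // i; rewrite leqNgt ltn_ord.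
elim: k => [|k IH] {}g {}mg {}gM gi.
  have /choice[B HB] : forall i, exists B, measurable B /\ g i = \1_B.
    by move=> i; have [B] := gi i (leq0n _); exists B.
  have E1 (C : set T) : measurable C -> \int[P]_w (\1_C w : R) = fine (P C).
    by move=> mC; rewrite /Rintegral integral_indic// setIT.
  have mWB i : measurable (W i @^-1` B i).
    by rewrite -[X in measurable X]setTI; apply: mW => //; case: (HB i).
  have mWB' : measurable (\bigcap_(i in [set: 'I_n]) W i @^-1` B i).
    by apply: fin_bigcap_measurable.
  transitivity (\int[P]_w (\1_(\bigcap_(i in [set: 'I_n]) W i @^-1` B i) w : R)).
    apply: eq_Rintegral => w _; rewrite indicE.
    have [wB|wB] := boolP (w \in _).
      rewrite big1// => i _; case: (HB i) => _ ->; rewrite indicE mem_set//.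
      by move: wB; rewrite inE => /(_ i); exact.
    move: wB; rewrite notin_setE => wB.
    have [i wi] : exists i, ~ B i (W i w).
      by apply: contrapT => /forallNP h; apply: wB => i _; apply: contrapT; exact: h.
    by rewrite (bigD1 i)//=; case: (HB i) => _ ->; rewrite indicE memNset// mul0r.
  rewrite E1// iW; last first.
    by move=> i; exists (B i); [case: (HB i)|rewrite setTI].
  under [RHS]eq_bigr => i _.
    have -> : \int[P]_w g i (W i w) = \int[P]_w (\1_(W i @^-1` B i) w : R).
      by case: (HB i) => _ ->.
    rewrite E1//; over.
  rewrite -[RHS]/(fine (\prod_i fine (P (W i @^-1` B i)))%:E); congr fine.
  rewrite (big_morph EFin (@EFinM R) erefl); apply: eq_bigr => i _.
  by rewrite fineK// fin_num_measure.
have [kn|kn] := ltnP k n; last first.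
  by apply: IH => // i /(leq_trans kn); rewrite leqNgt ltn_ord.
pose i0 := Ordinal kn.
transitivity (\int[P]_w ((\prod_(i | i != i0) g i (W i w)) * g i0 (W i0 w))).
  by apply: eq_Rintegral => w _; rewrite (bigD1 i0)//= mulrC.
rewrite (bigD1 i0)//= mulrC.
apply: (@bounded_Rintegral_weight _ _ _ P (W i0) _ (M ^+ n) M) => //.
- exact: mprod.
- by move=> w; exact: bprod.
move=> B mB.
pose g' i := if i == i0 then \1_B : R -> R else g i.
have /IH : forall i, measurable_fun [set: R] (g' i).
  by move=> i; rewrite /g'; case: ifP => // _; exact: ind.
have g'M i x : `|g' i x| <= M by rewrite /g'; case: ifP.
have g'i (i : 'I_n) : (k <= i)%N -> exists2 B, measurable B & g' i = \1_B.
  rewrite leq_eqVlt => /predU1P[ki|ki].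
    by exists B => //; rewrite /g' (_ : i = i0) ?eqxx//; exact/val_inj.
  by rewrite /g'; case: ifP => [_|_]; [exists B|exact: gi].
move=> /(_ g'M g'i).
have E0 : g' i0 = \1_B by rewrite /g' eqxx.
have E1 i : i != i0 -> g' i = g i by rewrite /g' => /negbTE ->.
rewrite [X in _ = X -> _](bigD1 i0)//= E0 => H.
transitivity (\int[P]_w \prod_i g' i (W i w)).
  apply: eq_Rintegral => w _; rewrite [RHS](bigD1 i0)//= E0 mulrC; congr (_ * _).
  by apply: eq_bigr => i /E1 ->.
by rewrite H mulrC; congr (_ * _); apply: eq_bigr => i /E1 ->.
Qed.

Lemma independent_variables_pair (I : finType) (W : I -> T -> R) (i j : I) :
  independent_variables W -> i != j -> forall A B : set R,
  measurable A -> measurable B ->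
  P ((W i @^-1` A) `&` (W j @^-1` B)) = (P (W i @^-1` A) * P (W j @^-1` B))%E.
Proof.
move=> iW ij A B mA mB.
pose C k : set R := if k == i then A else if k == j then B else setT.
have Ci : C i = A by rewrite /C eqxx.
have Cj : C j = B by rewrite /C eq_sym (negbTE ij) eqxx.
have mC k : measurable (C k) by rewrite /C; case: ifP => // _; case: ifP.
have := iW (fun k => W k @^-1` C k).
have -> : \bigcap_(k in [set: I]) W k @^-1` C k = (W i @^-1` A) `&` (W j @^-1` B).
  apply/seteqP; split => [w Cw|w [wA wB] k _].
    by split; [have := Cw i Logic.I; rewrite /= Ci|have := Cw j Logic.I; rewrite /= Cj].
  by rewrite /C/=; case: eqP => [->//|_]; case: eqP => [->|].
move=> ->; last by move=> k; exists (C k) => //; rewrite setTI.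
rewrite (bigD1 i)//= Ci (bigD1 j)/= ?Cj; last by rewrite eq_sym.
rewrite big1 ?mule1// => k /andP[ki kj].
by rewrite /C (negbTE ki) (negbTE kj) preimage_setT probability_setT.
Qed.

(** For nonnegative functions of U and V, indicators are replaced by general
    functions, first in one factor and then in the other. The general case
    follows by taking positive and negative parts. *)
Lemma expectation_mul (U V : T -> R) :
  measurable_fun [set: T] U -> measurable_fun [set: T] V ->
  (forall A B : set R, measurable A -> measurable B ->
     P ((U @^-1` A) `&` (V @^-1` B)) = (P (U @^-1` A) * P (V @^-1` B))%E) ->
  P.-integrable [set: T] (EFin \o U) -> P.-integrable [set: T] (EFin \o V) ->
  P.-integrable [set: T] (EFin \o (fun w => U w * V w)) /\
  \int[P]_w (U w * V w) = \int[P]_w U w * \int[P]_w V w.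
Proof.
move=> mU mV UV IU IV.
have ge0mul (g h : R -> R) : measurable_fun [set: R] g -> measurable_fun [set: R] h ->
    (forall x, 0 <= g x) -> (forall x, 0 <= h x) ->
    P.-integrable [set: T] (EFin \o (g \o U)) ->
    P.-integrable [set: T] (EFin \o (h \o V)) ->
    P.-integrable [set: T] (EFin \o (fun w => g (U w) * h (V w))) /\
    \int[P]_w (g (U w) * h (V w)) = \int[P]_w g (U w) * \int[P]_w h (V w).
  move=> mg mh g0 h0 Ig Ih.
  have mgU : measurable_fun [set: T] (g \o U) by exact: measurableT_comp.
  have mhV : measurable_fun [set: T] (h \o V) by exact: measurableT_comp.
  have fg := integrable_fin_num measurableT Ig.
  have fh := integrable_fin_num measurableT Ih.
  have mpre (W : T -> R) (B : set R) : measurable_fun [set: T] W -> measurable B ->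
      measurable (W @^-1` B).
    by move=> mW mB; rewrite -[X in measurable X]setTI; exact: mW.
  have m1 (W : T -> R) (B : set R) : measurable_fun [set: T] W -> measurable B ->
      measurable_fun [set: T] (fun w => \1_B (W w) : R).
    by move=> mW mB; apply: measurableT_comp => //; exact: measurable_indic.
  have E : (\int[P]_w ((g (U w))%:E * (h (V w))%:E) =
      (fine (\int[P]_w (g (U w))%:E))%:E * \int[P]_w (h (V w))%:E)%E.
    apply: (ge0_integral_weight (Y := g \o U) (g := EFin \o h)) => //.
    - by move=> w; exact: g0.
    - by apply: fine_ge0; apply: integral_ge0 => w _; rewrite lee_fin.
    - move=> B mB; rewrite fineK//.
      under eq_integral do rewrite muleC.
      transitivity ((fine (P (V @^-1` B)))%:E * \int[P]_w (g (U w))%:E)%E; last first.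
        by rewrite fineK; [exact: muleC|apply: fin_num_measure; exact: mpre].
      apply: (ge0_integral_weight (Y := (fun w => \1_B (V w))) (g := EFin \o g)) => //.
      + exact: m1.
      + by apply: fine_ge0; exact: measure_ge0.
      + move=> A mA; rewrite fineK ?fin_num_measure//; last exact: mpre.
        rewrite [RHS]muleC -UV// -[X in P X]setIT -integral_indic//; last first.
          by apply: measurableI; exact: mpre.
        apply: eq_integral => w _; rewrite -EFinM mulrC; congr EFin.
        by rewrite indicI.
      + exact/measurable_EFinP.
    - exact/measurable_EFinP.
  split; last first.
    by rewrite {1}/Rintegral; under eq_integral do rewrite EFinM; rewrite E fineM.
  apply/integrableP; split; first by apply/measurable_EFinP; exact: measurable_funM.
  rewrite (_ : (\int[P]_x _)%E = (\int[P]_w ((g (U w))%:E * (h (V w))%:E))%E).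
    by rewrite E ltey_eq fin_numM.
  by apply: eq_integral => w _; rewrite /= ger0_norm ?mulr_ge0.
pose p (x : R) := Num.max x 0; pose q (x : R) := Num.max (- x) 0.
have mp : measurable_fun [set: R] p by exact: measurable_maxr.
have mq : measurable_fun [set: R] q.
  by apply: measurable_maxr => //; exact: measurable_funN.
have p0 x : 0 <= p x by rewrite le_max lexx orbT.
have q0 x : 0 <= q x by rewrite le_max lexx orbT.
have pq x : x = p x - q x.
  rewrite /p /q; case/orP: (le_total 0 x) => x0.
    by rewrite (max_l x0) max_r ?oppr_le0// subr0.
  by rewrite (max_r x0) max_l ?oppr_ge0// sub0r opprK.
have Ipq (W : T -> R) (g : R -> R) : P.-integrable [set: T] (EFin \o W) -> measurable_fun [set: T] W ->
    measurable_fun [set: R] g -> (forall x, `|g x| <= `|x|) ->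
    P.-integrable [set: T] (EFin \o (g \o W)).
  move=> IW mW mg gx; apply: le_integrable IW => //.
  - by apply/measurable_EFinP; exact: measurableT_comp.
  - by move=> w _; rewrite /= lee_fin.
have px x : `|p x| <= `|x|.
  by rewrite ger0_norm// /p ge_max normr_ge0 ler_norm.
have qx x : `|q x| <= `|x|.
  by rewrite ger0_norm// /q ge_max normr_ge0 -normrN ler_norm.
have IpU := Ipq _ _ IU mU mp px; have IqU := Ipq _ _ IU mU mq qx.
have IpV := Ipq _ _ IV mV mp px; have IqV := Ipq _ _ IV mV mq qx.
have [Ipp Epp] := ge0mul _ _ mp mp p0 p0 IpU IpV.
have [Ipq' Epq] := ge0mul _ _ mp mq p0 q0 IpU IqV.
have [Iqp Eqp] := ge0mul _ _ mq mp q0 p0 IqU IpV.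
have [Iqq Eqq] := ge0mul _ _ mq mq q0 q0 IqU IqV.
have I1 := integrableB measurableT Ipp Ipq'.
have I2 := integrableB measurableT Iqp Iqq.
have E : (fun w => U w * V w) = (fun w => (p (U w) * p (V w) - p (U w) * q (V w)) -
    (q (U w) * p (V w) - q (U w) * q (V w))).
  by apply/funext => w; rewrite {1}(pq (U w)) {1}(pq (V w)); ring.
rewrite E; split; first exact: (integrableB measurableT I1 I2).
have EU : \int[P]_w U w = \int[P]_w p (U w) - \int[P]_w q (U w).
  by rewrite -RintegralB//; apply: eq_Rintegral => w _; exact: pq.
have EV : \int[P]_w V w = \int[P]_w p (V w) - \int[P]_w q (V w).
  by rewrite -RintegralB//; apply: eq_Rintegral => w _; exact: pq.
rewrite (RintegralB measurableT I1 I2) (RintegralB measurableT Ipp Ipq').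
rewrite (RintegralB measurableT Iqp Iqq) Epp Epq Eqp Eqq EU EV; ring.
Qed.

Lemma integrable_sum_seq (I : Type) (s : seq I) (f : I -> T -> R) :
  (forall i, P.-integrable [set: T] (EFin \o f i)) ->
  P.-integrable [set: T] (EFin \o (fun w => \sum_(i <- s) f i w)) /\
  \int[P]_w (\sum_(i <- s) f i w) = \sum_(i <- s) \int[P]_w f i w.
Proof.
move=> If; elim: s => [|i s [IHi IHe]].
  have -> : (fun w : T => \sum_(i <- [::]) f i w) = (fun=> 0).
    by apply/funext => w; rewrite big_nil.
  by rewrite big_nil Rintegral_setT_cst; split => //; exact: integrable0.
have -> : (fun w : T => \sum_(i <- i :: s) f i w) =
    (fun w => f i w + \sum_(i <- s) f i w).
  by apply/funext => w; rewrite big_cons.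
rewrite big_cons RintegralD_setT// IHe; split => //.
exact: (integrableD measurableT (If i) IHi).
Qed.

(** The off-diagonal terms vanish by independence and centring. *)
Lemma expectation_sum_sqr n (W : 'I_n -> T -> R) (v : R) :
  independent_variables W -> (forall i, measurable_fun [set: T] (W i)) ->
  (forall i, P.-integrable [set: T] (EFin \o W i)) ->
  (forall i, P.-integrable [set: T] (EFin \o (fun w => W i w ^+ 2))) ->
  (forall i, \int[P]_w W i w = 0) -> (forall i, \int[P]_w (W i w ^+ 2) = v) ->
  P.-integrable [set: T] (EFin \o (fun w => (\sum_i W i w) ^+ 2)) /\
  \int[P]_w ((\sum_i W i w) ^+ 2) = n%:R * v.
Proof.
move=> iW mW IW IW2 W0 W2.
have E : (fun w => (\sum_i W i w) ^+ 2) =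
    (fun w => \sum_i \sum_j W i w * W j w).
  by apply/funext => w; rewrite expr2 mulr_suml; apply: eq_bigr => i _; rewrite mulr_sumr.
have IWW i j : P.-integrable [set: T] (EFin \o (fun w => W i w * W j w)) /\
    \int[P]_w (W i w * W j w) = if i == j then v else 0.
  have [->|ij] := eqVneq i j.
    by split; [exact: IW2|exact: W2].
  have [] := expectation_mul (mW i) (mW j) (independent_variables_pair iW ij) (IW i) (IW j).
  by rewrite !W0 mulr0.
have I2 i := integrable_sum_seq (index_enum 'I_n) (fun j => (IWW i j).1).
have [I3 E3] := integrable_sum_seq (index_enum 'I_n) (fun i => (I2 i).1).
rewrite E; split => //; rewrite E3.
under eq_bigr => i _.
  rewrite (I2 i).2; under eq_bigr do rewrite (IWW _ _).2.
  rewrite -big_mkcond/= (big_pred1 i) => [|j]; [|by rewrite /= eq_sym]; over.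
by rewrite sumr_const card_ord mulr_natl.
Qed.

End independent_variables.

(** * Stochastic integrals against a Poisson process *)

Lemma centering d (T : measurableType d) (R : realType) (P : probability T R)
    (Y : T -> R) (c v : R) :
  P.-integrable [set: T] (EFin \o Y) -> P.-integrable [set: T] (EFin \o (fun w => Y w ^+ 2)) ->
  \int[P]_w Y w = c -> \int[P]_w (Y w ^+ 2) = v + c ^+ 2 ->
  [/\ P.-integrable [set: T] (EFin \o (fun w => Y w - c)),
      P.-integrable [set: T] (EFin \o (fun w => (Y w - c) ^+ 2)),
      \int[P]_w (Y w - c) = 0 & \int[P]_w ((Y w - c) ^+ 2) = v].
Proof.
move=> I1 I2 E1 E2.
have Ic (k : R) : P.-integrable [set: T] (EFin \o (fun=> k)).
  by apply: (@bounded_integrable _ _ _ _ _ `|k|).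
have IZ (k : R) g : P.-integrable [set: T] (EFin \o g) ->
    P.-integrable [set: T] (EFin \o (fun w => k * g w)).
  by move=> Ig; have := integrableZl measurableT k Ig.
have II := integrableB measurableT I2 (IZ (2 * c) _ I1).
have -> : (fun w => (Y w - c) ^+ 2) = (fun w => (Y w ^+ 2 - 2 * c * Y w) + c ^+ 2).
  by apply/funext => w; ring.
split.
- exact: (integrableB measurableT I1 (Ic c)).
- exact: (integrableD measurableT II (Ic (c ^+ 2))).
- by rewrite (RintegralB measurableT I1 (Ic c)) E1 Rintegral_setT_cst subrr.
- rewrite (RintegralD measurableT II (Ic (c ^+ 2))).
  rewrite (RintegralB measurableT I2 (IZ (2 * c) _ I1)) (RintegralZl (2 * c) measurableT I1).
  by rewrite E1 E2 Rintegral_setT_cst; ring.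
Qed.

Section density_integrals.
Context d (T : measurableType d) (R : realType) (mu : {measure set T -> \bar R}).
Variables (w : T -> R) (mw : measurable_fun [set: T] w) (w0 : forall x, 0 <= w x).

Lemma density_set A : measurable A ->
  density mu mw w0 A = (\int[mu]_(x in A) (w x)%:E)%E.
Proof.
move=> mA; rewrite [RHS]integral_mkcond; apply: eq_integral => x _.
by rewrite /= patchE diracE; case: (x \in A); rewrite ?mule1 ?mule0.
Qed.

Lemma ge0_integral_density_in D (f : T -> \bar R) : measurable D ->
  (forall x, 0 <= f x)%E -> measurable_fun D f ->
  (\int[density mu mw w0]_(x in D) f x = \int[mu]_(x in D) ((w x)%:E * f x))%E.
Proof.
move=> mD f0 mf; rewrite integral_mkcond ge0_integral_density; last 2 first.
- by move=> x; rewrite patchE; case: ifPn.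
- exact/(measurable_restrictT f mD).
rewrite [RHS]integral_mkcond; apply: eq_integral => x _.
by rewrite !patchE; case: ifPn => // _; rewrite mule0.
Qed.

End density_integrals.

Definition bounded_measurable d (T : measurableType d) (R : realType)
    (D : set T) (phi : T -> R) : Prop :=
  measurable_fun D phi /\ exists M : R, forall t, D t -> `|phi t| <= M.

Section bounded_measurable.
Context d (T : measurableType d) (R : realType) (D : set T).
Hypothesis mD : measurable D.
Implicit Types phi psi : T -> R.
Local Notation bm := (@bounded_measurable d T R D).

Lemma bounded_measurable_integrable (mu : {measure set T -> \bar R}) phi :
  (mu D < +oo)%E -> bm phi -> mu.-integrable D (EFin \o phi).
Proof.
move=> muD [mp [M pM]]; apply: measurable_bounded_integrable => //.
by exists M; split; [exact: num_real|move=> x Mx w Dw; exact: le_trans (pM w Dw) (ltW Mx)].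
Qed.

Lemma bounded_measurable_cst (c : R) : bm (fun=> c).
Proof. by split; [exact: measurable_cst|exists `|c|]. Qed.

Lemma bounded_measurableD phi psi : bm phi -> bm psi -> bm (fun t => phi t + psi t).
Proof.
move=> [mp [M pM]] [mq [N qN]]; split; first exact: measurable_funD.
by exists (M + N) => t Dt; rewrite (le_trans (ler_normD _ _))// lerD// ?pM ?qN.
Qed.

Lemma bounded_measurableM phi psi : bm phi -> bm psi -> bm (fun t => phi t * psi t).
Proof.
move=> [mp [M pM]] [mq [N qN]]; split; first exact: measurable_funM.
by exists (M * N) => t Dt; rewrite normrM ler_pM// ?pM ?qN.
Qed.

Lemma bounded_measurableN phi : bm phi -> bm (fun t => - phi t).
Proof.
move=> [mp [M pM]]; split; first exact: measurable_funN.
by exists M => t Dt; rewrite normrN pM.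
Qed.

Lemma bounded_measurableB phi psi : bm phi -> bm psi -> bm (fun t => phi t - psi t).
Proof. by move=> bp bq; apply: bounded_measurableD => //; exact: bounded_measurableN. Qed.

Lemma bounded_measurableZ (c : R) phi : bm phi -> bm (fun t => c * phi t).
Proof. by move=> bp; apply: bounded_measurableM => //; exact: bounded_measurable_cst. Qed.

Lemma bounded_measurable_sqr phi : bm phi -> bm (fun t => phi t ^+ 2).
Proof. by move=> bp; exact: (bounded_measurableM bp bp). Qed.

End bounded_measurable.

Section poisson_integral.
Context (R : realType) (tau : R) (f : R -> R) (lo hi : R).
Hypothesis tau0 : 0 < tau.
Hypothesis mf : measurable_fun (`[0, tau]%classic : set R) f.
Hypothesis lo0 : 0 < lo.
Hypothesis f_bnd : forall t, t \in `[0, tau] -> lo <= f t <= hi.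

Let D : set (measurableTypeR R) := `]0, tau]%classic.
Local Notation leb := (@lebesgue_measure R).
Local Notation oc a b := (`]a, b]%classic : set (measurableTypeR R)).
Local Notation bm := (@bounded_measurable _ (measurableTypeR R) R D).

Let mD : measurable D.
Proof. exact: measurable_itv. Qed.

Lemma lebesgue_oc_lty (a b : R) : (leb (oc a b) < +oo)%E.
Proof. by rewrite lebesgue_measure_itv/=; case: ifP; rewrite ?ltry. Qed.

Lemma intensity_bounded_measurable : bm f.
Proof.
have DI : D `<=` `[0, tau]%classic.
  by move=> t; rewrite /D/= !in_itv/= => /andP[/ltW -> ->].
split; first exact: measurable_funS mf.
exists hi => t /DI /f_bnd /andP[ft1 ft2]; rewrite ger0_norm//.
by rewrite (le_trans _ ft1)// ltW.
Qed.

(** The mean of the stochastic integral of phi for a process with intensity f. *)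
Definition compensator (phi : R -> R) : R := \int[leb]_(t in D) (phi t * f t).

Definition stoch_int (x : cumulative R R) (phi : R -> R) : R :=
  \int[lebesgue_stieltjes_measure x]_(t in D) phi t.

Lemma lsm_lty (x : cumulative R R) : (lebesgue_stieltjes_measure x D < +oo)%E.
Proof. by rewrite lsm_oc ?ltry// ltW. Qed.

Lemma stoch_intD x phi psi : bm phi -> bm psi ->
  stoch_int x (fun t => phi t + psi t) = stoch_int x phi + stoch_int x psi.
Proof.
by move=> bp bq; rewrite /stoch_int RintegralD//;
  apply: bounded_measurable_integrable => //; exact: lsm_lty.
Qed.

Lemma stoch_intZ x (c : R) phi : bm phi ->
  stoch_int x (fun t => c * phi t) = c * stoch_int x phi.
Proof.
by move=> bp; rewrite /stoch_int RintegralZl//;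
  apply: bounded_measurable_integrable => //; exact: lsm_lty.
Qed.

Lemma stoch_intB x phi psi : bm phi -> bm psi ->
  stoch_int x (fun t => phi t - psi t) = stoch_int x phi - stoch_int x psi.
Proof.
by move=> bp bq; rewrite /stoch_int RintegralB//;
  apply: bounded_measurable_integrable => //; exact: lsm_lty.
Qed.

Lemma stoch_int_cst (x : cumulative R R) (c : R) : stoch_int x (fun=> c) = c * (x tau - x 0).
Proof.
rewrite /stoch_int Rintegral_cst//; congr (_ * _).
by rewrite -[RHS]/(fine (x tau - x 0)%:E) -(lsm_oc x (ltW tau0)).
Qed.

Lemma le_stoch_int (x : cumulative R R) phi (M : R) : bm phi ->
  (forall t, D t -> `|phi t| <= M) -> `|stoch_int x phi| <= M * (x tau - x 0).
Proof.
move=> bp pM; rewrite -stoch_int_cst /stoch_int.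
have Ip : (lebesgue_stieltjes_measure x).-integrable D (EFin \o phi).
  by apply: bounded_measurable_integrable => //; exact: lsm_lty.
apply: le_trans (le_normr_Rintegral mD Ip) _.
apply: le_Rintegral => //.
- exact: (integrable_norm Ip).
- apply: bounded_measurable_integrable => //; first exact: lsm_lty.
  exact: bounded_measurable_cst.
Qed.

Lemma eq_stoch_int x phi psi : {in D, phi =1 psi} -> stoch_int x phi = stoch_int x psi.
Proof. exact: eq_Rintegral. Qed.

Let Icomp phi : bm phi -> leb.-integrable D (EFin \o (fun t => phi t * f t)).
Proof.
move=> bp; apply: bounded_measurable_integrable => //; first exact: lebesgue_oc_lty.
by apply: bounded_measurableM => //; exact: intensity_bounded_measurable.
Qed.

Lemma compensatorD phi psi : bm phi -> bm psi ->
  compensator (fun t => phi t + psi t) = compensator phi + compensator psi.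
Proof.
move=> bp bq; rewrite /compensator -RintegralD//; try exact: Icomp.
by apply: eq_Rintegral => t _; rewrite mulrDl.
Qed.

Lemma compensatorZ (c : R) phi : bm phi ->
  compensator (fun t => c * phi t) = c * compensator phi.
Proof.
move=> bp; rewrite /compensator -RintegralZl//; last exact: Icomp.
by apply: eq_Rintegral => t _; rewrite mulrA.
Qed.

Lemma compensatorB phi psi : bm phi -> bm psi ->
  compensator (fun t => phi t - psi t) = compensator phi - compensator psi.
Proof.
move=> bp bq; rewrite /compensator -RintegralB//; try exact: Icomp.
by apply: eq_Rintegral => t _; rewrite mulrBl.
Qed.

Lemma eq_compensator phi psi : {in D, phi =1 psi} -> compensator phi = compensator psi.
Proof. by move=> pq; apply: eq_Rintegral => t Dt; rewrite pq. Qed.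

Lemma le_compensator phi psi : bm phi -> bm psi ->
  (forall t, D t -> phi t <= psi t) -> compensator phi <= compensator psi.
Proof.
move=> bp bq pq; apply: le_Rintegral => //; try exact: Icomp.
move=> t Dt; apply: ler_wpM2r; last exact: pq.
have /f_bnd /andP[ft _] : t \in `[0, tau].
  by move: Dt; rewrite /D/= !in_itv/= => /andP[/ltW -> ->].
by rewrite (le_trans _ ft)// ltW.
Qed.

Lemma compensator1_ge0 : 0 <= compensator (fun=> 1).
Proof.
rewrite -[X in X <= _](_ : compensator (fun=> 0) = 0).
  by apply: le_compensator => //; exact: bounded_measurable_cst.
by rewrite /compensator; under eq_Rintegral do rewrite mul0r; rewrite Rintegral_cst// mul0r.
Qed.

Lemma norm_compensator_le phi (M : R) : bm phi ->
  (forall t, D t -> `|phi t| <= M) -> `|compensator phi| <= M * compensator (fun=> 1).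
Proof.
move=> bp pM; have b1 : bm (fun=> 1) by exact: bounded_measurable_cst.
rewrite -compensatorZ// ler_norml; apply/andP; split.
  rewrite -mulN1r -compensatorZ; last exact: bounded_measurableZ.
  apply: le_compensator => //; first by do 2 apply: bounded_measurableZ => //.
  by move=> t /pM; rewrite mulr1 mulN1r ler_norml => /andP[].
apply: le_compensator => //; first exact: bounded_measurableZ.
by move=> t /pM; rewrite mulr1 ler_norml => /andP[].
Qed.

Let f0 : measurableTypeR R -> R := f \_ D.

Let mf0 : measurable_fun [set: measurableTypeR R] f0.
Proof. by apply/(measurable_restrictT f mD); case: intensity_bounded_measurable. Qed.

Let f0_ge0 t : 0 <= f0 t.
Proof.
rewrite /f0 patchE; case: ifPn => //; rewrite inE /D/= in_itv/= => /andP[t0 tt].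
have /f_bnd /andP[ft _] : t \in `[0, tau] by rewrite in_itv/= (ltW t0).
by rewrite (le_trans _ ft)// ltW.
Qed.

(** The mean of the count at time t for a process with intensity f. *)
Definition mean_count (t : R) : R := \int[leb]_(r in `]0, t]) f r.

(** The sigma-algebra on the sample space is any one for which the observed
    values of X are measurable. With the one generated by the process itself,
    independence passes from the processes to their stochastic integrals. *)
Lemma measurable_stoch_int_kernel d (T : measurableType d) (X : T -> cumulative R R) phi :
  (forall t, t \in `[0, tau] -> measurable_fun [set: T] (fun w => X w t)) ->
  bm phi -> measurable_fun [set: T] (fun w => stoch_int (X w) phi).
Proof.
move=> mX bp; have [mp [M pM]] := bp.
have bc : bm (fun=> M) by exact: bounded_measurable_cst.
pose h t : \bar R := ((fun t => phi t + M) \_ D t)%:E.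
have h0 t : (0 <= h t)%E.
  rewrite lee_fin patchE; case: ifPn => //; rewrite inE => /pM.
  by rewrite ler_norml -lerBlDr sub0r => /andP[].
have mh : measurable_fun [set: measurableTypeR R] h.
  by apply/measurable_EFinP/(measurable_restrictT _ mD); exact: measurable_funD.
have -> : (fun w => stoch_int (X w) phi) =
    (fun w => fine (\int[jump_measure tau X w]_t h t) - M * (X w tau - X w 0))%R.
  apply/funext => w; rewrite ge0_integral_mrestr//.
  rewrite -stoch_int_cst (_ : fine _ = stoch_int (X w) (fun t => phi t + M)).
    by rewrite stoch_intD// addrK.
  congr fine; apply: eq_integral => t tD; rewrite /h patchE.
  by rewrite tD.
apply: measurable_funB.
  apply: measurableT_comp => //.
  by apply: measurable_fun_integral_kernel => // U mU; exact: measurable_jump.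
apply: measurable_funM => //; apply: measurable_funB; apply: mX; rewrite in_itv/= ?lexx ?(ltW tau0)//.
Qed.

Section observed_process.
Context d (T : measurableType d) (P : probability T R) (X : T -> cumulative R R).
Hypothesis HX : poisson_process tau f P X.

Lemma sub_oc (a b : R) : 0 <= a -> b <= tau -> oc a b `<=` D.
Proof.
move=> a0 bt t; rewrite /D/= !in_itv/= => /andP[ta tb].
by rewrite (le_lt_trans a0 ta) (le_trans tb bt).
Qed.

Let If (a b : R) : 0 <= a -> b <= tau -> leb.-integrable (oc a b) (EFin \o f).
Proof.
move=> a0 bt; apply: (@integrableS _ _ _ leb D) => //; first exact: sub_oc.
apply: bounded_measurable_integrable => //; first exact: lebesgue_oc_lty.
exact: intensity_bounded_measurable.
Qed.

Lemma increment_mean (s t : R) : 0 <= s -> s <= t -> t <= tau ->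
  \int[leb]_(r in `]s, t]) f r = mean_count t - mean_count s.
Proof.
move=> s0 st tt; apply/eqP; rewrite -(subr_eq _ _ (- _)) opprK addrC; apply/eqP.
rewrite /mean_count.
have -> : (`]0, t]%classic : set R) = `]0, s]%classic `|` `]s, t]%classic.
  by rewrite -itv_bndbnd_setU// bnd_simp.
rewrite Rintegral_setU//.
- rewrite (_ : _ `|` _ = oc 0 t); first exact: If.
  by rewrite -itv_bndbnd_setU// bnd_simp.
- apply/disj_setPRL => x /=; rewrite !in_itv/= => /andP[sx _].
  by apply/negP; rewrite negb_and -(ltNge s) sx orbT.
Qed.

Lemma increment_mean_gt0 (s t : R) : 0 <= s -> s < t -> t <= tau ->
  0 < \int[leb]_(r in `]s, t]) f r.
Proof.
move=> s0 st tt.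
have : lo * (t - s) <= \int[leb]_(r in `]s, t]) f r.
  have -> : lo * (t - s) = \int[leb]_(r in `]s, t]) (cst lo r).
    rewrite Rintegral_cst//; congr (_ * _).
    by rewrite /= lebesgue_measure_itv/= lte_fin st.
  apply: le_Rintegral => //.
  - apply: bounded_measurable_integrable => //; first exact: lebesgue_oc_lty.
    exact: bounded_measurable_cst.
  - exact: If.
  - move=> x; rewrite /= in_itv/= => /andP[sx xt].
    suff /f_bnd/andP[] : x \in `[0, tau] by [].
    by rewrite in_itv/= (le_trans s0 (ltW sx)) (le_trans xt).
by apply: lt_le_trans; rewrite mulr_gt0// subr_gt0.
Qed.

Lemma mean_count0 : mean_count 0 = 0.
Proof. by rewrite /mean_count set_itvoc0 Rintegral_set0. Qed.

Let mX t : 0 <= t -> t <= tau -> measurable_fun [set: T] (fun w => X w t).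
Proof. by move=> t0 tt; apply: (poisson_measurable HX); rewrite in_itv/= t0. Qed.

Let Xcount (s t : R) : 0 <= s -> s <= t -> t <= tau ->
  forall w, exists k : nat, X w t - X w s = k%:R.
Proof.
move=> s0 st tt w.
have [|k tk] := poisson_counting HX w (t := t); first by rewrite in_itv/= (le_trans s0 st).
have [|l sl] := poisson_counting HX w (t := s); first by rewrite in_itv/= s0 (le_trans st).
exists (k - l)%N; rewrite tk sl natrB//.
by rewrite -(ler_nat R) -tk -sl; exact: cumulative_is_nondecreasing.
Qed.

Lemma increment_moments (s t : R) : 0 <= s -> s <= t -> t <= tau ->
  let m := mean_count t - mean_count s in
  [/\ (\int[P]_w (X w t - X w s)%:E = m%:E)%E,
      (\int[P]_w ((X w t - X w s) ^+ 2)%:E = (m ^+ 2 + m)%:E)%E &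
      (\int[P]_w ((X w t - X w s) ^+ 3)%:E = (m ^+ 3 + 3 * m ^+ 2 + m)%:E)%E].
Proof.
move=> s0 + tt m; rewrite le_eqVlt => /predU1P[st|st].
  rewrite /m st subrr !expr0n/= mulr0 !addr0.
  by split; apply: integral0_eq => w _; rewrite subrr// ?expr0n.
have mN : measurable_fun [set: T] (fun w => X w t - X w s).
  by apply: measurable_funB; apply: mX; rewrite ?(ltW (le_lt_trans s0 st))// (le_trans (ltW st)).
have m0 := increment_mean_gt0 s0 st tt.
have PN := poisson_increments HX s0 st tt.
rewrite increment_mean ?(ltW st)// in m0 PN.
have Nn := Xcount s0 (ltW st) tt.
split.
- exact: (poisson_mean mN Nn m0 PN).
- exact: (poisson_moment2 mN Nn m0 PN).
- exact: (poisson_moment3 mN Nn m0 PN).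
Qed.

Let ge0_integrable (Y : T -> R) (c : R) : measurable_fun [set: T] Y ->
  (forall w, 0 <= Y w) -> (\int[P]_w (Y w)%:E = c%:E)%E ->
  P.-integrable [set: T] (EFin \o Y).
Proof.
move=> mY Y0 Yc; apply/integrableP; split; first exact/measurable_EFinP.
under eq_integral do rewrite /= ger0_norm//.
by rewrite Yc ltry.
Qed.

Let X0 w : X w 0 = 0. Proof. exact: poisson_start HX w. Qed.

Let Xge0 w t : 0 <= t -> 0 <= X w t.
Proof. by move=> t0; rewrite -(X0 w); exact: cumulative_is_nondecreasing. Qed.

(** The increment from s to t is independent of the count at time s. *)
Lemma covariance_count (s t : R) : 0 <= s -> s <= t -> t <= tau ->
  (\int[P]_w (X w s * X w t)%:E =
   (mean_count s * mean_count t + mean_count s)%:E)%E.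
Proof.
move=> s0 st tt; have stau := le_trans st tt; have t0 := le_trans s0 st.
have [Es Es2 _] := increment_moments (lexx 0) s0 stau.
have [Et Et2 _] := increment_moments s0 st tt.
have mXs := mX s0 stau; have mXt := mX t0 tt.
have mI : measurable_fun [set: T] (fun w => X w t - X w s) by exact: measurable_funB.
have Ige0 w : 0 <= X w t - X w s.
  by rewrite subr_ge0; exact: cumulative_is_nondecreasing.
rewrite mean_count0 subr0 in Es Es2.
have EsE : (\int[P]_w (X w s)%:E = (mean_count s)%:E)%E.
  by rewrite -Es; apply: eq_integral => w _; rewrite X0 subr0.
have Es2E : (\int[P]_w (X w s ^+ 2)%:E = (mean_count s ^+ 2 + mean_count s)%:E)%E.
  by rewrite -Es2; apply: eq_integral => w _; rewrite X0 subr0.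
have IXs := ge0_integrable mXs (fun w => Xge0 w s0) EsE.
have II := ge0_integrable mI Ige0 Et.
have mXs2 : measurable_fun [set: T] (fun w => X w s ^+ 2) by exact: measurable_funX.
have IXs2 := ge0_integrable mXs2 (fun w => sqr_ge0 _) Es2E.
have indep A B : measurable A -> measurable B ->
    P ((fun w => X w s) @^-1` A `&` (fun w => X w t - X w s) @^-1` B) =
    (P ((fun w => X w s) @^-1` A) * P ((fun w => X w t - X w s)%R @^-1` B))%E.
  move=> mA mB.
  pose u (i : nat) := if i is 0%N then 0 else if i is 1%N then s else t.
  have H := @poisson_indep_increments _ _ _ _ _ _ _ HX 2%N u.
  have : mutually_independent P (fun i : 'I_2 => sigma_of (fun w => X w (u i.+1) - X w (u i))).
    apply: H => [[|[|[|//]]] _|[|[|//]] _] //=; rewrite in_itv/= ?lexx ?s0 ?t0 ?(ltW tau0)//.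
  have o01 : @ord0 1 != ord_max :> 'I_2 by [].
  move=> /independent_variables_pair /(_ o01 A B mA mB) /=.
  have -> : (fun w => X w s - X w 0) = (fun w => X w s).
    by apply/funext => w; rewrite X0 subr0.
  by [].
have [Imul Emul] := expectation_mul mXs mI indep IXs II.
have -> : (fun w => (X w s * X w t)%:E) =
    (fun w => (X w s ^+ 2)%:E + (X w s * (X w t - X w s))%:E)%E.
  by apply/funext => w; rewrite -EFinD; congr EFin; ring.
rewrite (integralD measurableT IXs2 Imul) Es2E.
rewrite -[X in (_ + X)%E]fineK; last exact: (integrable_fin_num measurableT Imul).
rewrite -[fine _]/(\int[P]_w (X w s * (X w t - X w s))) Emul /Rintegral EsE Et /=.
by rewrite -EFinD; congr EFin; ring.
Qed.

Lemma compensator_indic (h : R -> R) (t : R) : 0 <= t -> t <= tau ->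
  compensator (fun r => h r * \1_(oc 0 t) r) = \int[leb]_(r in oc 0 t) (h r * f r).
Proof.
move=> t0 tt; rewrite /compensator /Rintegral; congr fine.
rewrite -[in RHS](setIidr (sub_oc (lexx 0) tt)) integral_mkcondr.
apply: eq_integral => r _; rewrite patchE indicE; case: ifPn => _.
  by rewrite mulr1.
by rewrite mulr0 mul0r.
Qed.

Lemma bounded_measurable_indic (t : R) : bm (\1_(oc 0 t)).
Proof.
split; first exact: measurable_indic.
by exists 1 => r _; rewrite indicE; case: (_ \in _); rewrite ?normr1 ?normr0.
Qed.

Lemma compensator_mean_count (t : R) : 0 <= t -> t <= tau ->
  compensator (\1_(oc 0 t)) = mean_count t.
Proof.
move=> t0 tt; rewrite -[RHS](_ : \int[leb]_(r in oc 0 t) (1 * f r) = _).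
  by rewrite -compensator_indic//; apply: eq_compensator => r _; rewrite mul1r.
by apply: eq_Rintegral => r _; rewrite mul1r.
Qed.

Lemma ge0_stoch_intE (x : cumulative R R) phi : bm phi -> (forall t, 0 <= phi t) ->
  (stoch_int x phi)%:E = (\int[lebesgue_stieltjes_measure x]_(t in D) (phi t)%:E)%E.
Proof.
move=> bp p0; rewrite /stoch_int /Rintegral fineK//.
apply: integrable_fin_num => //.
by apply: bounded_measurable_integrable => //; exact: lsm_lty.
Qed.

Lemma stoch_int_ge0 (x : cumulative R R) phi : (forall t, 0 <= phi t) -> 0 <= stoch_int x phi.
Proof. by move=> p0; apply: Rintegral_ge0 => t _. Qed.

(** Here g is the density, with respect to the intensity, of the joint mean of
    the weight Y and the counts. *)
Lemma campbell_weight (Y : T -> R) (g phi : R -> R) :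
  measurable_fun [set: T] Y -> (forall w, 0 <= Y w) ->
  bm g -> (forall t, 0 <= g t) ->
  (forall t, 0 < t -> t <= tau ->
    (\int[P]_w (Y w * X w t)%:E = (compensator (fun r => g r * \1_(oc 0 t) r))%:E)%E) ->
  bm phi -> (forall t, 0 <= phi t) ->
  (\int[P]_w (Y w * stoch_int (X w) phi)%:E =
   (compensator (fun r => phi r * g r))%:E)%E.
Proof.
move=> mY Y0 bg g0 YX bp p0.
pose w0 : measurableTypeR R -> R := (fun r => g r * f r) \_ D.
have bgf : bm (fun r => g r * f r).
  by apply: bounded_measurableM => //; exact: intensity_bounded_measurable.
have mw0 : measurable_fun [set: measurableTypeR R] w0.
  by apply/(measurable_restrictT _ mD); case: bgf.
have w0E r : w0 r = (g r) * f0 r.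
  by rewrite /w0 /f0 !patchE; case: (r \in D); rewrite ?mulr0.
have w0_ge0 r : 0 <= w0 r by rewrite w0E mulr_ge0.
have mp : measurable_fun D (EFin \o phi) by apply/measurable_EFinP; case: bp.
have wA (t : R) : 0 <= t -> t <= tau -> density leb mw0 w0_ge0 (oc 0 t) =
    (compensator (fun r => g r * \1_(oc 0 t) r))%:E.
  move=> t0 tt; rewrite density_set// compensator_indic// /Rintegral fineK.
    apply: eq_integral => r rt; rewrite /w0 patchE ifT//.
    by rewrite inE; apply: (sub_oc (lexx 0) tt); rewrite inE in rt.
  apply: integrable_fin_num => //; apply: (@integrableS _ _ _ leb D) => //.
    exact: sub_oc.
  by apply: bounded_measurable_integrable => //; exact: lebesgue_oc_lty.
transitivity (\int[P]_w ((Y w)%:E *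
    \int[lebesgue_stieltjes_measure (X w)]_(t in D) (phi t)%:E))%E.
  by apply: eq_integral => w _; rewrite EFinM ge0_stoch_intE.
rewrite (@campbell _ _ tau0 _ _ _ (poisson_measurable HX) P Y (density leb mw0 w0_ge0)
  (EFin \o phi))//.
- rewrite ge0_integral_density_in//.
  rewrite /compensator /Rintegral fineK.
    apply: eq_integral => r rD; rewrite /w0 patchE rD -EFinM; congr EFin; ring.
  apply: integrable_fin_num => //; apply: bounded_measurable_integrable => //.
    exact: lebesgue_oc_lty.
  apply: bounded_measurableM; last exact: intensity_bounded_measurable.
  exact: bounded_measurableM.
- by rewrite wA ?ltry// ltW.
- by move=> t t0 tt; rewrite wA ?YX// ltW.
Qed.

Lemma bounded_measurable1 : bm (fun=> 1).
Proof. exact: bounded_measurable_cst. Qed.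

Lemma ge0_mean_stoch_int phi : bm phi -> (forall t, 0 <= phi t) ->
  (\int[P]_w (stoch_int (X w) phi)%:E = (compensator phi)%:E)%E.
Proof.
move=> bp p0.
transitivity (\int[P]_w (1 * stoch_int (X w) phi)%:E)%E.
  by apply: eq_integral => w _; rewrite mul1r.
rewrite (@campbell_weight (fun=> 1) (fun=> 1))//.
- by congr EFin; apply: eq_compensator => r _; rewrite mulr1.
- exact: bounded_measurable1.
- move=> t t0 tt; have [E _ _] := increment_moments (lexx 0) (ltW t0) tt.
  rewrite mean_count0 subr0 in E.
  transitivity (\int[P]_w (X w t - X w 0)%:E)%E.
    by apply: eq_integral => w _; rewrite mul1r X0 subr0.
  rewrite E -compensator_mean_count ?(ltW t0)//; congr EFin.
  by apply: eq_compensator => r _; rewrite mul1r.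
Qed.

Lemma measurable_stoch_int phi : bm phi ->
  measurable_fun [set: T] (fun w => stoch_int (X w) phi).
Proof. exact/measurable_stoch_int_kernel/(poisson_measurable HX). Qed.

(** Campbell's formula is used twice: the covariances of two counts give those
    of a stochastic integral and a count, and these give those of two stochastic
    integrals. *)
Lemma ge0_covariance_stoch_int phi psi : bm phi -> bm psi ->
  (forall t, 0 <= phi t) -> (forall t, 0 <= psi t) ->
  (\int[P]_w (stoch_int (X w) phi * stoch_int (X w) psi)%:E =
   (compensator (fun t => phi t * psi t) + compensator phi * compensator psi)%:E)%E.
Proof.
move=> bp bq p0 q0.
have mean_count_ge0 t : 0 <= t -> t <= tau -> 0 <= mean_count t.
  move=> t0 tt; rewrite -compensator_mean_count//.
  apply: Rintegral_ge0 => r rD; rewrite mulr_ge0 ?indicE//.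
  by have := f0_ge0 r; rewrite /f0 patchE mem_set.
have comp_ge0 h : (forall t, 0 <= h t) -> 0 <= compensator h.
  move=> h0; apply: Rintegral_ge0 => r rD; rewrite mulr_ge0//.
  by have := f0_ge0 r; rewrite /f0 patchE mem_set.
have EX h (t : R) : bm h -> (forall r, 0 <= h r) -> 0 < t -> t <= tau ->
    (\int[P]_w (stoch_int (X w) h * X w t)%:E =
     (compensator (fun r => (compensator h + h r) * \1_(oc 0 t) r))%:E)%E.
  move=> bh h0 t0 tt.
  transitivity (\int[P]_w (X w t * stoch_int (X w) h)%:E)%E.
    by apply: eq_integral => w _; rewrite mulrC.
  have b1t := bounded_measurable_indic t.
  rewrite (@campbell_weight (fun w => X w t) (fun r => mean_count t + \1_(oc 0 t) r))//.
  - have E1 := compensatorD (bounded_measurableZ (mean_count t) bh) (bounded_measurableM bh b1t).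
    have E2 := compensatorD (bounded_measurableZ (compensator h) b1t) (bounded_measurableM bh b1t).
    congr EFin; transitivity (mean_count t * compensator h + compensator (fun r => h r * \1_(oc 0 t) r)).
      rewrite -compensatorZ// -E1; apply: eq_compensator => r _; ring.
    rewrite mulrC -(compensator_mean_count (ltW t0) tt) -compensatorZ// -E2.
    by apply: eq_compensator => r _; ring.
  - by apply: mX => //; exact: ltW.
  - by move=> w; apply: Xge0; exact: ltW.
  - by apply: bounded_measurableD => //; exact: bounded_measurable_cst.
  - by move=> r; rewrite addr_ge0 ?indicE// mean_count_ge0// ltW.
  - move=> s s0 ss; have b1s := bounded_measurable_indic s.
    have -> : compensator (fun r => (mean_count t + \1_(oc 0 t) r) * \1_(oc 0 s) r) =
        mean_count t * mean_count s + compensator (fun r => \1_(oc 0 t) r * \1_(oc 0 s) r).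
      rewrite -(compensator_mean_count (ltW s0) ss) -compensatorZ//.
      rewrite -(compensatorD (bounded_measurableZ _ b1s) (bounded_measurableM b1t b1s)).
      by apply: eq_compensator => r _; ring.
    have I12 (a b : R) : a <= b ->
        (fun r => \1_(oc 0 a) r * \1_(oc 0 b) r : R) = \1_(oc 0 a).
      move=> ab; apply/funext => r; rewrite !indicE !mem_setE !in_itv/=.
      case: (0 < r) => //=; rewrite ?mulr0// ; case: (leP r a) => ra; rewrite ?mul0r//.
      by rewrite (le_trans ra ab) mulr1.
    have [ts|/ltW st] := leP t s.
      rewrite (covariance_count (ltW t0) ts ss) (I12 _ _ ts).
      by rewrite compensator_mean_count// ltW.
    under eq_integral do rewrite mulrC.
    rewrite (covariance_count (ltW s0) st tt).
    rewrite [X in compensator X](_ : _ = \1_(oc 0 s)).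
      by rewrite compensator_mean_count ?(ltW s0)// (mulrC (mean_count s)).
    by rewrite -[RHS](I12 _ _ st); apply/funext => r; rewrite mulrC.
rewrite (@campbell_weight (fun w => stoch_int (X w) phi) (fun r => compensator phi + phi r))//.
- have E := compensatorD (bounded_measurableM bp bq) (bounded_measurableZ (compensator phi) bq).
  rewrite -compensatorZ// -E; congr EFin; apply: eq_compensator => r _; ring.
- exact: measurable_stoch_int.
- by move=> w; exact: stoch_int_ge0.
- by apply: bounded_measurableD => //; exact: bounded_measurable_cst.
- by move=> r; rewrite addr_ge0// comp_ge0.
- by move=> t t0 tt; exact: EX.
Qed.

Let shift phi (M : R) t := (phi \_ D) t + M.

Let shift_ge0 phi (M : R) : 0 <= M -> (forall t, D t -> `|phi t| <= M) ->
  forall t, 0 <= shift phi M t.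
Proof.
move=> M0 pM t; rewrite /shift patchE; case: ifPn; last by rewrite add0r.
by rewrite inE => /pM; rewrite ler_norml -lerBlDr sub0r => /andP[].
Qed.

Let bounded_measurable_shift phi (M : R) : bm phi -> bm (shift phi M).
Proof.
move=> [mp [N pN]]; apply: bounded_measurableD; last exact: bounded_measurable_cst.
split; last by exists N => t Dt; rewrite patchE mem_set//; exact: pN.
by apply: measurable_funTS; exact/(measurable_restrictT _ mD).
Qed.

Let shiftE phi (M : R) : {in D, phi =1 (fun t => shift phi M t - M * 1)}.
Proof. by move=> t tD; rewrite /shift patchE tD mulr1 addrK. Qed.

(** On ]0, tau], phi is a nonnegative function minus a constant, and all the
    terms are bilinear. *)
Lemma stoch_int_moments phi : bm phi ->
  [/\ P.-integrable [set: T] (EFin \o (fun w => stoch_int (X w) phi)),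
      P.-integrable [set: T] (EFin \o (fun w => stoch_int (X w) phi ^+ 2)),
      \int[P]_w stoch_int (X w) phi = compensator phi &
      \int[P]_w (stoch_int (X w) phi ^+ 2) =
        compensator (fun t => phi t ^+ 2) + compensator phi ^+ 2].
Proof.
move=> bp; have [_ [M0 pM0]] := bp.
pose M := `|M0|; have M_ge0 : 0 <= M by exact: normr_ge0.
have pM t : D t -> `|phi t| <= M by move=> /pM0 /le_trans; apply; exact: ler_norm.
have h0 := shift_ge0 M_ge0 pM; have bh : bm (shift phi M) by exact: bounded_measurable_shift.
set h := shift phi M in h0 bh.
have one0 (t : R) : 0 <= 1 :> R by [].
have J0 g w : (forall t, 0 <= g t) -> 0 <= stoch_int (X w) g by exact: stoch_int_ge0.
pose J g w := stoch_int (X w) g.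
have mJ g : bm g -> measurable_fun [set: T] (J g) by exact: measurable_stoch_int.
have IJ g : bm g -> (forall t, 0 <= g t) ->
    P.-integrable [set: T] (EFin \o J g) /\ \int[P]_w J g w = compensator g.
  move=> bg g0; have E := ge0_mean_stoch_int bg g0.
  split; first exact: (ge0_integrable (mJ _ bg) (fun w => J0 _ w g0) E).
  by rewrite /Rintegral E.
have IJJ g k : bm g -> bm k -> (forall t, 0 <= g t) -> (forall t, 0 <= k t) ->
    P.-integrable [set: T] (EFin \o (fun w => J g w * J k w)) /\
    \int[P]_w (J g w * J k w) = compensator (fun t => g t * k t) + compensator g * compensator k.
  move=> bg bk g0 k0; have E := ge0_covariance_stoch_int bg bk g0 k0.
  split; last by rewrite /Rintegral E.
  apply: (ge0_integrable _ _ E); first by apply: measurable_funM; exact: mJ.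
  by move=> w; rewrite mulr_ge0// J0.
have [Ih Eh] := IJ _ bh h0; have [I1 E1] := IJ _ bounded_measurable1 one0.
have [Ihh Ehh] := IJJ _ _ bh bh h0 h0; have [Ih1 Eh1] := IJJ _ _ bh bounded_measurable1 h0 one0.
have [I11 E11] := IJJ _ _ bounded_measurable1 bounded_measurable1 one0 one0.
have bM1 := bounded_measurableZ M bounded_measurable1.
have JE w : stoch_int (X w) phi = J h w - M * J (fun=> 1) w.
  rewrite (eq_stoch_int _ (shiftE phi M)) stoch_intB//.
  by rewrite (stoch_intZ (X w) M bounded_measurable1).
have cE : compensator phi = compensator h - M * compensator (fun=> 1).
  by rewrite (eq_compensator (shiftE phi M)) compensatorB// (compensatorZ M bounded_measurable1).
have bhh := bounded_measurableM bh bh; have bh1 := bounded_measurableM bh bounded_measurable1.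
have b11 := bounded_measurableM bounded_measurable1 bounded_measurable1.
have c2E : compensator (fun t => phi t ^+ 2) =
    compensator (fun t => h t * h t) - (2 * M) * compensator (fun t => h t * 1) +
    M ^+ 2 * compensator (fun t => 1 * 1).
  have B1 := bounded_measurableZ (2 * M) bh1.
  rewrite -(compensatorZ (2 * M) bh1) -(compensatorZ (M ^+ 2) b11).
  rewrite -(compensatorB bhh B1).
  rewrite -(compensatorD (bounded_measurableB bhh B1) (bounded_measurableZ (M ^+ 2) b11)).
  by apply: eq_compensator => t tD; rewrite (shiftE phi M tD) -/h; ring.
have IZ (k : R) g : P.-integrable [set: T] (EFin \o g) ->
    P.-integrable [set: T] (EFin \o (fun w => k * g w)).
  by move=> Ig; have := integrableZl measurableT k Ig.
have Iphi : P.-integrable [set: T] (EFin \o (fun w => J h w - M * J (fun=> 1) w)).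
  exact: (integrableB measurableT Ih (IZ M _ I1)).
have II := integrableB measurableT Ihh (IZ (2 * M) _ Ih1).
have Iphi2 := integrableD measurableT II (IZ (M ^+ 2) _ I11).
have J2E w : stoch_int (X w) phi ^+ 2 = (J h w * J h w - 2 * M * (J h w * J (fun=> 1) w)) +
    M ^+ 2 * (J (fun=> 1) w * J (fun=> 1) w).
  by rewrite JE; ring.
have -> : (fun w => stoch_int (X w) phi) = (fun w => J h w - M * J (fun=> 1) w).
  exact/funext.
have -> : (fun w => stoch_int (X w) phi ^+ 2) =
    (fun w => (J h w * J h w - 2 * M * (J h w * J (fun=> 1) w)) +
    M ^+ 2 * (J (fun=> 1) w * J (fun=> 1) w)).
  exact/funext.
split=> //.
  rewrite (RintegralB measurableT Ih (IZ M _ I1)) (RintegralZl M measurableT I1).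
  by rewrite Eh E1 cE.
rewrite (RintegralD measurableT II (IZ (M ^+ 2) _ I11)).
rewrite (RintegralB measurableT Ihh (IZ (2 * M) _ Ih1)).
rewrite (RintegralZl (2 * M) measurableT Ih1) (RintegralZl (M ^+ 2) measurableT I11).
by rewrite Ehh Eh1 E11 cE c2E; ring.
Qed.

Definition centered_int phi w : R := stoch_int (X w) phi - compensator phi.

Lemma centered_int_moments phi : bm phi ->
  [/\ P.-integrable [set: T] (EFin \o centered_int phi),
      P.-integrable [set: T] (EFin \o (fun w => centered_int phi w ^+ 2)),
      \int[P]_w centered_int phi w = 0 &
      \int[P]_w (centered_int phi w ^+ 2) = compensator (fun t => phi t ^+ 2)].
Proof.
move=> bp; have [I1 I2 E1 E2] := stoch_int_moments bp.
exact: (centering I1 I2 E1 E2).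
Qed.

(** The centred integral is at most M times the count plus M times its mean, and
    (a + b)^3 <= 4 (a^3 + b^3) for nonnegative a and b. *)
Lemma centered_int_moment3 phi (M : R) : bm phi -> (forall t, D t -> `|phi t| <= M) ->
  0 <= M ->
  let L := mean_count tau in
  P.-integrable [set: T] (EFin \o (fun w => `|centered_int phi w| ^+ 3)) /\
  \int[P]_w (`|centered_int phi w| ^+ 3) <= 4 * M ^+ 3 * (2 * L ^+ 3 + 3 * L ^+ 2 + L).
Proof.
move=> bp pM M0 L.
have L0 : 0 <= L.
  by rewrite /L -compensator_mean_count ?(ltW tau0)//; apply: Rintegral_ge0 => t tD;
  rewrite mulr_ge0 ?indicE//; have := f0_ge0 t; rewrite /f0 patchE mem_set.
have [_ _ E3] := increment_moments (lexx 0) (ltW tau0) (lexx tau).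
rewrite mean_count0 subr0 -/L in E3.
have mN : measurable_fun [set: T] (fun w => (X w tau - X w 0) ^+ 3).
  by apply: measurable_funX; apply: measurable_funB; apply: mX => //; exact: ltW.
have N0 w : 0 <= X w tau - X w 0 by rewrite X0 subr0 Xge0// ltW.
have IN := ge0_integrable mN (fun w => exprn_ge0 3 (N0 w)) E3.
have Ic (k : R) : P.-integrable [set: T] (EFin \o (fun=> k)).
  by apply: (@bounded_integrable _ _ _ _ _ `|k|).
pose B w := 4 * M ^+ 3 * ((X w tau - X w 0) ^+ 3 + L ^+ 3).
have IND := integrableD measurableT IN (Ic (L ^+ 3)).
have IB : P.-integrable [set: T] (EFin \o B).
  by have := integrableZl measurableT (4 * M ^+ 3) IND.
have WB w : `|centered_int phi w| ^+ 3 <= B w.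
  have W1 : `|centered_int phi w| <= M * (X w tau - X w 0) + M * L.
    rewrite /centered_int (le_trans (ler_normB _ _))// lerD//; first exact: le_stoch_int.
    have /le_trans := norm_compensator_le bp pM; apply.
    rewrite (_ : compensator (fun=> 1) = L)// /L -compensator_mean_count ?(ltW tau0)//.
    by apply: eq_compensator => t tD; rewrite indicE tD.
  apply: (@le_trans _ _ ((M * (X w tau - X w 0) + M * L) ^+ 3)).
    by apply: lerXn2r; rewrite ?nnegrE// addr_ge0// mulr_ge0.
  have := N0 w; rewrite /B; move: (X w tau - X w 0) => a a0.
  rewrite -mulrDr exprMn (_ : 4 * _ * _ = M ^+ 3 * (4 * (a ^+ 3 + L ^+ 3))); last by ring.
  apply: ler_wpM2l; first exact: exprn_ge0.
  rewrite -subr_ge0 (_ : _ - _ = 3 * (a + L) * (a - L) ^+ 2); last by ring.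
  by apply: mulr_ge0; [apply: mulr_ge0; [exact: ler0n|exact: addr_ge0]|exact: sqr_ge0].
have mW : measurable_fun [set: T] (fun w => `|centered_int phi w| ^+ 3).
  apply: measurable_funX; apply: measurableT_comp => //; apply: measurable_funB => //.
  exact: measurable_stoch_int.
have IW : P.-integrable [set: T] (EFin \o (fun w => `|centered_int phi w| ^+ 3)).
  apply: le_integrable IB => //; first exact/measurable_EFinP.
  move=> w _; rewrite /= lee_fin ger0_norm ?exprn_ge0//.
  exact: le_trans (WB w) (ler_norm _).
split=> //.
apply: (@le_trans _ _ (\int[P]_w B w)); first exact: le_Rintegral.
rewrite /B (RintegralZl _ measurableT IND) (RintegralD measurableT IN (Ic (L ^+ 3))).
rewrite (Rintegral_setT_cst P (L ^+ 3)) /Rintegral E3 /=.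
by rewrite le_eqVlt; apply/orP; left; apply/eqP; ring.
Qed.

End observed_process.

End poisson_integral.

(** * Cosine transforms of sums of independent variables *)

Section mean_value_bounds.
Context (R : realType).

Lemma mean_value_le (f df : R -> R) (a b K : R) :
  (forall x, Num.min a b <= x <= Num.max a b -> is_derive x 1 f (df x)) ->
  (forall x, Num.min a b <= x <= Num.max a b -> `|df x| <= K) ->
  `|f b - f a| <= K * `|b - a|.
Proof.
wlog ab : a b / a <= b.
  move=> H D B; have [|/ltW ba] := leP a b; first by move=> ab; exact: H.
  rewrite distrC [X in _ * X]distrC; apply: H => // x; rewrite minC maxC.
    exact: D.
  exact: B.
rewrite (min_l ab) (max_r ab) => D B.
have [||c cab ->] := MVT_segment (f := f) (df := df) ab.
- by move=> x xab; apply: D; move: xab; rewrite in_itv/= => /andP[/ltW -> /ltW ->].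
- apply: derivable_within_continuous => x xab.
  by have [] : is_derive x 1 f (df x) by apply: D; rewrite in_itv in xab.
by rewrite normrM ler_wpM2r//; apply: B; rewrite in_itv in cab.
Qed.

Lemma mean_value_le0 (f df : R -> R) (x K : R) : f 0 = 0 ->
  (forall y : R, `|y| <= `|x| -> is_derive y 1 f (df y)) ->
  (forall y : R, `|y| <= `|x| -> `|df y| <= K) ->
  `|f x| <= K * `|x|.
Proof.
move=> f0 D B.
have H (y : R) : Num.min 0 x <= y <= Num.max 0 x -> `|y| <= `|x|.
  have [x0|/ltW x0] := leP 0 x.
    by move=> /andP[y0 yx]; rewrite !ger0_norm.
  by move=> /andP[xy y0]; rewrite !ler0_norm// lerN2.
have := @mean_value_le f df 0 x K; rewrite f0 !subr0; apply.
  by move=> y /H; exact: D.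
by move=> y /H; exact: B.
Qed.

Lemma norm_cosB1 (x : R) : `|cos x - 1| <= `|x|.
Proof.
rewrite -[leRHS]mul1r.
apply: (@mean_value_le0 (fun x => cos x - 1) (fun x => - sin x)).
- by rewrite cos0 subrr.
- by move=> y _; apply: is_derive_eq; rewrite subr0.
- by move=> y _; rewrite normrN sin_max.
Qed.

Lemma norm_sin (x : R) : `|sin x| <= `|x|.
Proof.
rewrite -[leRHS]mul1r.
apply: (@mean_value_le0 sin cos); first exact: sin0.
- by move=> y _; exact: cos_max.
Qed.

Lemma norm_cosB1_sqr (x : R) : `|cos x - 1| <= `|x| ^+ 2.
Proof.
rewrite expr2; apply: (@mean_value_le0 (fun x => cos x - 1) (fun x => - sin x)).
- by rewrite cos0 subrr.
- by move=> y _; apply: is_derive_eq; rewrite subr0.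
- by move=> y yx; rewrite normrN (le_trans (norm_sin _)).
Qed.

Lemma norm_sinB_sqr (x : R) : `|sin x - x| <= `|x| ^+ 2.
Proof.
rewrite expr2; apply: (@mean_value_le0 (fun x => sin x - x) (fun x => cos x - 1)).
- by rewrite sin0 subrr.
- by move=> y yx; rewrite (le_trans (norm_cosB1 _)).
Qed.

Lemma norm_sinB (x : R) : `|sin x - x| <= `|x| ^+ 3.
Proof.
rewrite exprSr; apply: (@mean_value_le0 (fun x => sin x - x) (fun x => cos x - 1)).
- by rewrite sin0 subrr.
- move=> y yx; rewrite (le_trans (norm_cosB1_sqr _))//.
  by apply: lerXn2r; rewrite ?nnegrE.
Qed.

Lemma norm_cos_taylor (x : R) : `|cos x - (1 - x ^+ 2 / 2)| <= `|x| ^+ 3.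
Proof.
rewrite [leRHS]exprSr.
apply: (@mean_value_le0 (fun x => cos x - (1 - x ^+ 2 / 2)) (fun x => x - sin x)).
- by rewrite cos0 expr0n/= mul0r subr0 subrr.
- move=> y _; apply: is_derive_eq.
  by rewrite !scaler0 ?addr0 ?add0r /GRing.scale/=; field.
- move=> y yx; rewrite distrC (le_trans (norm_sinB_sqr _))//.
  by apply: lerXn2r; rewrite ?nnegrE.
Qed.

Lemma norm_expRN_taylor (x : R) : 0 <= x -> `|expR (- x) - (1 - x)| <= x ^+ 2.
Proof.
move=> x0; have e1 (y : R) : 0 <= y -> `|1 - expR (- y)| <= y.
  move=> y0; rewrite ger0_norm ?subr_ge0 -?expR0 ?ler_expR ?oppr_le0//.
  by rewrite expR0 lerBlDl -lerBlDr (le_trans _ (expR_ge1Dx _)).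
have -> : expR (- x) - (1 - x) = (expR (- x) - (1 - x)) - (expR (- 0) - (1 - 0)).
  by rewrite oppr0 expR0 addr0 (subrr 1) subr0.
have -> : x ^+ 2 = x * `|x - 0| by rewrite subr0 ger0_norm.
apply: (@mean_value_le (fun x => expR (- x) - (1 - x)) (fun x => 1 - expR (- x))).
- by move=> y _; apply: is_derive_eq; ring.
- rewrite (min_l x0) (max_r x0) => y /andP[y0 yx].
  exact: le_trans (e1 y y0) yx.
Qed.

End mean_value_bounds.

Section characteristic_product.
Context d (T : measurableType d) (R : realType) (P : probability T R).
Context (n : nat) (W : 'I_n -> T -> R) (s : R).
Hypothesis mW : forall i, measurable_fun [set: T] (W i).
Hypothesis iW : independent_variables P W.

Let c i := \int[P]_w cos (s * W i w).
Let e i := \int[P]_w sin (s * W i w).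

Local Notation psum k w := (\sum_(i < n | (i < k)%N) W i w).
Local Notation tail g k w := (\prod_(i < n | (k <= i)%N) g i (W i w)).

Let mcosS (h : T -> R) : measurable_fun [set: T] h -> measurable_fun [set: T] (fun w => cos (h w)).
Proof.
by move=> mh; apply: measurableT_comp mh; apply: continuous_measurable_fun; exact: continuous_cos.
Qed.

Let msinS (h : T -> R) : measurable_fun [set: T] h -> measurable_fun [set: T] (fun w => sin (h w)).
Proof.
by move=> mh; apply: measurableT_comp mh; apply: continuous_measurable_fun; exact: continuous_sin.
Qed.

Let mpsum k : measurable_fun [set: T] (fun w => s * psum k w).
Proof.
apply: measurable_funM => //; under eq_fun do rewrite big_mkcond/=.
by apply: measurable_sum => i; case: (i < k)%N.
Qed.

Let mtail (g : 'I_n -> R -> R) k : (forall i : 'I_n, measurable_fun [set: R] (g i)) ->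
  measurable_fun [set: T] (fun w => tail g k w).
Proof.
move=> mg; under eq_fun do rewrite big_mkcond/=.
apply: measurable_prod => i _; case: (k <= i)%N => //; exact: measurableT_comp.
Qed.

Let btail (g : 'I_n -> R -> R) k : (forall i x, `|g i x| <= 1) -> forall w, `|tail g k w| <= 1.
Proof.
move=> g1 w; rewrite normr_prod; apply: (@le_trans _ _ (\prod_(i < n | (k <= i)%N) 1)).
  by apply: ler_prod => i _; rewrite normr_ge0 g1.
by rewrite prodr_const expr1n.
Qed.

Let psumS (k : 'I_n) w : psum k.+1 w = W k w + psum k w.
Proof.
rewrite (bigD1 k)//=; congr (_ + _); apply: eq_bigl => i.
by rewrite ltnS leq_eqVlt -val_eqE/=; case: ltngtP.
Qed.

Let tailS (g : 'I_n -> R -> R) (k : 'I_n) w : tail g k w = g k (W k w) * tail g k.+1 w.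
Proof.
rewrite (bigD1 k)//=; congr (_ * _); apply: eq_bigl => i.
by rewrite -val_eqE/=; case: ltngtP.
Qed.

Let tailES (g : 'I_n -> R -> R) (k : 'I_n) :
  \prod_(i < n | (k <= i)%N) \int[P]_w g i (W i w) =
  \int[P]_w g k (W k w) * \prod_(i < n | (k < i)%N) \int[P]_w g i (W i w).
Proof.
rewrite (bigD1 k)//=; congr (_ * _); apply: eq_bigl => i.
by rewrite -val_eqE/=; case: ltngtP.
Qed.

(** A and B are the real and imaginary parts of the characteristic function at s
    of the sum of the first k variables. The product over the other variables
    makes the induction go through: the next variable is moved from the product
    into the sum by the addition formulas. At each step a number of modulus at
    most 1 is multiplied by a number within 2 delta of q, so that the errors add
    up. *)
Lemma characteristic_recursion k : (k <= n)%N ->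
  exists A B : R, [/\ `|A| <= 1, `|B| <= 1,
   (forall g : 'I_n -> R -> R, (forall i, measurable_fun [set: R] (g i)) ->
     (forall i x, `|g i x| <= 1) ->
     \int[P]_w (cos (s * psum k w) * tail g k w) =
       A * \prod_(i < n | (k <= i)%N) \int[P]_w g i (W i w) /\
     \int[P]_w (sin (s * psum k w) * tail g k w) =
       B * \prod_(i < n | (k <= i)%N) \int[P]_w g i (W i w)) &
   forall q delta : R, 0 <= q <= 1 -> 0 <= delta ->
     (forall i, `|c i - q| <= delta) -> (forall i, `|e i| <= delta) ->
     `|A - q ^+ k| <= 2 * delta *+ k /\ `|B| <= 2 * delta *+ k].
Proof.
have one (h : 'I_n -> R -> R) : (forall i x, h i x = 1) -> forall k w, tail h k w = 1.
  by move=> h1 j w; rewrite big1// => i _; exact: h1.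
have Eone j : \prod_(i < n | (j <= i)%N) \int[P]_w (fun _ _ => 1 : R) i (W i w) = 1.
  by rewrite big1// => i _; rewrite Rintegral_setT_cst.
have le1 (h : T -> R) : measurable_fun [set: T] h -> (forall w, `|h w| <= 1) ->
    `|\int[P]_w h w| <= 1.
  move=> mh h1; have Ih := bounded_integrable P mh h1.
  apply: le_trans (le_normr_Rintegral measurableT Ih) _.
  rewrite -[leRHS](Rintegral_setT_cst P 1); apply: le_Rintegral => //.
  - exact: (integrable_norm Ih).
  - by apply: (@bounded_integrable _ _ _ _ _ 1) => // w; rewrite normr1.
elim: k => [_|k IH kn].
  have S0 w : psum 0 w = 0 by rewrite big_pred0.
  exists 1, 0; split => //; rewrite ?normr1 ?normr0//.
    move=> g mg g1; split.
      under eq_Rintegral do rewrite S0 mulr0 cos0 mul1r.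
      by rewrite mul1r (expectation_prod mW iW mg g1).
    under eq_Rintegral do rewrite S0 mulr0 sin0 mul0r.
    by rewrite Rintegral_setT_cst mul0r.
  by move=> q delta _ _ _ _; rewrite expr0 subrr normr0 !mulr0n.
have [A [B [A1 B1 AB Abnd]]] := IH (ltnW kn).
pose k0 := Ordinal kn.
pose A' := A * c k0 - B * e k0; pose B' := A * e k0 + B * c k0.
have step (g : 'I_n -> R -> R) : (forall i, measurable_fun [set: R] (g i)) -> (forall i x, `|g i x| <= 1) ->
     \int[P]_w (cos (s * psum k.+1 w) * tail g k.+1 w) =
       A' * \prod_(i < n | (k.+1 <= i)%N) \int[P]_w g i (W i w) /\
     \int[P]_w (sin (s * psum k.+1 w) * tail g k.+1 w) =
       B' * \prod_(i < n | (k.+1 <= i)%N) \int[P]_w g i (W i w).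
  move=> mg g1.
  pose gc i := if i == k0 then (fun x => cos (s * x)) else g i.
  pose gs i := if i == k0 then (fun x => sin (s * x)) else g i.
  have mgc i : measurable_fun [set: R] (gc i).
    rewrite /gc; case: ifP => // _; apply: continuous_measurable_fun => x.
    by apply: continuous_comp; [exact: mulrl_continuous|exact: continuous_cos].
  have mgs i : measurable_fun [set: R] (gs i).
    rewrite /gs; case: ifP => // _; apply: continuous_measurable_fun => x.
    by apply: continuous_comp; [exact: mulrl_continuous|exact: continuous_sin].
  have gc1 i x : `|gc i x| <= 1 by rewrite /gc; case: ifP => // _; exact: cos_max.
  have gs1 i x : `|gs i x| <= 1 by rewrite /gs; case: ifP => // _; exact: sin_max.
  have [ACc BCc] := AB gc mgc gc1; have [ACs BCs] := AB gs mgs gs1.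
  have tE w : tail gc k w = cos (s * W k0 w) * tail g k.+1 w.
    rewrite (tailS gc k0) /gc eqxx; congr (_ * _); apply: eq_bigr => i ki.
    by rewrite -val_eqE/= gtn_eqF.
  have tE' w : tail gs k w = sin (s * W k0 w) * tail g k.+1 w.
    rewrite (tailS gs k0) /gs eqxx; congr (_ * _); apply: eq_bigr => i ki.
    by rewrite -val_eqE/= gtn_eqF.
  have pE : \prod_(i < n | (k <= i)%N) \int[P]_w gc i (W i w) =
      c k0 * \prod_(i < n | (k < i)%N) \int[P]_w g i (W i w).
    rewrite (tailES gc k0) {1}/gc eqxx; congr (_ * _); apply: eq_bigr => i ki.
    by rewrite /gc -val_eqE/= gtn_eqF.
  have pE' : \prod_(i < n | (k <= i)%N) \int[P]_w gs i (W i w) =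
      e k0 * \prod_(i < n | (k < i)%N) \int[P]_w g i (W i w).
    rewrite (tailES gs k0) {1}/gs eqxx; congr (_ * _); apply: eq_bigr => i ki.
    by rewrite /gs -val_eqE/= gtn_eqF.
  have Icos (h : 'I_n -> R -> R) : (forall i, measurable_fun [set: R] (h i)) -> (forall i x, `|h i x| <= 1) ->
      P.-integrable [set: T] (EFin \o (fun w => cos (s * psum k w) * tail h k w)).
    move=> mh h1; apply: (@bounded_integrable _ _ _ _ _ (1 * 1)).
      by apply: measurable_funM; [exact: mcosS|exact: (@mtail h k mh)].
    by move=> w; rewrite normrM ler_pM// ?cos_max ?(@btail h k h1).
  have Isin (h : 'I_n -> R -> R) : (forall i, measurable_fun [set: R] (h i)) -> (forall i x, `|h i x| <= 1) ->
      P.-integrable [set: T] (EFin \o (fun w => sin (s * psum k w) * tail h k w)).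
    move=> mh h1; apply: (@bounded_integrable _ _ _ _ _ (1 * 1)).
      by apply: measurable_funM; [exact: msinS|exact: (@mtail h k mh)].
    by move=> w; rewrite normrM ler_pM// ?sin_max ?(@btail h k h1).
  split.
    transitivity (\int[P]_w (cos (s * psum k w) * tail gc k w - sin (s * psum k w) * tail gs k w)).
      apply: eq_Rintegral => w _; rewrite tE tE' (psumS k0) mulrDr cosD; ring.
    rewrite (RintegralB measurableT (Icos _ mgc gc1) (Isin _ mgs gs1)) ACc BCs pE pE'.
    by rewrite /A'; ring.
  transitivity (\int[P]_w (cos (s * psum k w) * tail gs k w + sin (s * psum k w) * tail gc k w)).
    apply: eq_Rintegral => w _; rewrite tE tE' (psumS k0) mulrDr sinD; ring.
  rewrite (RintegralD measurableT (Icos _ mgs gs1) (Isin _ mgc gc1)) ACs BCc pE pE'.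
  by rewrite /B'; ring.
exists A', B'.
have [cE sE] := step (fun _ _ => 1) (fun=> measurable_cst _) (fun _ _ => eq_ind _ (fun x => x <= 1) (lexx 1) _ (esym (normr1 R))).
rewrite (Eone k.+1) [A' * 1]mulr1 in cE; rewrite (Eone k.+1) [B' * 1]mulr1 in sE.
have tail1 w : tail (fun _ _ => 1) k.+1 w = 1 :> R by exact: (one (fun _ _ => 1) (fun _ _ => erefl)).
have le_tail (h : R -> R) w : (forall x, `|h x| <= 1) ->
    `|h (s * psum k.+1 w) * tail (fun _ _ => 1) k.+1 w| <= 1.
  by move=> h1; rewrite (tail1 w) mulr1.
split=> //.
- rewrite -cE; apply: le1 => [|w]; last exact/le_tail/cos_max.
  by apply: measurable_funM; [exact: mcosS|exact: (@mtail (fun _ _ => 1) k.+1 (fun=> measurable_cst _))].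
- rewrite -sE; apply: le1 => [|w]; last exact/le_tail/sin_max.
  by apply: measurable_funM; [exact: msinS|exact: (@mtail (fun _ _ => 1) k.+1 (fun=> measurable_cst _))].
move=> q delta /andP[q0 q1] d0 cq ed.
have [HA HB] := Abnd q delta (introT andP (conj q0 q1)) d0 cq ed.
have e2 (a b x y : R) : `|a| <= 1 -> `|b| <= 1 -> `|x| <= delta -> `|y| <= delta ->
    `|a * x| + `|b * y| <= 2 * delta.
  move=> a1 b1 xd yd; rewrite !normrM [2 * delta]mulr_natl mulr2n lerD//.
    by rewrite -[leRHS]mul1r ler_pM.
  by rewrite -[leRHS]mul1r ler_pM.
split.
  have -> : A' - q ^+ k.+1 = (A - q ^+ k) * q + (A * (c k0 - q) - B * e k0).
    by rewrite /A' exprSr; ring.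
  rewrite mulrSr (le_trans (ler_normD _ _))// lerD//.
    by rewrite normrM (ger0_norm q0) (le_trans _ HA)// ler_piMr.
  by rewrite (le_trans (ler_normB _ _))// e2.
have -> : B' = B * q + (A * e k0 + B * (c k0 - q)) by rewrite /B'; ring.
rewrite mulrSr (le_trans (ler_normD _ _))// lerD//.
  by rewrite normrM (ger0_norm q0) (le_trans _ HB)// ler_piMr.
by rewrite (le_trans (ler_normD _ _))// e2.
Qed.

End characteristic_product.

Section characteristic_bound.
Context d (T : measurableType d) (R : realType) (P : probability T R).
Context (n : nat) (W : 'I_n -> T -> R) (v K : R).
Hypothesis mW : forall i, measurable_fun [set: T] (W i).
Hypothesis iW : independent_variables P W.
Hypothesis IW : forall i, P.-integrable [set: T] (EFin \o W i).
Hypothesis IW2 : forall i, P.-integrable [set: T] (EFin \o (fun w => W i w ^+ 2)).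
Hypothesis IW3 : forall i, P.-integrable [set: T] (EFin \o (fun w => `|W i w| ^+ 3)).
Hypothesis W0 : forall i, \int[P]_w W i w = 0.
Hypothesis W2 : forall i, \int[P]_w (W i w ^+ 2) = v.
Hypothesis W3 : forall i, \int[P]_w (`|W i w| ^+ 3) <= K.
Hypothesis n0 : (0 < n)%N.

Let IZ (k : R) g : P.-integrable [set: T] (EFin \o g) ->
    P.-integrable [set: T] (EFin \o (fun w => k * g w)).
Proof. by move=> Ig; have := integrableZl measurableT k Ig. Qed.

Let Icst (k : R) : P.-integrable [set: T] (EFin \o (fun=> k)).
Proof. by apply: (@bounded_integrable _ _ _ _ _ `|k|). Qed.

Let mcos (s : R) i : measurable_fun [set: T] (fun w => cos (s * W i w)).
Proof.
apply: (measurableT_comp (f := fun x => cos (s * x))) => //.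
apply: continuous_measurable_fun => x.
by apply: continuous_comp; [exact: mulrl_continuous|exact: continuous_cos].
Qed.

Let msin (s : R) i : measurable_fun [set: T] (fun w => sin (s * W i w)).
Proof.
apply: (measurableT_comp (f := fun x => sin (s * x))) => //.
apply: continuous_measurable_fun => x.
by apply: continuous_comp; [exact: mulrl_continuous|exact: continuous_sin].
Qed.

Let Icos s i : P.-integrable [set: T] (EFin \o (fun w => cos (s * W i w))).
Proof. by apply: (@bounded_integrable _ _ _ _ _ 1) => // w; exact: cos_max. Qed.

Let Isin s i : P.-integrable [set: T] (EFin \o (fun w => sin (s * W i w))).
Proof. by apply: (@bounded_integrable _ _ _ _ _ 1) => // w; exact: sin_max. Qed.

Let le_cube (s : R) i (h : T -> R) : P.-integrable [set: T] (EFin \o h) ->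
  (forall w, `|h w| <= `|s * W i w| ^+ 3) -> `|\int[P]_w h w| <= `|s| ^+ 3 * K.
Proof.
move=> Ih hs; apply: le_trans (le_normr_Rintegral measurableT Ih) _.
apply: (@le_trans _ _ (\int[P]_w (`|s| ^+ 3 * `|W i w| ^+ 3))).
  apply: le_Rintegral => //; first exact: (integrable_norm Ih).
    exact: IZ.
  by move=> w _; rewrite (le_trans (hs w))// normrM exprMn.
by rewrite (RintegralZl _ measurableT (IW3 i)) ler_wpM2l// exprn_ge0.
Qed.

(** By Taylor's formula, the characteristic function of one summand differs from
    expR (- s^2 v / 2) by a term of third order in s = a / sqrt n. *)
Lemma characteristic_bound (a b : R) :
  `|\int[P]_w cos (a * ((\sum_i W i w) / Num.sqrt n%:R) + b) -
    expR (- (a ^+ 2 * v / 2)) * cos b| <=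
  4 * (`|a / Num.sqrt n%:R| ^+ 3 * K + ((a / Num.sqrt n%:R) ^+ 2 * v / 2) ^+ 2) *+ n.
Proof.
set s := a / Num.sqrt n%:R; have i0 := Ordinal n0.
have v0 : 0 <= v by rewrite -(W2 i0); apply: Rintegral_ge0 => w _; exact: sqr_ge0.
have K0 : 0 <= K.
  by apply: le_trans (W3 i0); apply: Rintegral_ge0 => w _; rewrite exprn_ge0.
pose x := s ^+ 2 * v / 2.
have x0 : 0 <= x by rewrite /x divr_ge0// mulr_ge0// sqr_ge0.
pose q := expR (- x); pose delta := `|s| ^+ 3 * K + x ^+ 2.
have d0 : 0 <= delta.
  by apply: addr_ge0; [apply: mulr_ge0 => //; exact: exprn_ge0|exact: sqr_ge0].
have q01 : 0 <= q <= 1 by rewrite expR_ge0 -expR0 ler_expR oppr_le0.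
have cq i : `|\int[P]_w cos (s * W i w) - q| <= delta.
  have I1 : P.-integrable [set: T] (EFin \o (fun w => 1 - s ^+ 2 / 2 * W i w ^+ 2)).
    exact: (integrableB measurableT (Icst 1) (IZ (s ^+ 2 / 2) (IW2 i))).
  have E1 : \int[P]_w (1 - s ^+ 2 / 2 * W i w ^+ 2) = 1 - x.
    rewrite (RintegralB measurableT (Icst 1) (IZ (s ^+ 2 / 2) (IW2 i))).
    by rewrite (RintegralZl _ measurableT (IW2 i)) W2 Rintegral_setT_cst /x mulrAC.
  have -> : \int[P]_w cos (s * W i w) - q =
     \int[P]_w (cos (s * W i w) - (1 - s ^+ 2 / 2 * W i w ^+ 2)) + ((1 - x) - q).
    by rewrite (RintegralB measurableT (Icos s i) I1) E1 addrA subrK.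
  apply: le_trans (ler_normD _ _) _; apply: lerD.
    apply: (le_cube (i := i)); first exact: (integrableB measurableT (Icos s i) I1).
    move=> w; have := norm_cos_taylor (s * W i w).
    by rewrite exprMn [s ^+ 2 * _ / 2]mulrAC.
  by rewrite distrC; exact: norm_expRN_taylor.
have ed i : `|\int[P]_w sin (s * W i w)| <= delta.
  have I1 := IZ s (IW i).
  have -> : \int[P]_w sin (s * W i w) = \int[P]_w (sin (s * W i w) - s * W i w).
    rewrite (RintegralB measurableT (Isin s i) I1) (RintegralZl _ measurableT (IW i)).
    by rewrite W0 mulr0 subr0.
  apply: (@le_trans _ _ (`|s| ^+ 3 * K)); last by rewrite lerDl sqr_ge0.
  apply: (le_cube (i := i)); first exact: (integrableB measurableT (Isin s i) I1).
  by move=> w; exact: norm_sinB.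
have [A [B [_ _ AB /(_ q delta q01 d0 cq ed) [HA HB]]]] :=
  characteristic_recursion s mW iW (leqnn n).
have [EA EB] := AB (fun _ _ => 1) (fun=> measurable_cst _)
  (fun _ _ => eq_ind _ (fun x => x <= 1) (lexx 1) _ (esym (normr1 R))).
have full w : \sum_(i < n | (i < n)%N) W i w = \sum_i W i w.
  by apply: eq_bigl => i; rewrite ltn_ord.
have p1 (F : 'I_n -> R) : \prod_(i < n | (n <= i)%N) F i = 1.
  by rewrite big_pred0// => i; rewrite leqNgt ltn_ord.
have EA' : \int[P]_w cos (s * \sum_i W i w) = A.
  rewrite -[RHS]mulr1 -(p1 (fun i => \int[P]_w (fun _ _ => 1 : R) i (W i w))) -EA.
  by apply: eq_Rintegral => w _; rewrite p1 mulr1 full.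
have EB' : \int[P]_w sin (s * \sum_i W i w) = B.
  rewrite -[RHS]mulr1 -(p1 (fun i => \int[P]_w (fun _ _ => 1 : R) i (W i w))) -EB.
  by apply: eq_Rintegral => w _; rewrite p1 mulr1 full.
have mS : measurable_fun [set: T] (fun w => s * \sum_i W i w).
  by apply: measurable_funM => //; exact: measurable_sum.
have IcS : P.-integrable [set: T] (EFin \o (fun w => cos (s * \sum_i W i w))).
  apply: (@bounded_integrable _ _ _ _ _ 1) => [|w]; last exact: cos_max.
  by apply: measurableT_comp mS; apply: continuous_measurable_fun; exact: continuous_cos.
have IsS : P.-integrable [set: T] (EFin \o (fun w => sin (s * \sum_i W i w))).
  apply: (@bounded_integrable _ _ _ _ _ 1) => [|w]; last exact: sin_max.
  by apply: measurableT_comp mS; apply: continuous_measurable_fun; exact: continuous_sin.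
have -> : \int[P]_w cos (a * ((\sum_i W i w) / Num.sqrt n%:R) + b) =
    cos b * A - sin b * B.
  rewrite -EA' -EB' -(RintegralZl _ measurableT IcS) -(RintegralZl _ measurableT IsS).
  rewrite -(RintegralB measurableT (IZ (cos b) IcS) (IZ (sin b) IsS)).
  apply: eq_Rintegral => w _; rewrite cosD /s.
  by rewrite [a / _ * _]mulrAC -[a * _ / _]mulrA; ring.
have -> : expR (- (a ^+ 2 * v / 2)) = q ^+ n.
  rewrite /q -expRM_natl; congr expR.
  rewrite /x /s exprMn exprVn sqr_sqrtr ?ler0n//.
  by field; rewrite pnatr_eq0 -lt0n.
have -> : cos b * A - sin b * B - q ^+ n * cos b = cos b * (A - q ^+ n) - sin b * B by ring.
have -> : 4 * delta *+ n = 2 * delta *+ n + 2 * delta *+ n.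
  by rewrite -mulrnDl -mulrDl; congr (_ * _ *+ _); rewrite -natrD.
rewrite (le_trans (ler_normB _ _))// lerD// normrM.
  by rewrite -[leRHS]mul1r ler_pM// cos_max.
by rewrite -[leRHS]mul1r ler_pM// sin_max.
Qed.

End characteristic_bound.

Lemma cvg_sqrt_natV (R : realType) : (Num.sqrt n%:R)^-1 @[n --> \oo] --> (0 : R).
Proof.
apply/cvgrPdist_le => e e0; near=> n.
have n0 : 0 < n%:R :> R by rewrite ltr0n; near: n; exact: nbhs_infty_gt.
rewrite sub0r normrN gtr0_norm ?invr_gt0 ?sqrtr_gt0//.
rewrite -[leRHS]invrK lef_pV2 ?posrE ?sqrtr_gt0 ?invr_gt0//.
rewrite -[leLHS]gtr0_norm ?invr_gt0// -sqrtr_sqr ler_wsqrtr//.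
by near: n; exact: nbhs_infty_ger.
Unshelve. all: end_near. Qed.

Section central_limit.
Context (R : realType) (d : nat -> measure_display) (T : forall n, measurableType (d n)).
Context (P : forall n, probability (T n) R) (W : forall n, 'I_n -> T n -> R) (v K : R).
Hypothesis v0 : 0 <= v.
Hypothesis mW : forall n i, measurable_fun [set: T n] (W i).
Hypothesis iW : forall n, independent_variables (P n) (@W n).
Hypothesis IW : forall n i, (P n).-integrable [set: T n] (EFin \o W i).
Hypothesis IW2 : forall n i, (P n).-integrable [set: T n] (EFin \o (fun w => W i w ^+ 2)).
Hypothesis IW3 : forall n i, (P n).-integrable [set: T n] (EFin \o (fun w => `|W i w| ^+ 3)).
Hypothesis W0 : forall n (i : 'I_n), \int[P n]_w W i w = 0.
Hypothesis W2 : forall n (i : 'I_n), \int[P n]_w (W i w ^+ 2) = v.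
Hypothesis W3 : forall n (i : 'I_n), \int[P n]_w (`|W i w| ^+ 3) <= K.

(** The bound on the characteristic function is of order 1 / sqrt n. *)
Lemma central_limit_cos (a b : R) :
  \int[P n]_w cos (a * ((\sum_i @W n i w) / Num.sqrt n%:R) + b) @[n --> \oo] -->
  expR (- (a ^+ 2 * v / 2)) * cos b.
Proof.
apply/cvgrPdist_le => e e0.
have := @cvg_sqrt_natV R => cs.
pose B (r : R) := 4 * (`|a| ^+ 3 * K * r + (a ^+ 2 * v / 2) ^+ 2 * r ^+ 2).
have cB : B (Num.sqrt n%:R)^-1 @[n --> \oo] --> (0 : R).
  rewrite (_ : 0 = B 0); last by rewrite /B mulr0 expr0n/= mulr0 addr0 mulr0.
  apply: cvgM; first exact: cvg_cst.
  apply: cvgD; first by apply: cvgM => //; exact: cvg_cst.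
  by apply: cvgM; [exact: cvg_cst|apply: cvgM].
move/cvgrPdist_le : cB => /(_ e e0) cB.
near=> n.
have n0 : (0 < n)%N by near: n; exact: nbhs_infty_gt.
have sn0 : 0 < Num.sqrt n%:R :> R by rewrite sqrtr_gt0 ltr0n.
have := characteristic_bound (@mW n) (@iW n) (@IW n) (@IW2 n) (@IW3 n) (@W0 n) (@W2 n) (@W3 n) n0 a b.
rewrite distrC => /le_trans; apply.
have Bn : `|0 - B (Num.sqrt n%:R)^-1| <= e by near: n.
apply: le_trans Bn; rewrite sub0r normrN; apply: le_trans (ler_norm _).
rewrite le_eqVlt; apply/orP; left; apply/eqP; rewrite /B normrM normfV (gtr0_norm sn0).
have nE : n%:R = Num.sqrt n%:R ^+ 2 :> R by rewrite sqr_sqrtr ?ler0n.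
set r := Num.sqrt n%:R in sn0 nE *; rewrite -[LHS]mulr_natr nE.
by field; rewrite gt_eqF.
Unshelve. all: end_near. Qed.

(** The bound comes from |x| <= 1 + x^2 and from the variance of the sum. *)
Lemma normalized_sum_moment n :
  (P n).-integrable [set: T n] (EFin \o (fun w => (\sum_i W i w) / Num.sqrt n%:R)) /\
  \int[P n]_w `|(\sum_i W i w) / Num.sqrt n%:R| <= 1 + v.
Proof.
have [I2 E2] := expectation_sum_sqr (@iW n) (@mW n) (@IW n) (@IW2 n) (@W0 n) (@W2 n).
have [I1 _] := integrable_sum_seq (index_enum 'I_n) (@IW n).
have I3 : (P n).-integrable [set: T n] (EFin \o (fun w => (Num.sqrt n%:R)^-1 * (\sum_i W i w))).
  by have := integrableZl measurableT (Num.sqrt n%:R)^-1 I1.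
have E : (fun w : T n => (Num.sqrt n%:R)^-1 * (\sum_i W i w) : R) =
    (fun w : T n => (\sum_i W i w) / Num.sqrt n%:R : R).
  by apply/funext => w; rewrite mulrC.
rewrite E in I3; split=> //.
have Ic : (P n).-integrable [set: T n] (EFin \o (fun=> 1 : R)).
  by apply: (@bounded_integrable _ _ _ _ _ `|1|).
have I4 : (P n).-integrable [set: T n] (EFin \o (fun w => n%:R^-1 * (\sum_i W i w) ^+ 2)).
  by have := integrableZl measurableT n%:R^-1 I2.
apply: (@le_trans _ _ (\int[P n]_w (1 + n%:R^-1 * (\sum_i W i w) ^+ 2))).
  apply: le_Rintegral => //.
  - exact: (integrable_norm I3).
  - exact: (integrableD measurableT Ic I4).
  - move=> w _; set S := \sum_i _.
    have -> : n%:R^-1 * S ^+ 2 = `|S / Num.sqrt n%:R| ^+ 2.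
      by rewrite real_normK ?num_real// exprMn exprVn sqr_sqrtr ?ler0n// mulrC.
    move: `|_| (normr_ge0 (S / Num.sqrt n%:R)) => x x0.
    by rewrite -subr_ge0; have := sqr_ge0 (x - 1); nra.
rewrite (RintegralD measurableT Ic I4) Rintegral_setT_cst (RintegralZl _ measurableT I2) E2.
rewrite lerD2l mulrA; have [->|n0] := eqVneq n 0%N.
  by rewrite invr0 !mul0r.
by rewrite mulVf ?mul1r// pnatr_eq0.
Qed.

End central_limit.

(** * The Gaussian cosine transform *)

Section gaussian_cosine.
Context (R : realType) (sigma : R).
Hypothesis sigma0 : 0 < sigma.
Local Notation leb := (@lebesgue_measure R).
Let p := normal_pdf 0 sigma.

Let p0 x : 0 <= p x. Proof. exact: normal_pdf_ge0. Qed.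

Let mp : measurable_fun [set: R] p. Proof. exact: measurable_normal_pdf. Qed.

Let sigma_neq0 : sigma != 0. Proof. by rewrite gt_eqF. Qed.

Let pE x : p x = normal_peak sigma * expR (- x ^+ 2 / (sigma ^+ 2 *+ 2)).
Proof. by rewrite /p normal_pdfE// /normal_fun subr0. Qed.

Let Ip : leb.-integrable [set: R] (EFin \o p).
Proof. exact: integrable_normal_pdf. Qed.

Let dominating C (h : R -> R) : measurable_fun [set: R] h ->
  (forall x, `|h x| <= C * p x) -> leb.-integrable [set: R] (EFin \o h).
Proof.
move=> mh hC; have IC := integrableZl measurableT C Ip.
apply: le_integrable IC => //; first exact/measurable_EFinP.
by move=> x _; rewrite /= lee_fin (le_trans (hC x))// ler_norm.
Qed.

Let xp_le_exp x : `|x| * p x <=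
  normal_peak sigma * (sigma * expR (- (x ^+ 2 / (sigma ^+ 2 *+ 4)))).
Proof.
rewrite pE mulrCA ler_wpM2l ?normal_peak_ge0//.
pose u := x ^+ 2 / (sigma ^+ 2 *+ 4).
have -> : - x ^+ 2 / (sigma ^+ 2 *+ 2) = - u + - u.
  by rewrite /u -mulr_natr -[_ *+ 4]mulr_natr; field.
rewrite -/u expRD mulrA; apply: ler_wpM2r; first exact: expR_ge0.
rewrite expRN -ler_pdivlMr ?invr_gt0 ?expR_gt0// invrK.
(* The last inequality, |x| <= sigma (1 + u), says that (|x| - 2 sigma)^2 >= 0. *)
apply: (@le_trans _ _ (sigma * (1 + u))); last first.
  by rewrite ler_wpM2l ?(ltW sigma0)// expR_ge1Dx.
have -> : u = `|x| ^+ 2 / (sigma ^+ 2 *+ 4) by rewrite real_normK// num_real.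
rewrite -subr_ge0 (_ : _ - _ = (`|x| - 2 * sigma) ^+ 2 / (4 * sigma)).
  by rewrite divr_ge0 ?sqr_ge0// mulr_ge0// ltW.
by rewrite -[_ *+ 4]mulr_natr; field.
Qed.

Let xp_le x : `|x| * p x <= normal_peak sigma * sigma.
Proof.
apply: le_trans (xp_le_exp x) _; rewrite ler_wpM2l ?normal_peak_ge0//.
rewrite ler_piMr ?(ltW sigma0)// -expR0 ler_expR oppr_le0 divr_ge0 ?sqr_ge0//.
by rewrite mulrn_wge0// sqr_ge0.
Qed.

Lemma integrable_normal_pdf_first_moment :
  leb.-integrable [set: R] (EFin \o (fun x => `|x| * p x)).
Proof.
have s2 : Num.sqrt 2 * sigma != 0 by rewrite mulf_neq0// gt_eqF// sqrtr_gt0.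
pose q := normal_pdf 0 (Num.sqrt 2 * sigma).
pose C := sigma * normal_peak sigma / normal_peak (Num.sqrt 2 * sigma).
have IC := integrableZl measurableT C (integrable_normal_pdf 0 (Num.sqrt 2 * sigma)).
apply: le_integrable IC => //.
  by apply/measurable_EFinP; apply: measurable_funM => //; exact: measurableT_comp.
move=> x _; rewrite /= lee_fin.
rewrite ger0_norm ?mulr_ge0// (le_trans _ (ler_norm _))// (le_trans (xp_le_exp x))//.
rewrite normal_pdfE// /normal_fun subr0 /C.
have -> : - x ^+ 2 / ((Num.sqrt 2 * sigma) ^+ 2 *+ 2) = - (x ^+ 2 / (sigma ^+ 2 *+ 4)).
  rewrite exprMn sqr_sqrtr// -mulr_natr -[_ *+ 4]mulr_natr; field.
  by rewrite sigma_neq0.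
rewrite le_eqVlt; apply/orP; left; apply/eqP; field.
by rewrite gt_eqF// normal_peak_gt0.
Qed.

Let is_derive_p (x : R) : is_derive x 1 p (- x / sigma ^+ 2 * p x).
Proof.
pose k := (sigma ^+ 2 *+ 2)^-1; pose K := normal_peak sigma.
have D : is_derive x 1 (fun x => K * expR (- x ^+ 2 * k))
    (- x / sigma ^+ 2 * (K * expR (- x ^+ 2 * k))).
  apply: is_derive_eq.
  rewrite /GRing.scale/=.
  have -> : k = 2^-1 / sigma ^+ 2 by rewrite /k -mulr_natr; field.
  by move: (expR _) => e; field.
rewrite [X in is_derive _ _ _ X](_ : _ = - x / sigma ^+ 2 * (K * expR (- x ^+ 2 * k))).
  by rewrite (_ : p = (fun x => K * expR (- x ^+ 2 * k)))//; apply/funext => y; rewrite pE.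
by rewrite pE.
Qed.

Let cp : continuous p. Proof. exact: continuous_normal_pdf. Qed.

Section phase.
Variables a b : R.
Let F x := sigma ^+ 2 * (sin (a * x + b) * p x).
Let h x := a * sigma ^+ 2 * (cos (a * x + b) * p x) - x * (sin (a * x + b) * p x).

Let is_derive_F (x : R) : is_derive x 1 F (h x).
Proof.
have D := is_derive_p x.
apply: is_derive_eq; rewrite /GRing.scale/= /h; field; exact: sigma_neq0.
Qed.

Let affine_continuous : continuous (fun x : R => a * x + b).
Proof. by move=> x; apply: cvgD; [exact: mulrl_continuous|exact: cvg_cst]. Qed.

Let ccos : continuous (fun x : R => cos (a * x + b)).
Proof.
by move=> x; apply: continuous_comp; [exact: affine_continuous|exact: continuous_cos].
Qed.

Let csin : continuous (fun x : R => sin (a * x + b)).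
Proof.
by move=> x; apply: continuous_comp; [exact: affine_continuous|exact: continuous_sin].
Qed.

Let ccosp : continuous (fun x : R => cos (a * x + b) * p x).
Proof. by move=> x; apply: cvgM; [exact: ccos|exact: cp]. Qed.

Let csinp : continuous (fun x : R => sin (a * x + b) * p x).
Proof. by move=> x; apply: cvgM; [exact: csin|exact: cp]. Qed.

Let cxsinp : continuous (fun x : R => x * (sin (a * x + b) * p x)).
Proof. by move=> x; apply: cvgM; [exact: cvg_id|exact: csinp]. Qed.

Lemma integrable_cos_normal : leb.-integrable [set: R] (EFin \o (fun x => cos (a * x + b) * p x)).
Proof.
apply: (@dominating 1); first exact: continuous_measurable_fun.
by move=> x; rewrite normrM (ger0_norm (p0 x)) ler_wpM2r// cos_max.
Qed.

Lemma integrable_xsin_normal :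
  leb.-integrable [set: R] (EFin \o (fun x => x * (sin (a * x + b) * p x))).
Proof.
apply: le_integrable integrable_normal_pdf_first_moment => //.
  by apply/measurable_EFinP; exact: continuous_measurable_fun.
move=> x _; rewrite /= lee_fin !normrM normr_id ler_wpM2l// ler_piMl//.
exact: sin_max.
Qed.

Let Ih : leb.-integrable [set: R] (EFin \o h).
Proof.
exact: (integrableB measurableT (integrableZl measurableT (a * sigma ^+ 2) integrable_cos_normal)
  integrable_xsin_normal).
Qed.

Let ch : continuous h.
Proof.
move=> x; apply: cvgB; last exact: cxsinp.
by apply: cvgM; [exact: cvg_cst|exact: ccosp].
Qed.

Let sym_itv n : set R := `[- n.+1%:R, n.+1%:R]%classic.

Let integral_h_sym n :
  (\int[leb]_(x in sym_itv n) (h x)%:E = (F n.+1%:R - F (- n.+1%:R))%:E)%E.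
Proof.
have dF x : derivable F x 1 by case: (is_derive_F x).
have cF : continuous F by move=> x; exact/differentiable_continuous/derivable1_diffP.
rewrite EFinB; apply: continuous_FTC2.
- by rewrite ltrNl (lt_trans (_ : - n.+1%:R < 0))// ?ltr0n// oppr_lt0 ltr0n.
- exact: continuous_subspaceT.
- split; first by move=> x _; exact: dF.
    by apply: cvg_at_right_filter; exact: cF.
  by apply: cvg_at_left_filter; exact: cF.
- by move=> x _; rewrite derive1E; apply: derive_val.
Qed.

Let cvg_F : (F n.+1%:R - F (- n.+1%:R))%:E @[n --> \oo] --> 0%E.
Proof.
apply: cvg_EFin; first exact: nearW.
pose C := 2 * (sigma ^+ 2 * (normal_peak sigma * sigma)).
have C0 : C * harmonic n @[n --> \oo] --> 0.
  by rewrite -(mulr0 C); apply: cvgM; [exact: cvg_cst|exact: cvg_harmonic].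
have Fle (m : R) n : `|m| = n.+1%:R -> `|F m| <= sigma ^+ 2 * (normal_peak sigma * sigma) * harmonic n.
  move=> mn; rewrite /F normrM ger0_norm ?sqr_ge0// -mulrA ler_wpM2l ?sqr_ge0//.
  rewrite ler_pdivlMr ?ltr0n// normrM (ger0_norm (p0 m)).
  apply: (@le_trans _ _ (p m * n.+1%:R)).
    by rewrite ler_wpM2r// ler_piMl// sin_max.
  by rewrite mulrC -mn; exact: xp_le.
apply/cvgrPdist_le => e e0; move/cvgrPdist_le : C0 => /(_ e e0).
apply: filterS => n; rewrite !sub0r !normrN /= => Cn.
apply: le_trans Cn; apply: le_trans (ler_norm _).
rewrite (le_trans (ler_normB _ _))// /C -mulrA [2 * _]mulr_natl mulr2n lerD//.
  by apply: Fle; rewrite ger0_norm.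
by apply: Fle; rewrite normrN ger0_norm.
Qed.

(** The function h is the derivative of F, which vanishes at infinity since x
    p(x) is bounded. *)
Lemma normal_integration_by_parts :
  \int[leb]_x (x * (sin (a * x + b) * p x)) =
  a * sigma ^+ 2 * \int[leb]_x (cos (a * x + b) * p x).
Proof.
have H0 : (\int[leb]_x (h x)%:E)%E = 0%E.
  have mh : measurable_fun [set: R] h by exact: continuous_measurable_fun.
  have msym n : measurable (sym_itv n : set (measurableTypeR R)) by exact: measurable_itv.
  have hn x : (fun n => ((h \_ (sym_itv n)) x)%:E) @ \oo --> (h x)%:E.
    apply: cvg_near_cst; near=> n; rewrite patchE mem_set// /sym_itv/= in_itv/= -ler_norml.
    by rewrite (le_trans (ltW (archi_boundP _)))// ler_nat ltnW// ltnS; near: n; exact: nbhs_infty_ge.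
  have [||||| _ _ cvgI] := @dominated_convergence _ _ _ leb setT measurableT
    (fun n x => ((h \_ (sym_itv n)) x)%:E) (EFin \o h) (EFin \o (Num.norm \o h)).
  - move=> n; apply/measurable_EFinP.
    by apply/(measurable_restrictT h (msym n)); exact: measurable_funTS.
  - exact/measurable_EFinP.
  - by apply: aeW => x _; exact: hn.
  - exact: (integrable_norm Ih).
  - apply: aeW => x n _; rewrite /= lee_fin patchE; case: ifPn => // _.
    by rewrite normr0.
  have E n : (\int[leb]_x ((h \_ (sym_itv n)) x)%:E = (F n.+1%:R - F (- n.+1%:R))%:E)%E.
    rewrite -integral_h_sym [RHS]integral_mkcond; apply: eq_integral => x _.
    by rewrite !patchE; case: ifPn.
  rewrite (_ : [sequence _]_n = (fun n => (F n.+1%:R - F (- n.+1%:R))%:E)) in cvgI; last first.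
    by apply/funext => n; exact: E.
  exact: (cvg_unique _ cvgI cvg_F).
move/(congr1 fine): H0 => /=.
rewrite -[fine _]/(\int[leb]_x h x).
rewrite (RintegralB measurableT (integrableZl measurableT (a * sigma ^+ 2) integrable_cos_normal)
  integrable_xsin_normal).
rewrite (RintegralZl _ measurableT integrable_cos_normal).
by move=> /eqP; rewrite subr_eq0 => /eqP ->.
Unshelve. all: end_near. Qed.

End phase.

Let Phi (b a : R) := \int[leb]_x (cos (a * x + b) * p x).

Let is_derive_Phi (b a : R) : is_derive a 1 (Phi b) (- (a * sigma ^+ 2) * Phi b a).
Proof.
pose f (a x : R) := cos (a * x + b) * p x.
have Df (u x : R) : is_derive u 1 (f ^~ x) (- (x * (sin (u * x + b) * p x))).
  by apply: is_derive_eq; rewrite /GRing.scale/=; ring.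
have d1E (u x : R) : partial1of2 f u x = - (x * (sin (u * x + b) * p x)).
  by rewrite partial1of2E; have Dx := Df u x; exact: derive_val.
have aI : `]a - 1, a + 1[%classic a.
  by rewrite /= in_itv/= ltrBlDr andbb ltrDl ltr01.
have intf u : `]a - 1, a + 1[%classic u -> leb.-integrable [set: R] (EFin \o f u).
  by move=> _; exact: integrable_cos_normal.
have derf u x : `]a - 1, a + 1[%classic u -> [set: R] x -> derivable (f ^~ x) u 1.
  by move=> _ _; case: (Df u x).
have Gub u x : `]a - 1, a + 1[%classic u -> [set: R] x -> `|partial1of2 f u x| <= `|x| * p x.
  move=> _ _; rewrite d1E normrN !normrM (ger0_norm (p0 x)) ler_wpM2l// ler_piMl//.
  exact: sin_max.
have G0 x : 0 <= `|x| * p x by rewrite mulr_ge0.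
have D1 := derivable_under_integral measurableT aI intf derf G0
  integrable_normal_pdf_first_moment Gub.
have D2 := differentiation_under_integral measurableT aI intf derf G0
  integrable_normal_pdf_first_moment Gub.
split; first exact: D1.
rewrite -derive1E [LHS]D2.
transitivity (- 1 * \int[leb]_x (x * (sin (a * x + b) * p x))).
  rewrite -(RintegralZl _ measurableT (integrable_xsin_normal a b)).
  by apply: eq_Rintegral => x _; rewrite d1E mulN1r.
by rewrite normal_integration_by_parts mulN1r mulNr.
Qed.

(** As a function Phi of a, the integral satisfies Phi' = - a sigma^2 Phi:
    differentiate under the integral and integrate by parts. *)
Lemma integral_cos_normal_pdf (a b : R) :
  \int[leb]_x (cos (a * x + b) * p x) = expR (- (a ^+ 2 * sigma ^+ 2 / 2)) * cos b.
Proof.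
pose psi (a : R) := Phi b a * expR (a ^+ 2 * (sigma ^+ 2 / 2)).
have Dpsi (u : R) : is_derive u 1 psi 0.
  have D := is_derive_Phi b u.
  by apply: is_derive_eq; rewrite /GRing.scale/=; field.
have := @is_derive_0_is_cst _ psi a 0 Dpsi.
rewrite /psi expr0n/= mul0r expR0 mulr1 [X in _ = X](_ : _ = cos b) => [E|].
  rewrite -[LHS]/(Phi b a) -E -[a ^+ 2 * sigma ^+ 2 / 2]mulrA expRN mulrC.
  by rewrite mulfK// gt_eqF// expR_gt0.
rewrite /Phi; transitivity (\int[leb]_x (cos b * p x)).
  by apply: eq_Rintegral => x _; rewrite mul0r add0r.
rewrite (RintegralZl _ measurableT Ip) /Rintegral.
by rewrite (integral_normal_pdf 0 sigma) mulr1.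
Qed.

Section normal_variable.
Context d (T : measurableType d) (Q : probability T R) (zeta : {RV Q >-> R}).
Hypothesis zetaE : forall B : set R, measurable B ->
  distribution Q zeta B = normal_prob 0 sigma B.

Let mzeta : measurable_fun [set: T] zeta. Proof. by []. Qed.

Lemma ge0_integral_normal_variable (g : R -> \bar R) : measurable_fun [set: R] g ->
  (forall x, 0 <= g x)%E ->
  (\int[Q]_w g (zeta w) = \int[leb]_x ((p x)%:E * g x))%E.
Proof.
move=> mg g0; pose l (x : measurableTypeR R) : {measure set R -> \bar R} := \d_(x : R).
have ml U : measurable U -> measurable_fun [set: measurableTypeR R] (l ^~ U).
  move=> mU; rewrite (_ : l ^~ U = (fun x => (\1_U x)%:E)).
    by apply/measurable_EFinP; exact: measurable_indic.
  by apply/funext => x; rewrite /l/= diracE indicE.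
transitivity (\int[mixture leb mp p0 ml]_x g x)%E; last first.
  rewrite ge0_integral_mixture//; apply: eq_integral => x _.
  by rewrite integral_dirac// diracT mul1e.
rewrite -[LHS](ge0_integral_distribution zeta)//.
apply: eq_measure_integral => A mA _; rewrite [LHS](zetaE mA)/= /normal_prob /mixture.
rewrite [LHS]integral_mkcond; apply: eq_integral => x _.
by rewrite /l/= patchE diracE; case: (x \in A); rewrite ?mule1 ?mule0.
Qed.

Lemma normal_variable_cos (a b : R) :
  \int[Q]_w cos (a * zeta w + b) = expR (- (a ^+ 2 * sigma ^+ 2 / 2)) * cos b.
Proof.
have mc : measurable_fun [set: R] (fun x => cos (a * x + b)).
  apply: continuous_measurable_fun => x; apply: continuous_comp; last exact: continuous_cos.
  by apply: cvgD; [exact: mulrl_continuous|exact: cvg_cst].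
have mz : measurable_fun [set: T] (fun w => cos (a * zeta w + b)).
  exact: (measurableT_comp mc mzeta).
have Iz : Q.-integrable [set: T] (EFin \o (fun w => cos (a * zeta w + b))).
  by apply: (@bounded_integrable _ _ _ _ _ 1) => // w; exact: cos_max.
have I1 : Q.-integrable [set: T] (EFin \o (fun=> 1 : R)).
  by apply: (@bounded_integrable _ _ _ _ _ `|1|).
have m1 : measurable_fun [set: R] (fun x => (1 + cos (a * x + b))%:E).
  by apply/measurable_EFinP; exact: measurable_funD.
have c0 x : (0 <= (1 + cos (a * x + b))%:E)%E.
  by rewrite lee_fin -lerBlDl sub0r cos_geN1.
have /(congr1 fine) := ge0_integral_normal_variable m1 c0.
rewrite (_ : fine (\int[Q]_w _)%E = 1 + \int[Q]_w cos (a * zeta w + b)); last first.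
  by rewrite -[in RHS](Rintegral_setT_cst Q 1) -(RintegralD measurableT I1 Iz).
rewrite (_ : fine _ = 1 + \int[leb]_x (cos (a * x + b) * p x)); last first.
  transitivity (\int[leb]_x p x + \int[leb]_x (cos (a * x + b) * p x)); last first.
    by rewrite /Rintegral (integral_normal_pdf 0 sigma).
  rewrite -(RintegralD measurableT Ip (integrable_cos_normal a b)); congr fine.
  by apply: eq_integral => x _; rewrite -EFinM; congr EFin; ring.
by move=> /addrI ->; exact: integral_cos_normal_pdf.
Qed.

Lemma normal_variable_first_moment : Q.-integrable [set: T] (EFin \o zeta).
Proof.
apply/integrableP; split; first exact/measurable_EFinP.
have ma : measurable_fun [set: R] (fun x : R => (`|x|)%:E).
  by apply/measurable_EFinP; exact: normr_measurable.
have a0 (x : R) : (0 <= (`|x|)%:E)%E by rewrite lee_fin.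
have E := ge0_integral_normal_variable ma a0.
apply: (@le_lt_trans _ _ (\int[Q]_w (`|zeta w|)%:E)%E) => //.
rewrite E; have /integrableP[_] := integrable_normal_pdf_first_moment.
apply: le_lt_trans; apply: ge0_le_integral => //.
- by move=> x _; rewrite mule_ge0 ?lee_fin.
- by apply: emeasurable_funM => //; exact/measurable_EFinP.
- apply/measurable_EFinP; apply: measurableT_comp => //.
  by apply: measurable_funM => //; exact: measurableT_comp.
- by move=> x _; rewrite /= -EFinM lee_fin mulrC ler_norm.
Qed.

End normal_variable.

End gaussian_cosine.

(** * Approximation by trigonometric polynomials *)

(** Near each point of the compact interval one delta serves; y may leave the
    interval. *)
Lemma locally_uniformly_continuous (R : realType) (f : R -> R) (M e : R) :
  continuous f -> 0 < e ->
  exists2 delta, 0 < delta & forall x y, `|x| <= M -> `|x - y| < delta -> `|f x - f y| < e.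
Proof.
move=> cf e0.
have := @segment_compact R (- M) M; rewrite compact_near_coveringP => cov.
have := cov R 0^'+ (fun delta x => forall y, `|x - y| < delta -> `|f x - f y| < e) _.
have near_x x : `[- M, M]%classic x -> \forall x' \near x & delta \near 0^'+,
    forall y, `|x' - y| < delta -> `|f x' - f y| < e.
  move=> _; have /cvgrPdist_lt /(_ (e / 2)) := cf x.
  rewrite divr_gt0// => /(_ isT) /nbhs_ballP[r /= r0 xr].
  near=> x' delta => y xy.
  have xx' : `|x - x'| < r / 2.
    by near: x'; apply/nbhs_ballP; exists (r / 2) => //=; rewrite divr_gt0.
  have dr : delta < r / 2 by near: delta; apply: nbhs_right_lt; rewrite divr_gt0.
  have h1 : `|f x - f x'| < e / 2.
    by apply: xr; rewrite /ball/= (lt_trans xx')//; lra.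
  have h2 : `|f x - f y| < e / 2.
    apply: xr; rewrite /ball/= -(subrK x' x) -addrA (le_lt_trans (ler_normD _ _))//.
    by rewrite [r]splitr ltrD// (lt_trans xy).
  rewrite -(subrK (f x) (f x')) -addrA (le_lt_trans (ler_normD _ _))//.
  by rewrite [e]splitr ltrD// distrC.
move=> /(_ _ near_x); rewrite /at_right /within/= => /nbhs_ballP[r /= r0 H].
exists (r / 2); first by rewrite divr_gt0.
move=> x y xM xy; apply: (H (r / 2)) => //.
- by rewrite /ball/= sub0r normrN gtr0_norm ?divr_gt0//; lra.
- by rewrite divr_gt0.
- by rewrite /= in_itv/= -ler_norml.
Unshelve. all: end_near. Qed.

Section bernstein.
Context (R : realType).
Implicit Types (y : R) (phi psi : nat -> R).

(** The mean of phi at a binomial variable of parameters n and y, that is, the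
    Bernstein polynomial with coefficients phi k at y. The recursion conditions
    on one trial. *)
Fixpoint bernstein y n phi : R :=
  if n is m.+1 then (1 - y) * bernstein y m phi + y * bernstein y m (phi \o S)
  else phi 0%N.

Lemma bernstein_le y n phi psi : 0 <= y <= 1 -> (forall k, phi k <= psi k) ->
  bernstein y n phi <= bernstein y n psi.
Proof.
move=> /andP[y0 y1]; elim: n phi psi => [|n IH] phi psi h /=; first exact: h.
by rewrite lerD// ler_wpM2l// ?subr_ge0// IH// => k; exact: h.
Qed.

Lemma bernstein_affine y n phi (a b : R) :
  bernstein y n (fun k => a + b * phi k) = a + b * bernstein y n phi.
Proof.
elim: n phi => [//|n IH] phi /=.
by rewrite IH (_ : _ \o S = (fun k => a + b * (phi \o S) k))// IH; ring.
Qed.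

(** For c = n y this is the variance of the binomial law. *)
Lemma bernstein_variance y n (c : R) :
  bernstein y n (fun k => (k%:R - c) ^+ 2) = (n%:R * y - c) ^+ 2 + n%:R * y * (1 - y).
Proof.
elim: n c => [|n IH] c /=; first by rewrite !mul0r addr0.
rewrite IH (_ : _ \o S = (fun k : nat => (k%:R - (c - 1)) ^+ 2)).
  by rewrite IH -natr1; ring.
by apply/funext => k /=; rewrite -natr1; congr (_ ^+ 2); ring.
Qed.

(** The quadratic error averages to A times the variance of the binomial law. *)
Lemma bernstein_approx y n phi (c e A : R) : 0 <= y <= 1 -> 0 <= A ->
  (forall k : nat, `|phi k - c| <= e + A * (k%:R - n%:R * y) ^+ 2) ->
  `|bernstein y n phi - c| <= e + A * n%:R.
Proof.
move=> y01 A0 H; have /andP[y0 y1] := y01.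
have V : A * (n%:R * y * (1 - y)) <= A * n%:R.
  rewrite ler_wpM2l// -mulrA ler_piMr// mulr_ile1 ?subr_ge0//.
  by rewrite lerBlDr lerDl.
have E (s : R) : bernstein y n (fun k => (c + s * e) + (s * A) * (k%:R - n%:R * y) ^+ 2) =
    c + s * (e + A * (n%:R * y * (1 - y))).
  by rewrite bernstein_affine bernstein_variance subrr expr0n/= add0r; ring.
rewrite ler_distl; apply/andP; split.
  apply: (@le_trans _ _ (c - (e + A * (n%:R * y * (1 - y))))).
    by rewrite lerD2l lerN2 lerD2l.
  rewrite -[X in _ - X]mul1r -mulNr -E; apply: bernstein_le => // k.
  by have := H k; rewrite ler_distl => /andP[+ _]; apply: le_trans; rewrite !mulN1r mulNr opprD addrA.
apply: (@le_trans _ _ (c + (e + A * (n%:R * y * (1 - y))))); last by rewrite lerD2l lerD2l.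
rewrite -[X in c + X]mul1r -E; apply: bernstein_le => // k.
by have := H k; rewrite ler_distl => /andP[_]; rewrite !mul1r addrA.
Qed.

Lemma bernstein_bound y n phi (C : R) : 0 <= y <= 1 -> (forall k, `|phi k| <= C) ->
  `|bernstein y n phi| <= C.
Proof.
move=> y01 H; have := @bernstein_approx y n phi 0 C 0 y01 (lexx 0).
rewrite subr0 mul0r addr0; apply => k.
by rewrite subr0 mul0r addr0.
Qed.

End bernstein.

Section trigonometric_approximation.
Context (R : realType).

Let half_sine (s x : R) : R := (1 + sin (s * x)) / 2.

Let half_sine01 s x : 0 <= half_sine s x <= 1.
Proof.
rewrite /half_sine; apply/andP; split.
  by rewrite divr_ge0// -lerBlDl sub0r sin_geN1.
by rewrite ler_pdivrMr// mul1r (_ : 2 = 1 + 1)// lerD2l sin_le1.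
Qed.

Lemma asin_lipschitz (x y : R) : `|x| <= 2^-1 -> `|y| <= 2^-1 ->
  `|asin x - asin y| <= 2 * `|x - y|.
Proof.
move=> x2 y2.
have bnd (z : R) : Num.min y x <= z <= Num.max y x -> `|z| <= 2^-1.
  move=> /andP[zl zu]; move: x2 y2; rewrite !ler_norml => /andP[x1 x2] /andP[y1 y2].
  apply/andP; split; first by apply: le_trans zl; rewrite le_min x1 y1.
  by apply: le_trans zu _; rewrite ge_max x2 y2.
have bnd1 (z : R) : `|z| <= 2^-1 -> -1 < z < 1.
  move=> z2; have : `|z| < 1 by rewrite (le_lt_trans z2)// invf_lt1// ltr1n.
  by rewrite ltr_norml.
apply: (@mean_value_le _ _ (fun z => (Num.sqrt (1 - z ^+ 2))^-1)).
  by move=> z /bnd /bnd1; exact: is_derive1_asin.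
move=> z /bnd z2.
have zz : z ^+ 2 <= 4^-1.
  have -> : z ^+ 2 = `|z| ^+ 2 by rewrite real_normK// num_real.
  rewrite (_ : 4^-1 = 2^-1 ^+ 2 :> R); last by rewrite exprVn -natrX.
  by rewrite lerXn2r// nnegrE// invr_ge0.
have h : 2^-1 <= Num.sqrt (1 - z ^+ 2).
  rewrite -[leLHS]ger0_norm ?invr_ge0// -sqrtr_sqr ler_wsqrtr//.
  by rewrite exprVn -natrX; lra.
have s0 : 0 < Num.sqrt (1 - z ^+ 2) by rewrite (lt_le_trans _ h)// invr_gt0.
rewrite ger0_norm ?invr_ge0 ?(ltW s0)//.
by rewrite -[leRHS]invrK lef_pV2 ?posrE ?invr_gt0.
Qed.

(** When |s x| <= 1 / 2, x is a Lipschitz function of the half sine of x. On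
    [-M, M], f is thus a continuous function of the half sine, which Bernstein
    polynomials approximate. As the half sine takes its values in [0, 1], they
    keep the bound C for every x. *)
Lemma trigonometric_approximation (f : R -> R) (C M e : R) : continuous f ->
  (forall x, `|f x| <= C) -> 0 < M -> 0 < e ->
  exists s n (phi : nat -> R),
    (forall x, `|bernstein (half_sine s x) n phi| <= C) /\
    forall x, `|x| <= M -> `|bernstein (half_sine s x) n phi - f x| <= e.
Proof.
move=> cf fC M0 e0.
have e20 : 0 < e / 2 by rewrite divr_gt0.
have [delta d0 fd] := @locally_uniformly_continuous _ f M (e / 2) cf e20.
pose s := (2 * M)^-1.
have s0 : 0 < s by rewrite invr_gt0 mulr_gt0.
(* Each node is a preimage of k / n under the half sine; clamping keeps the
   arguments of asin where it is Lipschitz. *)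
pose clamp (y : R) := Num.max (- 2^-1) (Num.min y 2^-1).
have clamp_le y : `|clamp y| <= 2^-1.
  rewrite /clamp ler_norml le_max lexx/= ge_max ge_min lexx orbT andbT.
  by rewrite (@le_trans _ _ 0)// ?oppr_le0 ?invr_ge0.
have clamp_lip y z : `|z| <= 2^-1 -> `|clamp y - z| <= `|y - z|.
  rewrite ler_norml => /andP[z1 z2]; rewrite /clamp.
  have [y2|/ltW y2] := leP y 2^-1.
    have [y1|/ltW y1] := leP (- 2^-1) y; first by [].
    by rewrite distrC ger0_norm ?subr_ge0// distrC ger0_norm ?lerB// subr_ge0 (le_trans y1).
  rewrite max_r; last by rewrite (le_trans z1).
  by rewrite ger0_norm ?subr_ge0// ger0_norm ?lerB// subr_ge0 (le_trans z2).
have C0 : 0 <= C by apply: le_trans (fC 0).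
pose A0 := 2 * C * (4 / (s * delta)) ^+ 2.
have A0_ge0 : 0 <= A0 by rewrite mulr_ge0 ?sqr_ge0// mulr_ge0.
pose n := (Num.bound (A0 / (e / 2))).+1.
have n0 : 0 < n%:R :> R by rewrite ltr0n.
pose node (k : nat) : R := asin (clamp (2 * (k%:R / n%:R) - 1)) / s.
exists s, n, (f \o node); split.
  by move=> x; apply: bernstein_bound => // k; exact: fC.
move=> x xM.
have sx : `|s * x| <= 2^-1.
  by rewrite normrM (gtr0_norm s0) mulrC ler_pdivrMr ?mulr_gt0// mulKf.
have ssx : `|sin (s * x)| <= 2^-1 by exact: le_trans (norm_sin _) sx.
have xE : x = asin (sin (s * x)) / s.
  rewrite sinK; first by rewrite mulrAC divff ?mul1r// gt_eqF.
  have pi2 : 2^-1 <= pi / 2 :> R.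
    by rewrite ler_pdivlMr// mulVf// (le_trans _ (pi_ge2 _))// ler1n.
  by rewrite in_itv/= -ler_norml (le_trans sx).
have node_lip k : `|node k - x| <= 4 / s * `|k%:R / n%:R - half_sine s x|.
  have s'0 : 0 < s^-1 by rewrite invr_gt0.
  rewrite [in leLHS]xE /node -mulrBl normrM (gtr0_norm s'0).
  rewrite [leRHS]mulrAC ler_pM2r//.
  apply: le_trans (asin_lipschitz (clamp_le _) ssx) _.
  rewrite (_ : 4 = 2 * 2 :> R); last by rewrite -natrM.
  rewrite -mulrA ler_pM2l//; apply: le_trans (clamp_lip _ _ ssx) _.
  rewrite -[X in _ <= X * _]ger0_norm// -normrM /half_sine.
  rewrite (_ : 2 * _ - 1 - _ = 2 * (k%:R / n%:R - (1 + sin (s * x)) / 2))//.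
  by field; rewrite gt_eqF.
apply: (@le_trans _ _ (e / 2 + A0 / n%:R ^+ 2 * n%:R)); last first.
  rewrite [leRHS]splitr lerD2l expr2 invfM mulrA mulfVK ?gt_eqF//.
  rewrite ler_pdivrMr// mulrC -ler_pdivrMr ?divr_gt0//.
  by rewrite (le_trans (ltW (archi_boundP _)))// ?ler_nat// divr_ge0// ltW// divr_gt0.
apply: bernstein_approx => //; first by rewrite divr_ge0// sqr_ge0.
move=> k /=.
have [kd|kd] := ltP `|x - node k| delta.
  rewrite distrC (le_trans (ltW (fd _ _ xM kd)))// lerDl mulr_ge0 ?sqr_ge0//.
  by rewrite divr_ge0// sqr_ge0.
apply: (@le_trans _ _ (2 * C)).
  by rewrite (le_trans (ler_normB _ _))// mulr_natl mulr2n lerD.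
rewrite -[leLHS]add0r lerD//; first by rewrite divr_ge0// ltW.
have := node_lip k; rewrite distrC => /(le_trans kd) kd1.
have t1 : 1 <= (4 / (s * delta) * `|k%:R / n%:R - half_sine s x|) ^+ 2.
  rewrite -[leLHS](expr1n _ 2) lerXn2r ?nnegrE//.
    by rewrite mulr_ge0// divr_ge0// ltW// mulr_gt0.
  have -> t : 4 / (s * delta) * t = 4 / s * t / delta.
    by field; rewrite !gt_eqF.
  by rewrite ler_pdivlMr// mul1r.
apply: (@le_trans _ _ (2 * C * (4 / (s * delta) * `|k%:R / n%:R - half_sine s x|) ^+ 2)).
  by rewrite -[leLHS]mulr1 ler_wpM2l// mulr_ge0.
rewrite exprMn real_normK ?num_real// mulrA -/A0 -mulrA ler_wpM2l//.
rewrite le_eqVlt; apply/orP; left; apply/eqP.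
by field; rewrite gt_eqF.
Qed.

End trigonometric_approximation.

(** * Weak convergence from cosine transforms *)

Section weak_convergence.
Context (R : realType) (d : nat -> measure_display) (T : forall n, measurableType (d n)).
Context (P : forall n, probability (T n) R) (Z : forall n, T n -> R).
Context (d' : measure_display) (T' : measurableType d') (Q : probability T' R) (zeta : T' -> R).
Variable V : R.
Hypothesis mZ : forall n, measurable_fun [set: T n] (@Z n).
Hypothesis mzeta : measurable_fun [set: T'] zeta.
Hypothesis IZ : forall n, (P n).-integrable [set: T n] (EFin \o @Z n).
Hypothesis Izeta : Q.-integrable [set: T'] (EFin \o zeta).
Hypothesis ZV : forall n, \int[P n]_w `|@Z n w| <= V.
Hypothesis zetaV : \int[Q]_w `|zeta w| <= V.
Hypothesis cvg_cosine : forall a b : R,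
  \int[P n]_w cos (a * @Z n w + b) @[n --> \oo] --> \int[Q]_w cos (a * zeta w + b).

Local Notation bm := (@bounded_measurable _ R R [set: R]).

Let lims (g : R -> R) : Prop :=
  \int[P n]_w g (@Z n w) @[n --> \oo] --> \int[Q]_w g (zeta w).

Let bounded_integrable_comp dS (S : measurableType dS) (p : probability S R) (Y : S -> R)
    (g : R -> R) : measurable_fun [set: S] Y -> bm g ->
  p.-integrable [set: S] (EFin \o (fun w => g (Y w))).
Proof.
move=> mY [mg [M gM]]; apply: (@bounded_integrable _ _ _ _ _ M).
  exact: measurableT_comp mg mY.
by move=> w; exact: gM.
Qed.

Let limD (g h : R -> R) : bm g -> bm h -> lims g -> lims h -> lims (fun x => g x + h x).
Proof.
move=> bg bh lg lh; rewrite /lims.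
have E dS (S : measurableType dS) (p : probability S R) (Y : S -> R) : measurable_fun [set: S] Y ->
    \int[p]_w (g (Y w) + h (Y w)) = \int[p]_w g (Y w) + \int[p]_w h (Y w).
  by move=> mY; apply: RintegralD_setT; exact: bounded_integrable_comp.
rewrite E//; have -> : (fun n => \int[P n]_w (g (@Z n w) + h (@Z n w))) =
    (fun n => \int[P n]_w g (@Z n w) + \int[P n]_w h (@Z n w)).
  by apply/funext => n; rewrite E.
exact: cvgD.
Qed.

Let limZ (c : R) (g : R -> R) : bm g -> lims g -> lims (fun x => c * g x).
Proof.
move=> bg lg; rewrite /lims RintegralZl//; last exact: bounded_integrable_comp.
have -> : (fun n => \int[P n]_w (c * g (@Z n w))) = (fun n => c * \int[P n]_w g (@Z n w)).
  by apply/funext => n; rewrite RintegralZl//; exact: bounded_integrable_comp.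
by apply: cvgM => //; exact: cvg_cst.
Qed.

Let bounded_measurable_cos (a b : R) : bm (fun x => cos (a * x + b)).
Proof.
split; last by exists 1 => x _; rewrite ler_norml cos_geN1 cos_le1.
apply: continuous_measurable_fun => x; apply: continuous_comp; last exact: continuous_cos.
by apply: cvgD; [exact: mulrl_continuous|exact: cvg_cst].
Qed.

Let bounded_measurable_bernstein (s : R) n (phi : nat -> R) :
  bm (fun x => bernstein ((1 + sin (s * x)) / 2) n phi).
Proof.
have bs : bm (fun x => (1 + sin (s * x)) / 2).
  rewrite (_ : (fun x => _) = (fun x => 2^-1 * (1 + cos (s * x + - (pi / 2))))).
    by apply: bounded_measurableZ; apply: bounded_measurableD => //; exact: bounded_measurable_cst.
  by apply/funext => x; rewrite mulrC cosBpihalf.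
elim: n phi => [|n IH] phi /=; first exact: bounded_measurable_cst.
apply: bounded_measurableD => //; apply: bounded_measurableM => //.
by apply: bounded_measurableB => //; exact: bounded_measurable_cst.
Qed.

(** The product of sin (s x) with a cosine is a sum of two cosines. *)
Let lim_bernstein (s : R) n (phi : nat -> R) (a b : R) :
  lims (fun x => bernstein ((1 + sin (s * x)) / 2) n phi * cos (a * x + b)).
Proof.
elim: n phi a b => [|n IH] phi a b.
  by apply: limZ; [exact: bounded_measurable_cos|exact: cvg_cosine].
pose g (phi : nat -> R) (a b x : R) :=
  bernstein ((1 + sin (s * x)) / 2) n phi * cos (a * x + b).
have bg phi' a' b' : bm (g phi' a' b').
  by apply: bounded_measurableM; [exact: bounded_measurable_bernstein|exact: bounded_measurable_cos].
have -> : (fun x => bernstein ((1 + sin (s * x)) / 2) n.+1 phi * cos (a * x + b)) =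
  (fun x => (2^-1 * g phi a b x + 2^-1 * g (phi \o S) a b x) +
     ((- 4^-1) * (g phi (s + a) (b - pi / 2) x + g phi (s - a) (- b - pi / 2) x) +
      4^-1 * (g (phi \o S) (s + a) (b - pi / 2) x + g (phi \o S) (s - a) (- b - pi / 2) x))).
  apply/funext => x; rewrite /g /=.
  have E : sin (s * x) * cos (a * x + b) =
      2^-1 * (cos ((s + a) * x + (b - pi / 2)) + cos ((s - a) * x + (- b - pi / 2))).
    rewrite (_ : (s + a) * x + (b - pi / 2) = (s * x + (a * x + b)) - pi / 2); last by ring.
    rewrite (_ : (s - a) * x + (- b - pi / 2) = (s * x - (a * x + b)) - pi / 2); last by ring.
    rewrite !cosBpihalf.
    by rewrite sinD sinB; field.
  transitivity (2^-1 * (bernstein ((1 + sin (s * x)) / 2) n phi * cos (a * x + b) +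
     bernstein ((1 + sin (s * x)) / 2) n (phi \o S) * cos (a * x + b)) +
     2^-1 * (bernstein ((1 + sin (s * x)) / 2) n (phi \o S) -
      bernstein ((1 + sin (s * x)) / 2) n phi) * (sin (s * x) * cos (a * x + b))).
    by field.
  by rewrite E; field.
have bZ c phi' a' b' : bm (fun x => c * g phi' a' b' x) by exact: bounded_measurableZ.
have b2 phi' a' b' phi'' a'' b'' : bm (fun x => g phi' a' b' x + g phi'' a'' b'' x).
  exact: bounded_measurableD.
have L phi' a' b' : lims (g phi' a' b') by exact: IH.
have b2Z c phi' a' b' phi'' a'' b'' : bm (fun x => c * (g phi' a' b' x + g phi'' a'' b'' x)).
  exact: bounded_measurableZ.
apply: limD; [exact: bounded_measurableD|exact: bounded_measurableD| |].
  by apply: limD => //; exact: limZ.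
by apply: limD => //; apply: limZ => //; exact: limD.
Qed.

(** The trigonometric approximations h of f inherit the convergence of the
    cosines. The error is at most e / 8 on [-M, M], and the first moments
    control the rest. *)
Lemma weak_convergence_of_cosines (f : R -> R) (C : R) : continuous f ->
  (forall x, `|f x| <= C) -> lims f.
Proof.
move=> cf fC; apply/cvgrPdist_lt => e e0.
have C0 : 0 <= C by apply: le_trans (fC 0).
have V0 : 0 <= V by apply: le_trans zetaV; apply: Rintegral_ge0.
(* This makes 2 C V / M at most e / 8. *)
pose M := 16 * C * V / e + 1.
have M0 : 0 < M by rewrite ltr_wpDl// divr_ge0 ?(ltW e0)// !mulr_ge0.
have e8 : 0 < e / 8 by rewrite divr_gt0.
have [s [n [phi [hC hf]]]] := trigonometric_approximation cf fC M0 e8.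
pose h x := bernstein ((1 + sin (s * x)) / 2) n phi.
have bh : bm h by exact: bounded_measurable_bernstein.
have bf : bm f by split; [exact: continuous_measurable_fun|exists C].
have lh : lims h.
  have : lims (fun x => h x * cos (0 * x + 0)) by exact: lim_bernstein.
  by rewrite (_ : (fun x => _) = h)//; apply/funext => x; rewrite mul0r addr0 cos0 mulr1.
have fh (x : R) : `|f x - h x| <= e / 8 + 2 * C / M * `|x|.
  have [xM|/ltW xM] := leP `|x| M.
    by rewrite distrC (le_trans (hf _ xM))// lerDl mulr_ge0// divr_ge0 ?(ltW M0)// mulr_ge0.
  rewrite (le_trans (ler_normB _ _))// (@le_trans _ _ (2 * C))//.
    by rewrite mulr_natl mulr2n lerD//; exact: hC.
  rewrite -[leLHS]add0r lerD ?(ltW e8)// mulrAC ler_pdivlMr//.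
  by rewrite ler_wpM2l// mulr_ge0.
have close dS (S : measurableType dS) (p : probability S R) (Y : S -> R) :
    measurable_fun [set: S] Y -> p.-integrable [set: S] (EFin \o Y) ->
    \int[p]_w `|Y w| <= V ->
    `|\int[p]_w f (Y w) - \int[p]_w h (Y w)| <= e / 4.
  move=> mY IY YV.
  have If := bounded_integrable_comp p mY bf.
  have Ih := bounded_integrable_comp p mY bh.
  have Ifh : p.-integrable [set: S] (EFin \o (fun w => f (Y w) - h (Y w))).
    exact: (bounded_integrable_comp p mY (bounded_measurableB bf bh)).
  rewrite -(RintegralB measurableT If Ih).
  apply: (le_trans (le_normr_Rintegral measurableT Ifh)).
  have IaY : p.-integrable [set: S] (EFin \o (fun w => 2 * C / M * `|Y w|)).
    have := integrableZl measurableT (2 * C / M) (integrable_abse IY).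
    by [].
  have Ic : p.-integrable [set: S] (EFin \o (fun=> e / 8)).
    by apply: (@bounded_integrable _ _ _ _ _ `|e / 8|).
  apply: (@le_trans _ _ (\int[p]_w (e / 8 + 2 * C / M * `|Y w|))).
    apply: le_Rintegral => //.
    - exact: (integrable_abse Ifh).
    - exact: integrableD Ic IaY.
  rewrite (RintegralD_setT Ic IaY) Rintegral_setT_cst RintegralZl//; last first.
    by have := integrable_abse IY.
  apply: (@le_trans _ _ (e / 8 + 2 * C / M * V)).
    by rewrite lerD2l ler_wpM2l// divr_ge0 ?(ltW M0)// mulr_ge0.
  rewrite (_ : e / 4 = e / 8 + e / 8); last by field.
  rewrite lerD2l mulrAC ler_pdivrMr// /M mulrDr mulr1 -[leLHS]addr0 lerD ?(ltW e8)//.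
  rewrite le_eqVlt; apply/orP; left; apply/eqP; field.
  by rewrite gt_eqF.
have e4 : 0 < e / 4 by rewrite divr_gt0.
move/cvgrPdist_lt : lh => /(_ _ e4); apply: filterS => k lk.
have c1 := close _ _ (P k) _ (@mZ k) (@IZ k) (@ZV k).
have c2 := close _ _ Q _ mzeta Izeta zetaV.
set A := \int[Q]_w f _ in c2 *; set B := \int[Q]_w h _ in c2 lk.
set A' := \int[P k]_w f _ in c1 *; set B' := \int[P k]_w h _ in c1 lk.
rewrite (_ : A - A' = (A - B) + (B - B') - (A' - B')); last by ring.
rewrite (le_lt_trans (ler_normB _ _))// (le_lt_trans (lerD (ler_normD _ _) c1))//.
apply: (@lt_le_trans _ _ (e / 4 + e / 4 + e / 4)); last by lra.
by rewrite ltrD2r ler_ltD.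
Qed.

End weak_convergence.

(** * Oscillation of the empirical process *)

Section empirical_process.
Context (R : realType) (tau : R) (f : R -> R) (lo hi : R).
Hypothesis tau0 : 0 < tau.
Hypothesis mf : measurable_fun (`[0, tau]%classic : set R) f.
Hypothesis lo0 : 0 < lo.
Hypothesis f_bnd : forall t, t \in `[0, tau] -> lo <= f t <= hi.
Context (d : nat -> measure_display) (T : forall n, measurableType (d n)).
Context (P : forall n, probability (T n) R) (X : forall n, 'I_n -> T n -> cumulative R R).
Hypothesis HX : forall n j, poisson_process tau f (P n) (@X n j).
Hypothesis iX : forall n, mutually_independent (P n) (fun j => sigma_of_process tau (@X n j)).

Local Notation bm := (@bounded_measurable _ (measurableTypeR R) R (`]0, tau]%classic)).
Local Notation total := (compensator tau f (fun=> 1)).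

(** The empirical process: the centred sum of the stochastic integrals of phi,
    divided by sqrt n. *)
Definition empirical n (phi : R -> R) (w : T n) : R :=
  (\sum_j centered_int tau f (@X n j) phi w) / Num.sqrt n%:R.

Lemma sigma_of_stoch_int n (j : 'I_n) phi A : bm phi ->
  sigma_of (centered_int tau f (@X n j) phi) A -> sigma_of_process tau (@X n j) A.
Proof.
move=> bp [B mB <-].
set G := \bigcup_(t in `[0, tau]) sigma_of (fun w => @X n j w t).
have mX t : t \in `[0, tau] ->
    measurable_fun [set: g_sigma_algebraType G] (fun w : g_sigma_algebraType G => @X n j w t).
  move=> t0 _ C mC; apply: sub_gen_smallest; exists t; first exact: t0.
  by exists C.
have mS := @measurable_stoch_int_kernel _ _ tau0 _ _ _ phi mX bp.
have mW := measurable_funB mS (measurable_cst (compensator tau f phi)).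
by have := mW measurableT B mB; exact.
Qed.

Lemma independent_centered_int n phi : bm phi ->
  independent_variables (P n) (fun j => centered_int tau f (@X n j) phi).
Proof.
move=> bp A HA; apply: (@iX n A) => j.
exact: sigma_of_stoch_int (HA j).
Qed.

Lemma measurable_centered_int n (j : 'I_n) phi : bm phi ->
  measurable_fun [set: T n] (centered_int tau f (@X n j) phi).
Proof.
move=> bp; have [/measurable_int /measurable_EFinP + _ _ _] :=
  centered_int_moments tau0 mf lo0 f_bnd (HX j) bp.
by [].
Qed.

Lemma compensator_sqr_ge0 phi : bm phi -> 0 <= compensator tau f (fun t => phi t ^+ 2).
Proof.
move=> bp; rewrite -[X in X <= _](_ : compensator tau f (fun=> 0) = 0).
  apply: (le_compensator mf lo0 f_bnd) => //; first exact: bounded_measurable_cst.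
    exact: bounded_measurable_sqr.
  by move=> t _; exact: sqr_ge0.
by rewrite /compensator; under eq_Rintegral do rewrite mul0r; rewrite Rintegral_cst// mul0r.
Qed.

Lemma empirical_moment n phi : bm phi ->
  (P n).-integrable [set: T n] (EFin \o @empirical n phi) /\
  \int[P n]_w `|@empirical n phi w| <= 1 + compensator tau f (fun t => phi t ^+ 2).
Proof.
move=> bp; apply: (@normalized_sum_moment R d T P (fun n j => centered_int tau f (@X n j) phi)).
- exact: compensator_sqr_ge0.
- by move=> k j; exact: measurable_centered_int.
- by move=> k; exact: independent_centered_int.
- by move=> k j; case: (centered_int_moments tau0 mf lo0 f_bnd (HX j) bp).
- by move=> k j; case: (centered_int_moments tau0 mf lo0 f_bnd (HX j) bp).
- by move=> k j; case: (centered_int_moments tau0 mf lo0 f_bnd (HX j) bp).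
- by move=> k j; case: (centered_int_moments tau0 mf lo0 f_bnd (HX j) bp).
Qed.

Lemma empiricalB n phi psi w : bm phi -> bm psi ->
  @empirical n (fun t => phi t - psi t) w = @empirical n phi w - @empirical n psi w.
Proof.
move=> bp bq; rewrite /empirical -mulrBl -sumrB; congr (_ / _); apply: eq_bigr => j _.
have E1 := stoch_intB tau0 (@X n j w) bp bq; have E2 := compensatorB mf lo0 f_bnd bp bq.
rewrite /centered_int E1 E2.
move: (stoch_int _ _ phi) (stoch_int _ _ psi) (compensator _ _ phi) (compensator _ _ psi) => s s' c c'.
by ring.
Qed.

Lemma empiricalZ n (c : R) phi w : bm phi ->
  @empirical n (fun t => c * phi t) w = c * @empirical n phi w.
Proof.
move=> bp; rewrite /empirical mulrA mulr_sumr; congr (_ / _); apply: eq_bigr => j _.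
by rewrite /centered_int (stoch_intZ tau0)// (compensatorZ mf lo0 f_bnd)// mulrBr.
Qed.

(** Apply the previous moment bound to phi / c. *)
Lemma empirical_moment_le n phi (c : R) : bm phi -> 0 < c ->
  (forall t, `]0, tau]%classic t -> `|phi t| <= c) ->
  \int[P n]_w `|@empirical n phi w| <= c * (1 + total).
Proof.
move=> bp c0 pc; pose psi t := c^-1 * phi t.
have bpsi : bm psi by exact: bounded_measurableZ.
have [Ipsi Epsi] := empirical_moment n bpsi.
have -> : \int[P n]_w `|@empirical n phi w| = c * \int[P n]_w `|@empirical n psi w|.
  rewrite -RintegralZl//; last exact: (integrable_norm Ipsi).
  apply: eq_Rintegral => w _; rewrite -{1}(gtr0_norm c0) -normrM; congr `|_|.
  by rewrite /psi empiricalZ// mulrA divff ?mul1r// gt_eqF.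
rewrite ler_pM2l// (le_trans Epsi)// lerD2l.
apply: (le_compensator mf lo0 f_bnd); first exact: bounded_measurable_sqr.
  exact: bounded_measurable_cst.
move=> t Dt; rewrite /psi -real_normK ?num_real// expr_le1//.
by rewrite normrM gtr0_norm ?invr_gt0// mulrC ler_pdivrMr// mul1r pc.
Qed.

Definition total_count n (w : T n) : R := \sum_j (@X n j w tau - @X n j w 0).

Lemma total_count_moment n :
  (P n).-integrable [set: T n] (EFin \o @total_count n) /\
  \int[P n]_w total_count w = n%:R * total.
Proof.
have b1 : bm (fun=> 1) by exact: bounded_measurable_cst.
have E j : (fun w => @X n j w tau - @X n j w 0) =
    (fun w => stoch_int tau (@X n j w) (fun=> 1)).
  by apply/funext => w; rewrite stoch_int_cst// mul1r.
have M j := stoch_int_moments tau0 mf lo0 f_bnd (@HX n j) b1.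
have I j : (P n).-integrable [set: T n] (EFin \o (fun w => @X n j w tau - @X n j w 0)).
  by rewrite E; case: (M j).
have [I1 E1] := integrable_sum_seq (index_enum 'I_n) I.
split; first exact: I1.
rewrite E1 (eq_bigr (fun=> total)).
  by rewrite sumr_const card_ord mulr_natl.
by move=> j _; rewrite E; case: (M j).
Qed.

(** A crude bound, of order c sqrt n, which suffices when c is of order 1 / n. *)
Lemma empirical_le n phi (c : R) w : bm phi -> (0 < n)%N ->
  (forall t, `]0, tau]%classic t -> `|phi t| <= c) ->
  `|@empirical n phi w| <= c * (total_count w + n%:R * total) / Num.sqrt n%:R.
Proof.
move=> bp n0 pc; rewrite /empirical normrM [X in _ * X]ger0_norm ?invr_ge0 ?sqrtr_ge0//.
rewrite ler_wpM2r ?invr_ge0 ?sqrtr_ge0//.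
apply: le_trans (ler_norm_sum _ _ _) _.
have -> : c * (total_count w + n%:R * total) =
    \sum_(j < n) (c * (@X n j w tau - @X n j w 0) + c * total).
  rewrite big_split/= -mulr_sumr sumr_const card_ord mulrDr; congr (_ + _).
  by rewrite mulrCA mulr_natl.
apply: ler_sum => j _; rewrite (le_trans (ler_normB _ _))// lerD//.
  exact: le_stoch_int.
exact: (norm_compensator_le mf lo0 f_bnd).
Qed.

(** The parameter being one-dimensional and Phi Lipschitz, sums of increments
    over a grid have bounded means: U collects the absolute increments between
    the n points of a regular grid, each of mean at most B (1 + total) times the
    step, and the crude bound on the distance between Phi h and its value at the
    nearest grid point. The grid avoids the end points a and b, where Phi is not
    controlled. *)
Lemma empirical_oscillation n (a b B : R) (Phi : R -> R -> R) : (0 < n)%N -> a < b -> 0 < B ->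
  (forall h, a < h < b -> bm (Phi h)) ->
  (forall h h' t, a < h < b -> a < h' < b -> `]0, tau]%classic t ->
     `|Phi h t - Phi h' t| <= B * `|h - h'|) ->
  exists U : T n -> R, [/\ (P n).-integrable [set: T n] (EFin \o U), forall w, 0 <= U w,
    \int[P n]_w U w <= B * (b - a) * (1 + 3 * total) * 2 &
    forall w h h', a < h < b -> a < h' < b ->
      `|@empirical n (Phi h) w - @empirical n (Phi h') w| <= U w].
Proof.
move=> n0 ab B0 bPhi Phi_lip.
have ba : 0 < b - a by rewrite subr_gt0.
have n1 : 0 < n.+1%:R :> R by rewrite ltr0n.
have nn : 0 < n%:R :> R by rewrite ltr0n.
pose step : R := (b - a) / n.+1%:R.
have step0 : 0 < step by rewrite divr_gt0.
pose m k : R := a + step * k%:R.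
have nstep : step * n.+1%:R = b - a by rewrite /step mulfVK ?gt_eqF.
have m_in k : (0 < k)%N -> (k <= n)%N -> a < m k < b.
  move=> k0 kn; rewrite /m ltrDl mulr_gt0 ?ltr0n//=.
  by rewrite -ltrBrDl -nstep ltr_pM2l// ltr_nat ltnS.
have near_m h : a < h < b -> exists k, [/\ (0 < k)%N, (k <= n)%N & `|h - m k| <= step].
  move=> /andP[ah hb]; pose x := (h - a) / step.
  have x0 : 0 <= x by rewrite divr_ge0 ?(ltW step0)// subr_ge0 ltW.
  have hE : h = a + step * x by rewrite /x mulrC mulfVK ?gt_eqF// addrCA subrr addr0.
  have xn : x < n.+1%:R by rewrite /x ltr_pdivrMr// mulrC nstep ltrD2r.
  have /andP[tx xt] := truncn_itv x0.
  have dist (k : nat) : `|x - k%:R| <= 1 -> `|h - m k| <= step.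
    move=> xk; rewrite hE /m opprD addrACA subrr add0r -mulrBr normrM (gtr0_norm step0).
    by rewrite -[leRHS]mulr1 ler_pM2l.
  have [t0|t0] := posnP (Num.truncn x).
    exists 1%N; split=> //; apply: dist; rewrite ler_norml.
    by move: xt; rewrite t0 => xt; apply/andP; split; lra.
  exists (Num.truncn x); split=> //.
    by rewrite -ltnS -(ltr_nat R) (le_lt_trans tx).
  apply: dist; rewrite ger0_norm ?subr_ge0// lerBlDr -natr1 in xt *.
  by rewrite addrC ltW.
pose D k (w : T n) := `|@empirical n (Phi (m k.+2)) w - @empirical n (Phi (m k.+1)) w|.
pose S (w : T n) := \sum_(0 <= k < n.-1) D k w.
pose V (w : T n) := B * step * (total_count w + n%:R * total) / Num.sqrt n%:R.
have B_step : 0 < B * step by rewrite mulr_gt0.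
have stepE : B * step * n%:R <= B * (b - a).
  rewrite -mulrA ler_pM2l// -nstep ler_pM2l// ler_nat; exact: leqnSn.
have bPm k : (k < n)%N -> bm (Phi (m k.+1)) by move=> kn; apply: bPhi; exact: m_in.
have bdiff k : (k.+1 < n)%N -> bm (fun t => Phi (m k.+2) t - Phi (m k.+1) t).
  by move=> kn; apply: bounded_measurableB; apply: bPm => //; exact: ltnW.
have DE k : (k.+1 < n)%N ->
    D k = (fun w => `|@empirical n (fun t => Phi (m k.+2) t - Phi (m k.+1) t) w|).
  move=> kn; apply/funext => w; rewrite empiricalB//; first exact: bPm.
  by apply: bPm; exact: ltnW.
have lt_pred (k : 'I_n.-1) : (k.+1 < n)%N by have := ltn_ord k; rewrite -ltnS prednK.
have ID (k : 'I_n.-1) : (P n).-integrable [set: T n] (EFin \o D k).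
  rewrite DE//; have [I1 _] := empirical_moment n (bdiff _ (lt_pred k)).
  exact: (integrable_norm I1).
have ED (k : 'I_n.-1) : \int[P n]_w D k w <= B * step * (1 + total).
  rewrite DE//; apply: empirical_moment_le => //; first exact: bdiff.
  move=> t Dt; apply: le_trans (Phi_lip _ _ _ _ _ Dt) _.
  - by apply: m_in => //; exact: lt_pred.
  - by apply: m_in => //; exact/ltnW/lt_pred.
  rewrite ler_pM2l// /m opprD addrACA subrr add0r -mulrBr -[k.+2%:R]natr1 [_ + 1]addrC addrK.
  by rewrite mulr1 gtr0_norm.
have SE : S = (fun w => \sum_(k < n.-1) D k w) by apply/funext => w; rewrite /S big_mkord.
have [IS ES] := integrable_sum_seq (index_enum 'I_n.-1) ID.
have [IN EN] := total_count_moment n.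
have tot0 : 0 <= total by exact: compensator1_ge0 mf lo0 f_bnd.
pose c := B * step / Num.sqrt n%:R.
have Icst : (P n).-integrable [set: T n] (EFin \o (fun=> n%:R * total)).
  by apply: (@bounded_integrable _ _ _ _ _ `|n%:R * total|).
have INc : (P n).-integrable [set: T n] (EFin \o (fun w => total_count w + n%:R * total)).
  exact: integrableD IN Icst.
have VE : V = (fun w => c * (total_count w + n%:R * total)).
  by apply/funext => w'; rewrite /V /c mulrAC.
have IV : (P n).-integrable [set: T n] (EFin \o V).
  by rewrite VE; have := integrableZl measurableT c INc.
have EV : \int[P n]_w V w <= B * (b - a) * (2 * total).
  rewrite VE RintegralZl// (RintegralD_setT IN Icst) EN Rintegral_setT_cst.
  have c_le : c <= B * step.
    rewrite /c ler_pdivrMr ?sqrtr_gt0// ler_peMr ?(ltW B_step)//.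
    by rewrite -[leLHS]sqrtr1 ler_wsqrtr// ler1n.
  apply: (@le_trans _ _ (B * step * (n%:R * total + n%:R * total))).
    by rewrite ler_wpM2r// addr_ge0// mulr_ge0.
  rewrite (_ : B * step * _ = B * step * n%:R * (2 * total)); last by ring.
  by rewrite ler_wpM2r// mulr_ge0.
have ESle : \int[P n]_w S w <= B * (b - a) * (1 + total).
  rewrite SE ES; apply: (@le_trans _ _ (\sum_(i < n.-1) B * step * (1 + total))).
    by apply: ler_sum => i _; exact: ED.
  rewrite sumr_const card_ord -[leLHS]mulr_natl mulrA ler_wpM2r ?addr_ge0//.
  rewrite (le_trans _ stepE)// mulrC ler_pM2l// ler_nat; exact: leq_pred.
have IS' : (P n).-integrable [set: T n] (EFin \o S) by rewrite SE.
have S_ge0 w : 0 <= S w by apply: sumr_ge0 => i _; exact: normr_ge0.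
have count_ge0 (w : T n) : 0 <= total_count w.
  apply: sumr_ge0 => j _; rewrite subr_ge0.
  by apply: cumulative_is_nondecreasing; exact: ltW.
have V_ge0 w : 0 <= V w.
  by rewrite /V divr_ge0 ?sqrtr_ge0// mulr_ge0 ?(ltW B_step)// addr_ge0// mulr_ge0.
pose U w := 2 * (S w + V w).
have ISV : (P n).-integrable [set: T n] (EFin \o (fun w => S w + V w)).
  exact: integrableD IS' IV.
exists U; split.
- by have := integrableZl measurableT 2 ISV.
- by move=> w; rewrite /U mulr_ge0// addr_ge0.
- rewrite /U RintegralZl// (RintegralD_setT IS' IV) [leLHS]mulrC ler_pM2r//.
  rewrite (_ : 1 + 3 * total = (1 + total) + 2 * total); last by ring.
  by rewrite mulrDr lerD.
have tele w k : (k < n)%N ->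
    `|@empirical n (Phi (m k.+1)) w - @empirical n (Phi (m 1%N)) w| <= \sum_(0 <= i < k) D i w.
  elim: k => [|k IH] kn; first by rewrite subrr normr0 big_nil.
  rewrite big_nat_recr//= addrC -(subrK (@empirical n (Phi (m k.+1)) w) (@empirical n _ w)).
  rewrite -addrA (le_trans (ler_normD _ _))// lerD//.
  by apply: IH; exact: ltnW.
have close w h : a < h < b -> `|@empirical n (Phi h) w - @empirical n (Phi (m 1%N)) w| <= S w + V w.
  move=> hab; have [[|k] [k0 kn hk]] := near_m h hab; first by [].
  have split3 (y yk y1 : R) : y - y1 = (yk - y1) + (y - yk) by ring.
  rewrite (split3 _ (@empirical n (Phi (m k.+1)) w)) (le_trans (ler_normD _ _))// lerD//.
    apply: le_trans (tele w k kn) _; rewrite /S.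
    rewrite [leRHS](@big_cat_nat _ _ _ k)//=; first by rewrite lerDl sumr_ge0// => i _; exact: normr_ge0.
    by rewrite -ltnS prednK.
  rewrite -empiricalB; [|exact: bPhi|exact: bPm].
  apply: empirical_le => //; first by apply: bounded_measurableB; [exact: bPhi|exact: bPm].
  move=> t Dt; apply: le_trans (Phi_lip _ _ _ hab _ Dt) _; first exact: m_in.
  by rewrite ler_pM2l.
move=> w h h' hab h'ab.
rewrite -(subrK (@empirical n (Phi (m 1%N)) w) (@empirical n (Phi h) w)) -addrA.
rewrite (le_trans (ler_normD _ _))// /U mulr_natl mulr2n lerD ?close// distrC.
exact: close.
Qed.

End empirical_process.

(** * Functions that are flat to third order *)

Section cubic_quotient.
Context (R : realType) (Phi dPhi : R -> R) (r A c : R).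
Hypothesis A0 : 0 <= A.
Hypothesis Phi0 : Phi 0 = 0.
Hypothesis dPhiP : forall h : R, `|h| <= r -> is_derive h 1 Phi (dPhi h).
Hypothesis dPhi_bnd : forall h : R, `|h| <= r -> `|dPhi h - 3 * c * h ^+ 2| <= A * `|h| ^+ 3.

Definition cubic_quotient (h : R) : R := if h == 0 then c else Phi h / h ^+ 3.

Lemma cubic_bound (h : R) : `|h| <= r -> `|Phi h - c * h ^+ 3| <= A * `|h| ^+ 4.
Proof.
move=> hr; rewrite (_ : A * `|h| ^+ 4 = A * `|h| ^+ 3 * `|h|); last by ring.
apply: (@mean_value_le0 _ (fun h => Phi h - c * h ^+ 3) (fun h => dPhi h - 3 * c * h ^+ 2)).
- by rewrite Phi0 expr0n/= mulr0 subrr.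
- move=> y yh; have D := dPhiP (le_trans yh hr).
  by apply: is_derive_eq; rewrite /GRing.scale/=; ring.
- move=> y yh; apply: le_trans (dPhi_bnd (le_trans yh hr)) _.
  by rewrite ler_wpM2l// lerXn2r ?nnegrE.
Qed.

(** The derivative of Phi / h^3 is (h Phi' - 3 Phi) / h^4, in which the leading
    terms cancel. Arguments of opposite signs are compared through 0. *)
Lemma cubic_quotient_lipschitz (h h' : R) : `|h| <= r -> `|h'| <= r ->
  `|cubic_quotient h - cubic_quotient h'| <= 4 * A * `|h - h'|.
Proof.
have at0 (y : R) : `|y| <= r -> `|cubic_quotient y - c| <= A * `|y|.
  move=> yr; rewrite /cubic_quotient; have [->|y0] := eqVneq y 0.
    by rewrite subrr normr0 mulr0.
  have y3 : 0 < `|y| ^+ 3 by rewrite exprn_gt0// normr_gt0.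
  rewrite -(ler_pM2r y3) -[in leLHS]normrX -normrM mulrBl mulfVK ?expf_neq0//.
  by rewrite -mulrA -exprS cubic_bound.
move=> hr h'r; have [s|s] := leP (h * h') 0.
  have E : `|h - h'| = `|h| + `|h'|.
    have [h0|/ltW h0] := leP 0 h; have [h'0|/ltW h'0] := leP 0 h'.
    - have : h * h' == 0 by rewrite eq_le s mulr_ge0.
      rewrite mulf_eq0 => /orP[] /eqP ->; first by rewrite sub0r normrN normr0 add0r.
      by rewrite subr0 normr0 addr0.
    - by rewrite (ger0_norm h0) (ler0_norm h'0) ger0_norm// subr_ge0 (le_trans h'0).
    - by rewrite (ler0_norm h0) (ger0_norm h'0) ler0_norm ?subr_le0 ?(le_trans h0)// opprB addrC.
    - have : h * h' == 0 by rewrite eq_le s mulr_le0.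
      rewrite mulf_eq0 => /orP[] /eqP ->; first by rewrite sub0r normrN normr0 add0r.
      by rewrite subr0 normr0 addr0.
  rewrite (_ : cubic_quotient h - _ = (cubic_quotient h - c) - (cubic_quotient h' - c)); last by ring.
  rewrite (le_trans (ler_normB _ _))// (le_trans (lerD (at0 _ hr) (at0 _ h'r)))//.
  by rewrite E -mulrDr -[in leRHS]mulrA ler_peMl// ?ler1n// mulr_ge0// addr_ge0.
have nz (y : R) : Num.min h' h <= y <= Num.max h' h -> y != 0 /\ `|y| <= r.
  move=> /andP[yl yu]; move: hr h'r; rewrite !ler_norml => /andP[h1 h2] /andP[h'1 h'2].
  split; last first.
    by apply/andP; split; [rewrite (le_trans _ yl)// le_min h1 h'1|rewrite (le_trans yu)// ge_max h2 h'2].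
  have [h0|h0] := ltP 0 h.
    move: s; rewrite pmulr_rgt0// => h'0.
    by rewrite gt_eqF// (lt_le_trans _ yl)// lt_min h0 h'0.
  have h00 : h < 0.
    by rewrite lt_neqAle h0 andbT; apply: contraTneq s => ->; rewrite mul0r ltxx.
  move: s; rewrite nmulr_rgt0// => h'0.
  by rewrite lt_eqF// (le_lt_trans yu)// gt_max h00 h'0.
have qE (y : R) : Num.min h' h <= y <= Num.max h' h -> cubic_quotient y = Phi y / y ^+ 3.
  by move=> /nz[y0 _]; rewrite /cubic_quotient (negbTE y0).
have hh : Num.min h' h <= h <= Num.max h' h by rewrite ge_min lexx orbT/= le_max lexx orbT.
have hh' : Num.min h' h <= h' <= Num.max h' h by rewrite ge_min lexx/= le_max lexx.
rewrite (qE _ hh) (qE _ hh').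
apply: (@mean_value_le _ (fun y => Phi y / y ^+ 3)
   (fun y => (y * dPhi y - 3 * Phi y) / y ^+ 4)).
  move=> y /nz[y0 yr]; have D := dPhiP yr.
  have y3 : y ^+ 3 != 0 by rewrite expf_neq0.
  have D3 : is_derive y (1:R) (fun y : R => (y ^+ 3)^-1) (- (y ^+ 3) ^- 2 * (3 * y ^+ 2)).
    have D2 : is_derive y (1:R) (fun y : R => y ^+ 3) (3 * y ^+ 2).
      by apply: is_derive_eq; rewrite /GRing.scale/=; ring.
    by have := @is_deriveV R (fun y : R => y ^+ 3) y _ 1 y3 D2.
  apply: is_derive_eq; rewrite /GRing.scale/=; field.
  by [].
move=> y /nz[y0 yr].
have y4 : 0 < `|y| ^+ 4 by rewrite exprn_gt0// normr_gt0.
rewrite -(ler_pM2r y4) -[in leLHS]normrX -normrM mulfVK ?expf_neq0//.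
rewrite (_ : y * _ - _ = y * (dPhi y - 3 * c * y ^+ 2) - 3 * (Phi y - c * y ^+ 3)); last by ring.
rewrite (le_trans (ler_normB _ _))// !normrM [`|3|]ger0_norm//.
rewrite (_ : 4 * A * `|y| ^+ 4 = `|y| * (A * `|y| ^+ 3) + 3 * (A * `|y| ^+ 4)); last by ring.
by rewrite lerD// ler_wpM2l// ?dPhi_bnd ?cubic_bound.
Qed.

End cubic_quotient.

(** Each mean value inequality gains one power of h. *)
Lemma quartic_remainder (R : realType) (v v1 v2 v3 v4 : R -> R) (r K : R) :
  (forall h : R, `|h| <= r -> is_derive h 1 v (v1 h)) ->
  (forall h : R, `|h| <= r -> is_derive h 1 v1 (v2 h)) ->
  (forall h : R, `|h| <= r -> is_derive h 1 v2 (v3 h)) ->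
  (forall h : R, `|h| <= r -> is_derive h 1 v3 (v4 h)) ->
  v 0 = 0 -> v1 0 = 0 -> v2 0 = 0 -> v3 0 = 0 ->
  (forall h : R, `|h| <= r -> `|v4 h| <= K) ->
  forall h : R, `|h| <= r -> `|v1 h| <= K * `|h| ^+ 3 /\ `|v h| <= K * `|h| ^+ 4.
Proof.
move=> D0 D1 D2 D3 z0 z1 z2 z3 v4K.
have K0 (h : R) : `|h| <= r -> 0 <= K by move=> hr; apply: le_trans (v4K _ hr).
have step (g dg : R -> R) k : g 0 = 0 -> (forall h : R, `|h| <= r -> is_derive h 1 g (dg h)) ->
    (forall h : R, `|h| <= r -> `|dg h| <= K * `|h| ^+ k) ->
    forall h : R, `|h| <= r -> `|g h| <= K * `|h| ^+ k.+1.
  move=> g0 Dg dgK h hr; rewrite exprSr mulrA; apply: (@mean_value_le0 _ g dg) => //.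
    by move=> y yh; apply: Dg; exact: le_trans hr.
  move=> y yh; rewrite (le_trans (dgK _ (le_trans yh hr)))// ler_wpM2l ?(K0 h)//.
  by rewrite lerXn2r ?nnegrE.
have b3 := step v3 v4 0%N z3 D3.
have b2 := step v2 v3 1%N z2 D2; have b1 := step v1 v2 2%N z1 D1; have b0 := step v v1 3%N z0 D0.
have c3 h : `|h| <= r -> `|v3 h| <= K * `|h| ^+ 1.
  by apply: b3 => y yr; rewrite expr0 mulr1 v4K.
by move=> h hr; split; [apply: b1 => //; exact: b2|apply: b0 => //; apply: b1; exact: b2].
Qed.

Section flat_logarithm.
Context (R : realType) (u u1 u2 u3 u4 : R -> R) (r lo : R).
Hypothesis r0 : 0 < r.
Hypothesis r1 : r <= 1.
Hypothesis lo0 : 0 < lo.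
Hypothesis D0 : forall h : R, `|h| <= r -> is_derive h 1 u (u1 h).
Hypothesis D1 : forall h : R, `|h| <= r -> is_derive h 1 u1 (u2 h).
Hypothesis D2 : forall h : R, `|h| <= r -> is_derive h 1 u2 (u3 h).
Hypothesis D3 : forall h : R, `|h| <= r -> is_derive h 1 u3 (u4 h).
Hypothesis z1 : u1 0 = 0.
Hypothesis z2 : u2 0 = 0.
Hypothesis u_lo : lo <= u 0.
Hypothesis u_near1 : forall h : R, `|h| <= r -> `|u h - u 0| <= 1.
Hypothesis u_near_lo : forall h : R, `|h| <= r -> `|u h - u 0| <= lo / 2.
Hypothesis u4_near : forall h : R, `|h| <= r -> `|u4 h - u4 0| <= 1.

Let a := u3 0.

Let taylor (b K : R) : (forall h : R, `|h| <= r -> `|u4 h - b| <= K) ->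
  forall h : R, `|h| <= r ->
  `|u1 h - (a * h ^+ 2 / 2 + b * h ^+ 3 / 6)| <= K * `|h| ^+ 3 /\
  `|u h - u 0 - (a * h ^+ 3 / 6 + b * h ^+ 4 / 24)| <= K * `|h| ^+ 4.
Proof.
move=> H; apply: (@quartic_remainder R (fun h => u h - u 0 - (a * h ^+ 3 / 6 + b * h ^+ 4 / 24))
  (fun h => u1 h - (a * h ^+ 2 / 2 + b * h ^+ 3 / 6)) (fun h => u2 h - (a * h + b * h ^+ 2 / 2))
  (fun h => u3 h - (a + b * h)) (fun h => u4 h - b)).
- by move=> h hr; have D := D0 hr; apply: is_derive_eq; rewrite /GRing.scale/=; field.
- by move=> h hr; have D := D1 hr; apply: is_derive_eq; rewrite /GRing.scale/=; field.
- by move=> h hr; have D := D2 hr; apply: is_derive_eq; rewrite /GRing.scale/=; field.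
- by move=> h hr; have D := D3 hr; apply: is_derive_eq; rewrite /GRing.scale/=; field.
- by rewrite !expr0n/=; ring.
- by rewrite z1 !expr0n/=; ring.
- by rewrite z2 !expr0n/=; ring.
- by rewrite /a; ring.
- exact: H.
Qed.

(** Adding and subtracting the Taylor expansions at r and - r separates the
    third derivative from the fourth. In this way bounds on u alone, which are
    uniform in t in the application, bound the derivatives. *)
Lemma third_derivative_bound : `|u3 0| <= 12 / r ^+ 3 /\ `|u4 0| <= 48 / r ^+ 4.
Proof.
have r3 : 0 < r ^+ 3 by rewrite exprn_gt0.
have r4 : 0 < r ^+ 4 by rewrite exprn_gt0.
have r41 : r ^+ 4 <= 1 by rewrite expr_le1// ltW.
have rr : `|r| <= r by rewrite gtr0_norm.
have rNr : `|- r| <= r by rewrite normrN gtr0_norm.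
have [_ B1] := taylor u4_near rr; have [_ B2] := taylor u4_near rNr.
have B3 := u_near1 rr; have B4 := u_near1 rNr.
move: B1 B2; rewrite normrN (gtr0_norm r0) mul1r.
rewrite (_ : (- r) ^+ 3 = - r ^+ 3); last by ring.
rewrite (_ : (- r) ^+ 4 = r ^+ 4); last by ring.
rewrite mulrN -/a; set x := a * _; set y := u4 0 * _.
rewrite !(ler_norml (_ - _)) => /andP[h5 h6] /andP[h7 h8].
move: B3 B4; rewrite !(ler_norml (_ - _)) => /andP[h1 h2] /andP[h3 h4].
split.
  have E : `|a| * r ^+ 3 = `|x| by rewrite normrM [`|r ^+ 3|]gtr0_norm.
  rewrite ler_pdivlMr// -/a E ler_norml.
  by apply/andP; split; lra.
have E : `|u4 0| * r ^+ 4 = `|y| by rewrite normrM [`|r ^+ 4|]gtr0_norm.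
rewrite ler_pdivlMr// E ler_norml.
by apply/andP; split; lra.
Qed.

Let A3 := 12 / r ^+ 3.
Let A4 := 48 / r ^+ 4 + 1.

Lemma flat_log_derive (h : R) : `|h| <= r ->
  is_derive h 1 (fun h => ln (u h) - ln (u 0)) (u1 h / u h) /\ 0 < u h.
Proof.
move=> hr; have D := D0 hr.
have uh : 0 < u h.
  have := u_near_lo hr; rewrite ler_norml => /andP[+ _].
  have := u_lo; have := lo0; move: (u h) (u 0) => x y; lra.
split=> //; have DL := is_derive1_comp (is_derive1_ln uh) D.
by apply: is_derive_eq; rewrite subr0 mulrC.
Qed.

Definition flat_log_constant : R := 2 * A4 / lo + A3 * (A3 + A4) / lo ^+ 2.

(** The quotient u' / u differs from u'''(0) h^2 / (2 u(0)) by a Taylor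
    remainder and by the effect of the variation of u in the denominator. *)
Lemma flat_log_bound (h : R) : `|h| <= r ->
  `|u1 h / u h - 3 * (u3 0 / (6 * u 0)) * h ^+ 2| <= flat_log_constant * `|h| ^+ 3.
Proof.
move=> hr; have [_ uh] := flat_log_derive hr.
have u0 : 0 < u 0 := lt_le_trans lo0 u_lo.
have [a3 a4] := third_derivative_bound.
have A30 : 0 <= A3 by apply: le_trans a3.
have A40 : 0 <= A4 by rewrite /A4 addr_ge0// (le_trans _ a4).
have H0 (y : R) : `|y| <= r -> `|u4 y - 0| <= A4.
  move=> yr; rewrite subr0 -(subrK (u4 0) (u4 y)) (le_trans (ler_normD _ _))//.
  by rewrite /A4 addrC lerD// u4_near.
have [B1 B2] := taylor H0 hr.
rewrite !mul0r !addr0 in B1 B2.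
have uh2 : (u h)^-1 <= 2 / lo.
  rewrite -[2 / lo]invf_div lef_pV2 ?posrE ?divr_gt0//.
  have := u_near_lo hr; rewrite ler_norml => /andP[+ _]; have := u_lo.
  by move: (u h) (u 0) => x y; lra.
have u02 : (u 0)^-1 <= lo^-1 by rewrite lef_pV2 ?posrE.
have h1 : `|h| <= 1 := le_trans hr r1.
have B3 : `|u h - u 0| <= (A3 + A4) * `|h| ^+ 3.
  rewrite -(subrK (a * h ^+ 3 / 6) (u h - u 0)) (le_trans (ler_normD _ _))//.
  rewrite addrC mulrDl lerD//.
    rewrite normrM normrM normrX (ger0_norm (_ : 0 <= 6^-1)) ?invr_ge0//.
    rewrite ler_pdivrMr// (@le_trans _ _ (A3 * `|h| ^+ 3))//.
      by rewrite ler_wpM2r// exprn_ge0.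
    by rewrite ler_peMr ?ler1n// mulr_ge0// exprn_ge0.
  by rewrite (le_trans B2)// ler_wpM2l// exprS ler_piMl// exprn_ge0.
rewrite (_ : _ - _ = (u1 h - a * h ^+ 2 / 2) / u h -
   (a / 2) * h ^+ 2 * (u h - u 0) * (u h)^-1 * (u 0)^-1); last first.
  by rewrite /a; field; rewrite !gt_eqF.
rewrite (le_trans (ler_normB _ _))// /flat_log_constant [leRHS]mulrDl lerD//.
  rewrite normrM [`|(u h)^-1|]gtr0_norm ?invr_gt0//.
  rewrite (_ : 2 * A4 / lo * _ = A4 * `|h| ^+ 3 * (2 / lo)); last by ring.
  by rewrite ler_pM ?invr_ge0 ?(ltW uh).
rewrite !normrM [`|(u h)^-1|]gtr0_norm ?invr_gt0// [`|(u 0)^-1|]gtr0_norm ?invr_gt0//.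
rewrite (ger0_norm (_ : 0 <= 2^-1)) ?invr_ge0// -[`|h| * `|h|]/(`|h| ^+ 2).
rewrite (_ : A3 * (A3 + A4) / lo ^+ 2 * `|h| ^+ 3 =
   (A3 / 2 * 1) * ((A3 + A4) * `|h| ^+ 3) * (2 / lo) * lo^-1); last by field; rewrite gt_eqF.
have p1 : 0 <= (u h)^-1 by rewrite invr_ge0 ltW.
have p2 : 0 <= (u 0)^-1 by rewrite invr_ge0 ltW.
have p3 : 0 <= 2^-1 :> R by rewrite invr_ge0.
have p4 : 0 <= `|h| ^+ 2 by rewrite exprn_ge0.
have p5 : `|h| ^+ 2 <= 1 by rewrite expr_le1.
have q1 : 0 <= `|a| * 2^-1 by rewrite mulr_ge0.
have q2 : 0 <= `|a| * 2^-1 * `|h| ^+ 2 by rewrite mulr_ge0.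
have q3 : 0 <= `|a| * 2^-1 * `|h| ^+ 2 * `|u h - u 0| by rewrite mulr_ge0.
have q4 : 0 <= `|a| * 2^-1 * `|h| ^+ 2 * `|u h - u 0| * (u h)^-1 by rewrite mulr_ge0.
apply: ler_pM => //; apply: ler_pM => //; apply: ler_pM => //; apply: ler_pM => //.
by rewrite ler_wpM2r.
Qed.

End flat_logarithm.

(** * The log-intensity near the true value *)

Lemma is_derive_shift (R : realType) (g : R -> R) (x0 h dg : R) :
  is_derive (x0 + h) 1 g dg -> is_derive h 1 (fun h => g (x0 + h)) dg.
Proof.
move=> D; have D1 : is_derive h (1:R) (fun h : R => x0 + h) (1:R).
  by apply: is_derive_eq; rewrite add0r mulr1.
have DC := is_derive1_comp D D1; by rewrite mulr1 in DC.
Qed.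

Lemma is_derive_dtheta (R : realType) (j : nat) (g : R -> R -> R) (th t : R) :
  derivable (fun u : R => dtheta j g u t) th (1 : R) ->
  is_derive th (1 : R) (fun u : R => dtheta j g u t) (dtheta j.+1 g th t).
Proof. by move=> /derivableP D; apply: is_derive_eq; rewrite /dtheta derive1nS derive1E. Qed.

Section local_expansion.
Context (R : realType) (tau alpha beta theta0 : R) (lam : R -> R -> R) (lo hi : R).
Local Notation Theta := (`]alpha, beta[%classic : set R).
Hypothesis theta0_in : theta0 \in `]alpha, beta[.
Hypothesis cd4 : continuously_differentiable Theta tau 4 lam.
Hypothesis flat : forall t, t \in `[0, tau] -> dtheta 1 lam theta0 t = 0 /\ dtheta 2 lam theta0 t = 0.
Hypothesis lo0 : 0 < lo.
Hypothesis lam_bnd : forall t, t \in `[0, tau] -> lo <= lam theta0 t <= hi.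

Definition log_ratio (th t : R) : R := ln (lam th t) - ln (lam theta0 t).

(** The function g of the expansion, in which h^3 g is the leading term of the
    log-ratio; the third-order information is the integral of g^2
    lambda(theta0). *)
Definition score3 (t : R) : R := dtheta 3 lam theta0 t / (6 * lam theta0 t).

(** The rho_h of the expansion; see [log_ratioE]. *)
Definition cubic_remainder (h t : R) : R :=
  cubic_quotient (fun h => log_ratio (theta0 + h) t) (score3 t) h - score3 t.

Lemma cubic_remainder0 t : cubic_remainder 0 t = 0.
Proof. by rewrite /cubic_remainder /cubic_quotient eqxx subrr. Qed.

Lemma log_ratioE h t : log_ratio (theta0 + h) t = h ^+ 3 * (score3 t + cubic_remainder h t).
Proof.
rewrite /cubic_remainder /cubic_quotient addrCA subrr addr0.
have [->|h0] := eqVneq h 0; first by rewrite addr0 /log_ratio subrr expr0n/= mul0r.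
by rewrite mulrCA divff ?mulr1// expf_neq0.
Qed.

Lemma Theta_ball : exists2 r : R, 0 < r & forall h, `|h| <= r -> Theta (theta0 + h).
Proof.
move: theta0_in; rewrite in_itv/= => /andP[a0 b0].
exists (Num.min (theta0 - alpha) (beta - theta0) / 2).
  by rewrite divr_gt0// lt_min !subr_gt0 a0 b0.
move=> h hr; have : `|h| < Num.min (theta0 - alpha) (beta - theta0).
  by rewrite (le_lt_trans hr)// ltr_pdivrMr// ltr_pMr ?ltr1n// lt_min !subr_gt0 a0 b0.
rewrite lt_min => /andP[]; rewrite !ltr_norml => /andP[h1 _] /andP[_ h2].
by rewrite /= in_itv/=; apply/andP; split; lra.
Qed.

(** The continuity of the derivatives in theta is uniform in t by definition. *)
Lemma uniform_continuity (j : nat) (e : R) : (j <= 4)%N -> 0 < e ->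
  exists2 r : R, 0 < r & forall h t, `|h| <= r -> t \in `[0, tau] ->
    `|dtheta j lam (theta0 + h) t - dtheta j lam theta0 t| <= e.
Proof.
move=> j4 e0; have [_ /(_ j theta0 e j4 theta0_in e0)] := cd4.
move=> /nbhs_ballP[r /= r0 H]; exists (r / 2); first by rewrite divr_gt0.
move=> h t hr t0; apply/ltW/H => //.
by rewrite /ball/= opprD addrA subrr sub0r normrN (le_lt_trans hr)// ltr_pdivrMr// ltr_pMr ?ltr1n.
Qed.

(** The bounds on the derivatives obtained for each t depend on r and lo alone. *)
Lemma local_expansion : exists r A : R, [/\ 0 < r, 0 < A,
  (forall h, `|h| <= r -> Theta (theta0 + h)),
  (forall t, t \in `[0, tau] -> `|score3 t| <= A) &
  forall h h' t, `|h| <= r -> `|h'| <= r -> t \in `[0, tau] ->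
    0 < lam (theta0 + h) t /\
    `|cubic_remainder h t - cubic_remainder h' t| <= A * `|h - h'|].
Proof.
have [r1 r10 H1] := Theta_ball.
have [r2 r20 H2] := uniform_continuity (isT : (0 <= 4)%N) (ltr01 : 0 < 1 :> R).
have lo2 : 0 < lo / 2 by rewrite divr_gt0.
have [r3 r30 H3] := uniform_continuity (isT : (0 <= 4)%N) lo2.
have [r4 r40 H4] := uniform_continuity (isT : (4 <= 4)%N) (ltr01 : 0 < 1 :> R).
pose r := Num.min (Num.min r1 r2) (Num.min (Num.min r3 r4) 1).
have r0 : 0 < r by rewrite !lt_min r10 r20 r30 r40 ltr01.
have r_le1 : r <= 1 by rewrite !ge_min lexx !orbT.
have rr1 (h : R) : `|h| <= r -> `|h| <= r1 by move/le_trans; apply; rewrite !ge_min lexx.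
have rr2 (h : R) : `|h| <= r -> `|h| <= r2 by move/le_trans; apply; rewrite !ge_min lexx !orbT.
have rr3 (h : R) : `|h| <= r -> `|h| <= r3 by move/le_trans; apply; rewrite !ge_min lexx !orbT.
have rr4 (h : R) : `|h| <= r -> `|h| <= r4 by move/le_trans; apply; rewrite !ge_min lexx !orbT.
pose K := flat_log_constant r lo.
pose A := 4 * `|K| + 12 / r ^+ 3 / (6 * lo) + 1.
have q0 : 0 <= 12 / r ^+ 3 / (6 * lo).
  by rewrite !divr_ge0// ?exprn_ge0 ?(ltW r0)// mulr_ge0// ltW.
have A0 : 0 < A by rewrite ltr_wpDl// addr_ge0// mulr_ge0.
have D (j : nat) (h t : R) : (j < 4)%N -> `|h| <= r -> t \in `[0, tau] ->
    is_derive h (1:R) (fun h : R => dtheta j lam (theta0 + h) t) (dtheta j.+1 lam (theta0 + h) t).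
  move=> j4 hr t0; apply: is_derive_shift; apply: is_derive_dtheta.
  by have [+ _] := cd4; apply => //; apply/H1/rr1.
exists r, A; split=> //.
- by move=> h /rr1; exact: H1.
- move=> t t0; have [lt _] := andP (lam_bnd t0).
  have /= := @third_derivative_bound R (fun h => lam (theta0 + h) t)
    (fun h => dtheta 1 lam (theta0 + h) t) (fun h => dtheta 2 lam (theta0 + h) t)
    (fun h => dtheta 3 lam (theta0 + h) t) (fun h => dtheta 4 lam (theta0 + h) t) r r0 r_le1.
  rewrite !addr0; have [f1 f2] := flat t0.
  move=> /(_ (fun h hr => D 0%N h t isT hr t0) (fun h hr => D 1%N h t isT hr t0)
    (fun h hr => D 2%N h t isT hr t0) (fun h hr => D 3%N h t isT hr t0) f1 f2
    (fun h hr => H2 h t (rr2 h hr) t0) (fun h hr => H4 h t (rr4 h hr) t0)) [a3 _].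
  have lt0 : 0 < lam theta0 t := lt_le_trans lo0 lt.
  rewrite /score3 normrM [`|_^-1|]gtr0_norm ?invr_gt0 ?mulr_gt0//.
  apply: (@le_trans _ _ (12 / r ^+ 3 / (6 * lo))).
    apply: ler_pM => //; first by rewrite invr_ge0 mulr_ge0// ltW.
    by rewrite lef_pV2 ?posrE ?mulr_gt0// ler_pM2l.
  by rewrite /A; have := normr_ge0 K; lra.
move=> h h' t hr h'r t0; have [lt _] := andP (lam_bnd t0); have [f1 f2] := flat t0.
pose u (h : R) := lam (theta0 + h) t.
pose u1 (h : R) := dtheta 1 lam (theta0 + h) t.
have u0E : u 0 = lam theta0 t by rewrite /u addr0.
have FD (y : R) : `|y| <= r -> is_derive y 1 (fun h => ln (u h) - ln (u 0)) (u1 y / u y) /\ 0 < u y.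
  move=> yr; apply: (@flat_log_derive R u u1 r lo lo0) => //.
  - by move=> z zr; exact: D 0%N z t isT zr t0.
  - by rewrite u0E.
  - by move=> z zr; rewrite u0E; exact: H3 z t (rr3 z zr) t0.
have FB (y : R) : `|y| <= r -> `|u1 y / u y - 3 * score3 t * y ^+ 2| <= `|K| * `|y| ^+ 3.
  move=> yr; apply: (@le_trans _ _ (K * `|y| ^+ 3)); last by rewrite ler_wpM2r ?ler_norm// exprn_ge0.
  have := @flat_log_bound R u u1 (fun h => dtheta 2 lam (theta0 + h) t)
    (fun h => dtheta 3 lam (theta0 + h) t) (fun h => dtheta 4 lam (theta0 + h) t) r lo r0 r_le1 lo0
    (fun h hr => D 0%N h t isT hr t0) (fun h hr => D 1%N h t isT hr t0)
    (fun h hr => D 2%N h t isT hr t0) (fun h hr => D 3%N h t isT hr t0).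
  rewrite /u1 u0E !addr0; apply => //.
  - by move=> z zr; exact: H2 z t (rr2 z zr) t0.
  - by move=> z zr; exact: H3 z t (rr3 z zr) t0.
  - by move=> z zr; exact: H4 z t (rr4 z zr) t0.
split; first by case: (FD h hr).
rewrite /cubic_remainder opprB addrA subrK.
apply: (@le_trans _ _ (4 * `|K| * `|h - h'|)); last first.
  by rewrite ler_wpM2r// /A -addrA lerDl addr_ge0.
have L0 : log_ratio (theta0 + 0) t = 0 by rewrite addr0 /log_ratio subrr.
have LD (y : R) : `|y| <= r -> is_derive y 1 (fun h => log_ratio (theta0 + h) t) (u1 y / u y).
  by move=> yr; have [+ _] := FD y yr; rewrite u0E.
exact: (@cubic_quotient_lipschitz R (fun h => log_ratio (theta0 + h) t) (fun y => u1 y / u y)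
  r `|K| (score3 t) (normr_ge0 K) L0 LD FB h h' hr h'r).
Qed.

End local_expansion.

(** * The likelihood *)

Lemma le_stoch_int_fun (R : realType) (tau : R) (x : cumulative R R) (phi psi : R -> R) :
  0 < tau ->
  @bounded_measurable _ (measurableTypeR R) R (`]0, tau]%classic) phi ->
  @bounded_measurable _ (measurableTypeR R) R (`]0, tau]%classic) psi ->
  (forall t, `]0, tau]%classic t -> phi t <= psi t) ->
  stoch_int tau x phi <= stoch_int tau x psi.
Proof.
move=> tau0 bp bq pq; have mD : measurable (`]0, tau]%classic : set (measurableTypeR R)).
  exact: measurable_itv.
apply: le_Rintegral => //.
- by apply: bounded_measurable_integrable => //; exact: lsm_lty.
- by apply: bounded_measurable_integrable => //; exact: lsm_lty.
Qed.

Lemma ln_lipschitz (R : realType) (e x y : R) : 0 < e -> e <= x -> e <= y ->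
  `|ln x - ln y| <= e^-1 * `|x - y|.
Proof.
move=> e0 ex ey; apply: (@mean_value_le _ (@ln R) (fun z => z^-1)).
  move=> z /andP[z1 _]; apply: is_derive1_ln; apply: lt_le_trans z1.
  by rewrite lt_min !(lt_le_trans e0).
move=> z /andP[z1 _]; have ez : e <= z by apply: le_trans z1; rewrite le_min ey ex.
have z0 := lt_le_trans e0 ez.
by rewrite gtr0_norm ?invr_gt0// lef_pV2.
Qed.

Section likelihood.
Context (R : realType) (tau alpha beta theta0 : R) (lam : R -> R -> R) (lo hi : R).
Local Notation Theta := (`]alpha, beta[%classic : set R).
Hypothesis tau0 : 0 < tau.
Hypothesis theta0_in : theta0 \in `]alpha, beta[.
Hypothesis mlam : forall th, Theta th -> measurable_fun (`[0, tau]%classic : set R) (lam th).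
Hypothesis blam : forall th, Theta th -> bounded_positive tau (lam th).
Hypothesis lo0 : 0 < lo.
Hypothesis lam_bnd : forall t, t \in `[0, tau] -> lo <= lam theta0 t <= hi.

Local Notation bm := (@bounded_measurable _ (measurableTypeR R) R (`]0, tau]%classic)).
Local Notation f := (lam theta0).
Local Notation total := (compensator tau f (fun=> 1)).
Local Notation D := (`]0, tau]%classic : set R).
Local Notation leb := (@lebesgue_measure R).

Let mf : measurable_fun (`[0, tau]%classic : set R) f.
Proof. exact: mlam. Qed.

Let DI : D `<=` `[0, tau]%classic.
Proof. by move=> t /=; rewrite !in_itv/= => /andP[/ltW -> ->]. Qed.

Lemma bounded_measurable_log th (e : R) : Theta th -> 0 <= e -> bm (fun t => ln (lam th t + e)).
Proof.
move=> Th e0; have [c [C [c0 cC]]] := blam Th; split.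
  apply: (measurableT_comp (@measurable_ln R)).
  apply: measurable_funD; last exact: measurable_cst.
  exact: measurable_funS (mlam Th).
exists (`|ln c| + `|ln (C + e)|) => t /DI /cC /andP[h1 h2].
have h3 : c <= lam th t + e by rewrite (le_trans h1)// lerDl.
have h4 : lam th t + e <= C + e by rewrite lerD2r.
have l0 : 0 < lam th t + e := lt_le_trans c0 h3.
rewrite ler_norml; apply/andP; split.
  rewrite opprD (@le_trans _ _ (ln c))//; last by rewrite ler_ln ?posrE.
  by rewrite (@le_trans _ _ (- `|ln c|)) ?gerDl ?oppr_le0// lerNl -normrN ler_norm.
rewrite (@le_trans _ _ (ln (C + e)))//.
  by rewrite ler_ln ?posrE// (lt_le_trans l0).
by rewrite (le_trans (ler_norm _))// lerDr.
Qed.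

Lemma bounded_measurable_log_ratio th : Theta th -> bm (log_ratio theta0 lam th).
Proof.
move=> Th; have -> : log_ratio theta0 lam th = (fun t => ln (lam th t + 0) - ln (lam theta0 t + 0)).
  by apply/funext => t; rewrite !addr0.
by apply: bounded_measurableB; exact: bounded_measurable_log.
Qed.

Lemma bounded_measurable_expR phi : bm phi -> bm (fun t => expR (phi t)).
Proof.
move=> [mp [M pM]]; split; first exact: (measurableT_comp (@measurable_expR R) mp).
exists (expR M) => t /pM tM; rewrite ger0_norm ?expR_ge0// ler_expR.
exact: le_trans (ler_norm _) tM.
Qed.

Lemma expR_log_ratio th t : Theta th -> D t -> expR (log_ratio theta0 lam th t) * f t = lam th t.
Proof.
move=> Th /DI t0; have [c [C [c0 /(_ t t0) /andP[h1 _]]]] := blam Th.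
have /andP[f1 _] := lam_bnd t0; have f0 : 0 < f t := lt_le_trans lo0 f1.
rewrite /log_ratio expRD expRN lnK ?posrE ?(lt_le_trans c0)// lnK ?posrE//.
by rewrite mulfVK ?gt_eqF.
Qed.

(** The logarithm of L(theta) / L(theta0), with the integral of lambda(theta) -
    lambda(theta0) written as a compensator. *)
Definition log_likelihood_ratio n (x : 'I_n -> cumulative R R) (th : R) : R :=
  \sum_(j < n) stoch_int tau (x j) (log_ratio theta0 lam th) -
  n%:R * compensator tau f (fun t => expR (log_ratio theta0 lam th t) - 1).

Let bounded_measurable_lam th : Theta th -> bm (lam th).
Proof.
move=> Th; have [c [C [c0 cC]]] := blam Th; split; first exact: measurable_funS (mlam Th).
by exists C => t /DI /cC /andP[h1 h2]; rewrite ger0_norm// (le_trans _ h1)// ltW.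
Qed.

Lemma likelihoodE n (x : 'I_n -> cumulative R R) (th : R) : Theta th ->
  likelihood tau lam x th = likelihood tau lam x theta0 * expR (log_likelihood_ratio x th).
Proof.
move=> Th; have Th0 : Theta theta0 by [].
have mD : measurable (`]0, tau]%classic : set (measurableTypeR R)) by exact: measurable_itv.
rewrite /likelihood -expRD; congr expR.
have E th' : Theta th' -> \int[leb]_(t in `[0, tau]) (lam th' t - 1) =
    \int[leb]_(t in (`]0, tau]%classic : set (measurableTypeR R))) (lam th' t - 1).
  move=> Th'; rewrite [RHS]Rintegral_itv_obnd_cbnd//.
  have b : bm (fun t => lam th' t - 1).
    by apply: bounded_measurableB; [exact: bounded_measurable_lam|exact: bounded_measurable_cst].
  by have := bounded_measurable_integrable mD (lebesgue_oc_lty 0 tau) b.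
rewrite (E _ Th) (E _ Th0) /log_likelihood_ratio.
have -> : \sum_(j < n) stoch_int tau (x j) (log_ratio theta0 lam th) =
   \sum_(j < n) stoch_int tau (x j) (fun t => ln (lam th t)) -
   \sum_(j < n) stoch_int tau (x j) (fun t => ln (lam theta0 t)).
  rewrite -sumrB; apply: eq_bigr => j _.
  have bl th' : Theta th' -> bm (fun t => ln (lam th' t)).
    move=> Th'; rewrite (_ : (fun t => _) = (fun t => ln (lam th' t + 0))); first exact: bounded_measurable_log.
    by apply/funext => t; rewrite addr0.
  exact: (stoch_intB tau0 (x j) (bl _ Th) (bl _ Th0)).
have -> : compensator tau f (fun t => expR (log_ratio theta0 lam th t) - 1) =
    \int[leb]_(t in (`]0, tau]%classic : set (measurableTypeR R))) (lam th t - 1) -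
    \int[leb]_(t in (`]0, tau]%classic : set (measurableTypeR R))) (lam theta0 t - 1).
  have b th' : Theta th' -> leb.-integrable (`]0, tau]%classic : set (measurableTypeR R))
      (EFin \o (fun t => lam th' t - 1)).
    move=> Th'; have b : bm (fun t => lam th' t - 1).
      by apply: bounded_measurableB; [exact: bounded_measurable_lam|exact: bounded_measurable_cst].
    by have := bounded_measurable_integrable mD (lebesgue_oc_lty 0 tau) b.
  rewrite -(RintegralB mD (b _ Th) (b _ Th0)); apply: eq_Rintegral => t; rewrite inE => Dt.
  by rewrite mulrBl (expR_log_ratio Th Dt) mul1r opprB addrA subrK.
rewrite /stoch_int; set s1 := \sum_(j < n) _; set s2 := \sum_(j < n) _.
by ring.
Qed.

Lemma maximizes_likelihoodP n (x : 'I_n -> cumulative R R) (th : R) :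
  maximizes_likelihood Theta tau lam x th <->
  Theta th /\ forall u, Theta u -> log_likelihood_ratio x u <= log_likelihood_ratio x th.
Proof.
have key (L l : R -> R) (L0 : R) : 0 < L0 -> (forall u, Theta u -> L u = L0 * expR (l u)) ->
    (Theta th /\ (L th)%:E = ereal_sup [set (L u)%:E | u in Theta]) <->
    (Theta th /\ forall u, Theta u -> l u <= l th).
  move=> L00 LE; split=> -[Th H]; split=> //.
    move=> u Tu; rewrite -ler_expR -(ler_pM2l L00) -(LE _ Tu) -(LE _ Th) -lee_fin H.
    by apply: ereal_sup_ubound; exists u.
  apply/eqP; rewrite eq_le; apply/andP; split; first by apply: ereal_sup_ubound; exists th.
  apply: ge_ereal_sup => _ [u Tu <-]; rewrite lee_fin (LE _ Tu) (LE _ Th).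
  by rewrite ler_pM2l// ler_expR H.
exact: (key (likelihood tau lam x) (log_likelihood_ratio x) (likelihood tau lam x theta0)
  (expR_gt0 _) (fun u Tu => likelihoodE x Tu)).
Qed.

End likelihood.

(** * Consistency *)

Section score_decomposition.
Context (R : realType) (tau : R) (f : R -> R).
Context d (T : measurableType d) n (X : 'I_n -> T -> cumulative R R).

Lemma sum_stoch_int phi w : (0 < n)%N ->
  \sum_j stoch_int tau (X j w) phi =
  Num.sqrt n%:R * ((\sum_j centered_int tau f (X j) phi w) / Num.sqrt n%:R) +
  n%:R * compensator tau f phi.
Proof.
move=> n0; have key (s : 'I_n -> R) (c : R) :
    \sum_j s j = Num.sqrt n%:R * ((\sum_j (s j - c)) / Num.sqrt n%:R) + n%:R * c.
  rewrite mulrC mulfVK ?gt_eqF ?sqrtr_gt0 ?ltr0n//.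
  by rewrite sumrB sumr_const card_ord mulr_natl subrK.
exact: key.
Qed.

End score_decomposition.

Section consistency.
Context (R : realType) (tau alpha beta theta0 : R) (lam : R -> R -> R) (lo hi M : R).
Local Notation Theta := (`]alpha, beta[%classic : set R).
Hypothesis tau0 : 0 < tau.
Hypothesis theta0_in : theta0 \in `]alpha, beta[.
Hypothesis mlam : forall th, Theta th -> measurable_fun (`[0, tau]%classic : set R) (lam th).
Hypothesis blam : forall th, Theta th -> bounded_positive tau (lam th).
Hypothesis lo0 : 0 < lo.
Hypothesis lam_bnd : forall t, t \in `[0, tau] -> lo <= lam theta0 t <= hi.
Local Notation f := (lam theta0).
Hypothesis M0 : 0 < M.
Hypothesis sqrt_lip : forall th th' t, Theta th -> Theta th' -> t \in `[0, tau] ->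
  `|Num.sqrt (lam th t) - Num.sqrt (lam th' t)| <= M * `|th - th'|.

Local Notation bm := (@bounded_measurable _ (measurableTypeR R) R (`]0, tau]%classic)).
Local Notation total := (compensator tau f (fun=> 1)).
Local Notation D := (`]0, tau]%classic : set R).
Local Notation leb := (@lebesgue_measure R).

Let mf : measurable_fun (`[0, tau]%classic : set R) f.
Proof. exact: mlam. Qed.

Let DI t : D t -> t \in `[0, tau].
Proof. by rewrite /= !in_itv/= => /andP[/ltW -> ->]. Qed.

Let Th0 : Theta theta0. Proof. by []. Qed.

Let lam_gt0 th t : Theta th -> t \in `[0, tau] -> 0 < lam th t.
Proof. by move=> Th t0; have [c [C [c0 /(_ t t0) /andP[/(lt_le_trans c0)]]]] := blam Th. Qed.

Let S := Num.sqrt hi + M * (beta - alpha).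

Let sqrt_le th t : Theta th -> t \in `[0, tau] -> Num.sqrt (lam th t) <= S.
Proof.
move=> Th t0; rewrite /S -[leLHS](subrK (Num.sqrt (f t))) addrC lerD//.
  by rewrite ler_wsqrtr//; have /andP[] := lam_bnd t0.
rewrite (le_trans (ler_norm _))// (le_trans (sqrt_lip Th Th0 t0))// ler_pM2l//.
move: Th Th0; rewrite /= !in_itv/= => /andP[a1 b1] /andP[a2 b2].
by rewrite ler_norml; apply/andP; split; lra.
Qed.

Let S0 : 0 < S.
Proof.
have := theta0_in; rewrite in_itv/= => /andP[a b].
by rewrite /S ltr_wpDl ?sqrtr_ge0// mulr_gt0// subr_gt0 (lt_trans a).
Qed.

(** The square root of lambda is Lipschitz in theta, hence bounded on Theta, and
    so is its square. *)
Lemma intensity_lipschitz th th' t : Theta th -> Theta th' -> t \in `[0, tau] ->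
  `|lam th t - lam th' t| <= 2 * S * M * `|th - th'|.
Proof.
move=> Th Th' t0; have l1 := lam_gt0 Th t0; have l2 := lam_gt0 Th' t0.
rewrite -[lam th t]sqr_sqrtr ?(ltW l1)// -[lam th' t]sqr_sqrtr ?(ltW l2)//.
rewrite subr_sqr normrM mulrC -[leRHS]mulrA ler_pM//; last exact: sqrt_lip.
rewrite ger0_norm ?addr_ge0 ?sqrtr_ge0// mulr_natl mulr2n lerD//; exact: sqrt_le.
Qed.

(** Away from theta0 the intensity can come close to 0, and its logarithm need
    not be Lipschitz in theta on Theta. Adding a positive constant to
    lambda(theta) gives an upper bound that is. *)
Definition lifted_log_ratio (kappa th t : R) : R :=
  ln (lam th t + lo * kappa ^+ 2) - ln (lam theta0 t).

Lemma bounded_measurable_lifted kappa th : Theta th -> bm (lifted_log_ratio kappa th).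
Proof.
move=> Th; rewrite (_ : lifted_log_ratio kappa th =
  (fun t => ln (lam th t + lo * kappa ^+ 2) - ln (lam theta0 t + 0))).
  apply: bounded_measurableB; last exact: (bounded_measurable_log mlam blam Th0 (lexx 0)).
  by apply: (bounded_measurable_log mlam blam Th); rewrite mulr_ge0 ?(ltW lo0)// sqr_ge0.
by apply/funext => t; rewrite addr0.
Qed.

Lemma log_ratio_le_lifted kappa th t : Theta th -> D t ->
  log_ratio theta0 lam th t <= lifted_log_ratio kappa th t.
Proof.
move=> Th /DI t0; have l1 := lam_gt0 Th t0; rewrite /log_ratio /lifted_log_ratio lerD2r.
have k0 : 0 <= lo * kappa ^+ 2 by rewrite mulr_ge0 ?(ltW lo0)// sqr_ge0.
by rewrite ler_ln ?posrE ?lerDl// ltr_wpDr.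
Qed.

Lemma lifted_lipschitz kappa : 0 < kappa -> exists2 B, 0 < B &
  forall th th' t, Theta th -> Theta th' -> D t ->
  `|lifted_log_ratio kappa th t - lifted_log_ratio kappa th' t| <= B * `|th - th'|.
Proof.
move=> k0; have e0 : 0 < lo * kappa ^+ 2 by rewrite mulr_gt0// exprn_gt0.
exists ((lo * kappa ^+ 2)^-1 * (2 * S * M)); first by rewrite mulr_gt0 ?invr_gt0// !mulr_gt0.
move=> th th' t Th Th' /DI t0; have l1 := lam_gt0 Th t0; have l2 := lam_gt0 Th' t0.
rewrite /lifted_log_ratio opprB addrA subrK.
apply: le_trans (ln_lipschitz e0 _ _) _; [by rewrite lerDr ltW|by rewrite lerDr ltW|].
rewrite -[leRHS]mulrA ler_pM2l ?invr_gt0// opprD addrACA subrr addr0.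
exact: intensity_lipschitz.
Qed.

(** The squared Hellinger distance between the intensities at theta and theta0;
    see [hellingerE]. *)
Definition hellinger th : R :=
  compensator tau f (fun t => (expR (2^-1 * log_ratio theta0 lam th t) - 1) ^+ 2).

Let bl th : Theta th -> bm (log_ratio theta0 lam th).
Proof. by move=> Th; exact: (bounded_measurable_log_ratio theta0_in mlam blam Th). Qed.

Let b1 (c : R) : bm (fun=> c).
Proof. exact: bounded_measurable_cst. Qed.

(** With q^2 = lambda(theta) / lambda(theta0), the lifted log-ratio is at most 2
    ln (q + kappa) <= 2 (q + kappa - 1), and 2 (q - 1) - (q^2 - 1) = - (q -
    1)^2. *)
Lemma lifted_drift kappa th : 0 < kappa -> Theta th ->
  compensator tau f (lifted_log_ratio kappa th) -
    compensator tau f (fun t => expR (log_ratio theta0 lam th t) - 1) <=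
  - hellinger th + 2 * kappa * total.
Proof.
move=> k0 Th; have bh : bm (fun t => expR (2^-1 * log_ratio theta0 lam th t) - 1).
  by apply: bounded_measurableB => //; apply: bounded_measurable_expR; apply: bounded_measurableZ; exact: bl.
have be : bm (fun t => expR (log_ratio theta0 lam th t) - 1).
  by apply: bounded_measurableB => //; apply: bounded_measurable_expR; exact: bl.
have bh2 := bounded_measurable_sqr bh.
have E1 := compensatorB mf lo0 lam_bnd (bounded_measurable_lifted kappa Th) be.
have E2 := compensatorB mf lo0 lam_bnd (b1 (2 * kappa * 1)) bh2.
have E3 := compensatorZ mf lo0 lam_bnd (2 * kappa) (b1 1).
rewrite -E1 /hellinger addrC -E3 -E2.
apply: (le_compensator mf lo0 lam_bnd).
- by apply: bounded_measurableB => //; exact: bounded_measurable_lifted.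
- exact: bounded_measurableB.
move=> t Dt; have t0 := DI Dt; rewrite mulr1.
set L := log_ratio theta0 lam th t; set q := expR (2^-1 * L).
have LE : expR L = q ^+ 2 by rewrite expr2 -expRD; congr expR; field.
have q0 : 0 < q by exact: expR_gt0.
have l1 := lam_gt0 Th t0; have /andP[f1 _] := lam_bnd t0; have f0 := lt_le_trans lo0 f1.
have lamE : lam th t = q ^+ 2 * f t.
  by rewrite -LE (expR_log_ratio blam lo0 lam_bnd Th Dt).
have B1 : lifted_log_ratio kappa th t <= 2 * (q + kappa - 1).
  rewrite /lifted_log_ratio -ln_div ?posrE//; last by rewrite ltr_wpDr// mulr_ge0 ?(ltW lo0)// sqr_ge0.
  apply: (@le_trans _ _ (ln ((q + kappa) ^+ 2))).
    rewrite ler_ln ?posrE ?exprn_gt0 ?addr_gt0//; last first.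
      by rewrite divr_gt0// ltr_wpDr// mulr_ge0 ?(ltW lo0)// sqr_ge0.
    rewrite ler_pdivrMr// lamE sqrrD.
    apply: (@le_trans _ _ (q ^+ 2 * f t + kappa ^+ 2 * f t)).
      by rewrite lerD2l mulrC ler_wpM2l// sqr_ge0.
    rewrite -mulrDl ler_pM2r// -addrA lerD2l lerDr mulrn_wge0//.
    by rewrite mulr_ge0// ltW.
  rewrite lnXn ?addr_gt0// -[leLHS]mulr_natl ler_pM2l//.
  by have := @le_ln1Dx R (q + kappa - 1); rewrite addrCA subrr addr0; apply; lra.
by rewrite LE; move: B1; lra.
Qed.

End consistency.

Section consistency.
Context (R : realType) (tau alpha beta theta0 : R) (lam : R -> R -> R) (lo hi M : R).
Local Notation Theta := (`]alpha, beta[%classic : set R).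
Hypothesis tau0 : 0 < tau.
Hypothesis theta0_in : theta0 \in `]alpha, beta[.
Hypothesis mlam : forall th, Theta th -> measurable_fun (`[0, tau]%classic : set R) (lam th).
Hypothesis blam : forall th, Theta th -> bounded_positive tau (lam th).
Hypothesis lo0 : 0 < lo.
Hypothesis lam_bnd : forall t, t \in `[0, tau] -> lo <= lam theta0 t <= hi.
Local Notation f := (lam theta0).
Hypothesis M0 : 0 < M.
Hypothesis sqrt_lip : forall th th' t, Theta th -> Theta th' -> t \in `[0, tau] ->
  `|Num.sqrt (lam th t) - Num.sqrt (lam th' t)| <= M * `|th - th'|.
Hypothesis separated : forall nu : R, 0 < nu -> exists2 delta, 0 < delta &
  forall th, Theta th -> nu < `|th - theta0| -> delta <= hellinger tau theta0 lam th.
Context (d : nat -> measure_display) (T : forall n, measurableType (d n)).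
Context (P : forall n, probability (T n) R) (X : forall n, 'I_n -> T n -> cumulative R R).
Hypothesis HX : forall n j, poisson_process tau f (P n) (@X n j).
Hypothesis iX : forall n, mutually_independent (P n) (fun j => sigma_of_process tau (@X n j)).

Local Notation bm := (@bounded_measurable _ (measurableTypeR R) R (`]0, tau]%classic)).
Local Notation total := (compensator tau f (fun=> 1)).
Local Notation Y := (@empirical R tau f d T X).

Let mf : measurable_fun (`[0, tau]%classic : set R) f.
Proof. exact: mlam. Qed.

Let Th0 : Theta theta0. Proof. by []. Qed.

Lemma log_likelihood_ratio_le n (w : T n) (kappa th : R) : (0 < n)%N -> 0 < kappa -> Theta th ->
  log_likelihood_ratio tau theta0 lam (fun j => @X n j w) th <=
  Num.sqrt n%:R * Y (lifted_log_ratio theta0 lam lo kappa th) w +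
    n%:R * (- hellinger tau theta0 lam th + 2 * kappa * total).
Proof.
move=> n0 k0 Th; rewrite /log_likelihood_ratio.
have bl := bounded_measurable_lifted theta0_in mlam blam lo0 kappa Th.
have H1 : \sum_(j < n) stoch_int tau (@X n j w) (log_ratio theta0 lam th) <=
    \sum_(j < n) stoch_int tau (@X n j w) (lifted_log_ratio theta0 lam lo kappa th).
  apply: ler_sum => j _; apply: (le_stoch_int_fun _ tau0 (bounded_measurable_log_ratio theta0_in mlam blam Th) bl).
  by move=> t Dt; exact: (log_ratio_le_lifted theta0 blam lo0 kappa Th Dt).
have H2 := sum_stoch_int tau f (@X n) (lifted_log_ratio theta0 lam lo kappa th) w n0.
rewrite H2 in H1.
have H3 := lifted_drift theta0_in mlam blam lo0 lam_bnd k0 Th.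
rewrite -(ler_pM2l (_ : 0 < n%:R)) ?ltr0n// in H3.
move: H1 H3; rewrite /empirical mulrBr.
move: (\sum_j stoch_int _ _ _) (Num.sqrt _ * _) (n%:R * compensator _ _ _) (n%:R * compensator _ _ _) => a b c c'.
set e := n%:R * _; move=> h1 h2; lra.
Qed.

(** The lifted drift is at most - n delta / 2 outside the nu-neighbourhood of
    theta0, whereas sqrt n times the empirical process is at most sqrt n U,
    uniformly in theta. By Markov's inequality the event U < c sqrt n has
    probability close to 1 for large n. *)
Lemma consistency (nu : R) : 0 < nu -> exists C c : R, 0 < c /\
  forall n, (0 < n)%N -> exists U : T n -> R,
    [/\ (P n).-integrable [set: T n] (EFin \o U), forall w, 0 <= U w,
        \int[P n]_w U w <= C &
        forall w, U w < c * Num.sqrt n%:R -> forall th, Theta th -> nu < `|th - theta0| ->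
          log_likelihood_ratio tau theta0 lam (fun j => @X n j w) th < 0].
Proof.
move=> nu0; have [delta d0 dh] := separated nu0.
have tot0 : 0 <= total by exact: (compensator1_ge0 mf lo0 lam_bnd).
pose kappa := delta / (4 * (total + 1)).
have k0 : 0 < kappa by rewrite divr_gt0// mulr_gt0// ltr_wpDl.
have k_drift : 2 * kappa * total <= delta / 2.
  rewrite /kappa (_ : 2 * _ * total = delta / 2 * (total / (total + 1))); last first.
    by field; rewrite gt_eqF// ltr_wpDl.
  rewrite ler_piMr ?divr_ge0 ?(ltW d0)// ler_pdivrMr ?ltr_wpDl// mul1r.
  by rewrite lerDl.
have [B B0 BL] := lifted_lipschitz theta0_in blam lo0 lam_bnd M0 sqrt_lip k0.
pose Phi := lifted_log_ratio theta0 lam lo kappa.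
have bPhi th : Theta th -> bm (Phi th).
  by move=> Th; exact: (bounded_measurable_lifted theta0_in mlam blam lo0 kappa Th).
have ab : alpha < beta by move: theta0_in; rewrite in_itv/= => /andP[h1 h2]; exact: lt_trans h2.
have inT (h : R) : alpha < h < beta -> Theta h by rewrite /= in_itv.
pose V := compensator tau f (fun t => Phi theta0 t ^+ 2).
exists (B * (beta - alpha) * (1 + 3 * total) * 2 + (1 + V)), (delta / 2); split.
  by rewrite divr_gt0.
move=> n n0.
have [U [IU U0 EU HU]] := @empirical_oscillation _ _ _ _ _ tau0 mf lo0 lam_bnd _ _ _ _ HX iX n
  alpha beta B Phi n0 ab B0 (fun h hh => bPhi h (inT h hh))
  (fun h h' t hh hh' Dt => BL h h' t (inT h hh) (inT h' hh') Dt).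
have [IY EY] := empirical_moment tau0 mf lo0 lam_bnd HX iX n (bPhi _ Th0).
have IaY := integrable_norm IY.
exists (fun w => U w + `|Y (Phi theta0) w|); split.
- exact: integrableD IU IaY.
- by move=> w; rewrite addr_ge0.
- by rewrite (RintegralD_setT IU IaY) lerD.
move=> w Uw th Th nuth.
have n1 : 0 < Num.sqrt n%:R :> R by rewrite sqrtr_gt0 ltr0n.
have nE : n%:R = Num.sqrt n%:R * Num.sqrt n%:R :> R by rewrite -expr2 sqr_sqrtr.
apply: le_lt_trans (log_likelihood_ratio_le w n0 k0 Th) _.
have HY : Y (Phi th) w <= U w + `|Y (Phi theta0) w|.
  have inth : alpha < th < beta by move: Th; rewrite /= in_itv.
  have inth0 : alpha < theta0 < beta by move: Th0; rewrite /= in_itv.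
  have := HU w th theta0 inth inth0; rewrite ler_norml => /andP[_ h1].
  have := ler_norm (Y (Phi theta0) w); lra.
have hd := dh th Th nuth.
apply: (@le_lt_trans _ _ (Num.sqrt n%:R * (U w + `|Y (Phi theta0) w|) + n%:R * (- (delta / 2)))).
  by rewrite lerD// ler_wpM2l// ?(ltW n1)//; lra.
move: Uw n1 nE; set s := Num.sqrt n%:R => Uw n1 nE.
rewrite nE -mulrA -mulrDr pmulr_rlt0//; lra.
Qed.

(** The log-likelihood ratio vanishes at theta0 and is negative at distance more
    than nu, so its supremum is the one over a compact neighbourhood of theta0,
    where it is Lipschitz. *)
Lemma likelihood_maximizer (r A nu : R) n (x : 'I_n -> cumulative R R) : 0 < nu -> nu < r ->
  (forall h, `|h| <= r -> Theta (theta0 + h)) ->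
  (forall h h' t, `|h| <= r -> `|h'| <= r -> `]0, tau]%classic t ->
     `|log_ratio theta0 lam (theta0 + h) t - log_ratio theta0 lam (theta0 + h') t| <= A * `|h - h'|) ->
  (forall th, Theta th -> nu < `|th - theta0| -> log_likelihood_ratio tau theta0 lam x th < 0) ->
  exists th, maximizes_likelihood Theta tau lam x th.
Proof.
move=> nu0 nur Hr Lip far; set l := log_likelihood_ratio tau theta0 lam x.
have A0 : 0 <= A.
  have t0 : (`]0, tau]%classic : set R) tau by rewrite /= in_itv/= tau0 lexx.
  have r0 : 0 < r := lt_trans nu0 nur.
  have rr : `|r| <= r by rewrite gtr0_norm.
  have r00 : `|0 : R| <= r by rewrite normr0 ltW.
  have := Lip _ _ _ rr r00 t0; rewrite subr0 (gtr0_norm r0) => /(le_trans (normr_ge0 _)).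
  by rewrite pmulr_lge0.
have bl h : `|h| <= r -> bm (log_ratio theta0 lam (theta0 + h)).
  by move=> hr; exact: (bounded_measurable_log_ratio theta0_in mlam blam (Hr h hr)).
pose S := Num.sqrt hi + M * (beta - alpha).
pose K := \sum_(j < n) (A * (x j tau - x j 0)) + n%:R * (lo^-1 * (2 * S * M) * total).
have K_lip (h h' : R) : `|h| <= r -> `|h'| <= r ->
    `|l (theta0 + h) - l (theta0 + h')| <= K * `|h - h'|.
  move=> hr h'r; have Th := Hr h hr; have Th' := Hr h' h'r.
  have b1 (c : R) : bm (fun=> c) by exact: bounded_measurable_cst.
  have bE y : `|y| <= r -> bm (fun t => expR (log_ratio theta0 lam (theta0 + y) t) - 1).
    by move=> yr; apply: bounded_measurableB => //; apply: bounded_measurable_expR; exact: bl.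
  have E1 : \sum_(j < n) stoch_int tau (x j) (log_ratio theta0 lam (theta0 + h)) -
      \sum_(j < n) stoch_int tau (x j) (log_ratio theta0 lam (theta0 + h')) =
      \sum_(j < n) stoch_int tau (x j) (fun t => log_ratio theta0 lam (theta0 + h) t -
        log_ratio theta0 lam (theta0 + h') t).
    rewrite -sumrB; apply: eq_bigr => j _.
    by rewrite (stoch_intB tau0 (x j) (bl h hr) (bl h' h'r)).
  have E2 := compensatorB mf lo0 lam_bnd (bE h hr) (bE h' h'r).
  have N1 : `|\sum_(j < n) stoch_int tau (x j) (fun t => log_ratio theta0 lam (theta0 + h) t -
        log_ratio theta0 lam (theta0 + h') t)| <=
      (\sum_(j < n) A * (x j tau - x j 0)) * `|h - h'|.
    apply: le_trans (ler_norm_sum _ _ _) _; rewrite mulr_suml; apply: ler_sum => j _.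
    rewrite mulrAC; apply: (le_stoch_int tau0) => [|t Dt]; last exact: Lip.
    by apply: bounded_measurableB; exact: bl.
  have N2 := norm_compensator_le mf lo0 lam_bnd (bounded_measurableB (bE h hr) (bE h' h'r))
    (M := lo^-1 * (2 * S * M) * `|h - h'|).
  have {}N2 := N2 _.
  rewrite E2 in N2.
  rewrite /l /log_likelihood_ratio.
  have split4 (a b c c' : R) : (a - n%:R * c) - (b - n%:R * c') = (a - b) - n%:R * (c - c') by ring.
  rewrite split4 E1 (le_trans (ler_normB _ _))// /K [leRHS]mulrDl lerD// normrM.
  rewrite ger0_norm// -[leRHS]mulrA ler_wpM2l// [leRHS]mulrAC; apply: N2 => t Dt.
  have t0 : t \in `[0, tau] by move: Dt; rewrite /= !in_itv/= => /andP[/ltW -> ->].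
  have /andP[f1 _] := lam_bnd t0; have f0 : 0 < f t := lt_le_trans lo0 f1.
  rewrite opprB addrA subrK -(ler_pM2r f0) -[X in _ * X <= _](gtr0_norm f0) -normrM mulrBl.
  rewrite (expR_log_ratio blam lo0 lam_bnd Th Dt) (expR_log_ratio blam lo0 lam_bnd Th' Dt).
  have I := intensity_lipschitz theta0_in blam lam_bnd M0 sqrt_lip Th Th' t0.
  rewrite -/S opprD addrACA subrr add0r in I; apply: (le_trans I).
  have z0 : 0 <= 2 * S * M * `|h - h'| := le_trans (normr_ge0 _) I.
  rewrite -[leLHS]mul1r -[in leRHS]mulrA [leRHS]mulrAC ler_wpM2r// mulrC ler_pdivlMr// mul1r.
  exact: f1.
have cl (h : R) : `|h| < r -> {for (theta0 + h), continuous l}.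
  move=> hr; apply/cvgrPdist_lt => e e0.
  have K1 : 0 < `|K| + 1 by rewrite ltr_wpDl.
  apply/nbhs_ballP; exists (Num.min (r - `|h|) (e / (`|K| + 1))).
    by rewrite /= lt_min subr_gt0 hr divr_gt0.
  move=> th; rewrite /ball/= lt_min => /andP[h1 h2].
  have E : th = theta0 + (th - theta0) by rewrite addrC subrK.
  have hE : theta0 + h - th = h - (th - theta0) by ring.
  rewrite hE in h1 h2.
  have thr : `|th - theta0| <= r.
    rewrite -(subrK h (th - theta0)) (le_trans (ler_normD _ _))// -lerBrDr.
    by rewrite distrC ltW.
  rewrite [in l th]E (le_lt_trans (K_lip _ _ (ltW hr) thr))//.
  rewrite ltr_pdivlMr// mulrC in h2; apply: le_lt_trans h2.
  by rewrite ler_wpM2r// (le_trans (ler_norm _))// lerDl.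
have l00 : l theta0 = 0.
  have Z t : log_ratio theta0 lam theta0 t = 0 by rewrite /log_ratio subrr.
  rewrite /l /log_likelihood_ratio.
  rewrite (_ : log_ratio theta0 lam theta0 = (fun=> 0)); last by apply/funext => t; exact: Z.
  rewrite (_ : (fun t => expR 0 - 1) = (fun t => 0 * 1)); last first.
    by apply/funext => t; rewrite expR0 subrr mul0r.
  rewrite (compensatorZ mf lo0 lam_bnd 0 (bounded_measurable_cst _ 1)) mul0r mulr0 subr0.
  by rewrite big1// => j _; rewrite stoch_int_cst// mul0r.
have [c cin cmax] : exists2 c, c \in `[theta0 - nu, theta0 + nu] &
    forall t, t \in `[theta0 - nu, theta0 + nu] -> l t <= l c.
  apply: EVT_max; first by lra.
  apply: continuous_in_subspaceT => th; rewrite inE/= in_itv/= => /andP[h1 h2].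
  have -> : th = theta0 + (th - theta0) by rewrite addrC subrK.
  by apply: cl; rewrite ltr_norml; apply/andP; split; lra.
exists c; apply/(maximizes_likelihoodP tau0 theta0_in mlam blam lo0 lam_bnd).
have inball th : th \in `[theta0 - nu, theta0 + nu] <-> `|th - theta0| <= nu.
  by rewrite in_itv/= ler_norml; split => /andP[h1 h2]; apply/andP; split; lra.
split.
  have -> : c = theta0 + (c - theta0) by rewrite addrC subrK.
  by apply: Hr; apply: le_trans (ltW nur); exact/inball.
move=> u Tu; have [unu|unu] := leP `|u - theta0| nu; first by apply: cmax; exact/inball.
apply: le_trans (ltW (far u Tu unu)) _; rewrite -l00; apply: cmax; apply/inball.
by rewrite subrr normr0 ltW.
Qed.

End consistency.

(** * The likelihood near the true value *)

Lemma expR_remainder (R : realType) (x X : R) : `|x| <= X ->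
  `|expR x - 1 - x - x ^+ 2 / 2| <= expR X * `|x| ^+ 3.
Proof.
move=> xX.
have E1 (y : R) : `|y| <= X -> `|expR y - 1| <= expR X * `|y|.
  move=> yX; apply: (@mean_value_le0 _ (fun z => expR z - 1) expR).
  - by rewrite expR0 subrr.
  - by move=> z _; apply: is_derive_eq; rewrite subr0.
  - move=> z zy; rewrite ger0_norm ?expR_ge0// ler_expR.
    by rewrite (le_trans (ler_norm _))// (le_trans zy).
have E2 (y : R) : `|y| <= X -> `|expR y - 1 - y| <= expR X * `|y| ^+ 2.
  move=> yX; rewrite expr2 mulrA.
  apply: (@mean_value_le0 _ (fun z => expR z - 1 - z) (fun z => expR z - 1)).
  - by rewrite expR0 !subrr.
  - by move=> z _; apply: is_derive_eq; rewrite subr0.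
  - move=> z zy; rewrite (le_trans (E1 _ (le_trans zy yX)))//.
    by rewrite ler_wpM2l ?expR_ge0.
rewrite (_ : expR X * `|x| ^+ 3 = expR X * `|x| ^+ 2 * `|x|); last by ring.
apply: (@mean_value_le0 _ (fun z => expR z - 1 - z - z ^+ 2 / 2) (fun z => expR z - 1 - z)).
- by rewrite expR0 expr0n/= mul0r !subrr.
- by move=> z _; apply: is_derive_eq; rewrite /GRing.scale/=; field.
- move=> z zx; rewrite (le_trans (E2 _ (le_trans zx xX)))//.
  by rewrite ler_wpM2l ?expR_ge0// lerXn2r ?nnegrE.
Qed.

Section local_likelihood.
Context (R : realType) (tau alpha beta theta0 : R) (lam : R -> R -> R) (lo hi r A : R).
Local Notation Theta := (`]alpha, beta[%classic : set R).
Hypothesis tau0 : 0 < tau.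
Hypothesis theta0_in : theta0 \in `]alpha, beta[.
Hypothesis mlam : forall th, Theta th -> measurable_fun (`[0, tau]%classic : set R) (lam th).
Hypothesis blam : forall th, Theta th -> bounded_positive tau (lam th).
Hypothesis lo0 : 0 < lo.
Hypothesis lam_bnd : forall t, t \in `[0, tau] -> lo <= lam theta0 t <= hi.
Hypothesis r0 : 0 < r.
Hypothesis A0 : 0 < A.
Hypothesis Hr : forall h, `|h| <= r -> Theta (theta0 + h).
Hypothesis score_le : forall t, t \in `[0, tau] -> `|score3 theta0 lam t| <= A.
Hypothesis remainder_lip : forall h h' t, `|h| <= r -> `|h'| <= r -> t \in `[0, tau] ->
  `|cubic_remainder theta0 lam h t - cubic_remainder theta0 lam h' t| <= A * `|h - h'|.

Local Notation f := (lam theta0).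
Local Notation g := (score3 theta0 lam).
Local Notation rho := (cubic_remainder theta0 lam).
Local Notation L := (log_ratio theta0 lam).
Local Notation bm := (@bounded_measurable _ (measurableTypeR R) R (`]0, tau]%classic)).
Local Notation total := (compensator tau f (fun=> 1)).
Local Notation D := (`]0, tau]%classic : set R).

Let mf : measurable_fun (`[0, tau]%classic : set R) f.
Proof. exact: mlam. Qed.

Let DI t : D t -> t \in `[0, tau].
Proof. by rewrite /= !in_itv/= => /andP[/ltW -> ->]. Qed.

Let norm0r : `|0 : R| <= r. Proof. by rewrite normr0 ltW. Qed.

Lemma cubic_remainder_le (h t : R) : `|h| <= r -> D t -> `|rho h t| <= A * `|h|.
Proof.
move=> hr Dt; have := remainder_lip hr norm0r (DI Dt).
by rewrite cubic_remainder0 !subr0.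
Qed.

Let scaled_log_ratio (h t : R) : h != 0 -> h ^- 3 * L (theta0 + h) t = g t + rho h t.
Proof. by move=> h0; rewrite log_ratioE mulKf// expf_neq0. Qed.

(** By the expansion, g is the limit of the functions h^-3 ln (lambda(theta0 +
    h) / lambda(theta0)) as h tends to 0. *)
Lemma bounded_measurable_score3 : bm g.
Proof.
split; last by exists A => t /DI; exact: score_le.
pose h (k : nat) : R := r * k.+1%:R^-1.
have h0 k : 0 < h k by rewrite mulr_gt0// invr_gt0.
have hr k : `|h k| <= r.
  by rewrite gtr0_norm// /h ler_piMr ?(ltW r0)// invf_le1// ler1n.
have mh k : measurable_fun (D : set (measurableTypeR R)) (fun t => h k ^- 3 * L (theta0 + h k) t).
  have [m _] := bounded_measurableZ (h k ^- 3) (bounded_measurable_log_ratio theta0_in mlam blam (Hr (hr k))).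
  exact: m.
apply: (measurable_fun_cvg mh) => t Dt.
apply/cvgrPdist_le => e e0; near=> k.
rewrite scaled_log_ratio ?gt_eqF// opprD addrA subrr sub0r normrN.
apply: le_trans (cubic_remainder_le (hr k) Dt) _.
rewrite gtr0_norm// /h mulrA ler_pdivrMr// [leRHS]mulrC -ler_pdivrMr//.
near: k; exists (Num.bound (A * r / e)) => // k /= kb.
rewrite (le_trans (ltW (archi_boundP _)))//; first by rewrite divr_ge0 ?(ltW e0)// mulr_ge0 ?(ltW A0) ?(ltW r0).
by rewrite ler_nat (leq_trans kb).
Unshelve. all: end_near. Qed.

Lemma bounded_measurable_cubic_remainder (h : R) : `|h| <= r -> bm (rho h).
Proof.
move=> hr; have [->|h0] := eqVneq h 0.
  rewrite (_ : rho 0 = fun=> 0); first exact: bounded_measurable_cst.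
  by apply/funext => t; exact: cubic_remainder0.
rewrite (_ : rho h = (fun t => h ^- 3 * L (theta0 + h) t - g t)).
  apply: bounded_measurableB; last exact: bounded_measurable_score3.
  by apply: bounded_measurableZ; exact: (bounded_measurable_log_ratio theta0_in mlam blam (Hr hr)).
by apply/funext => t; rewrite scaled_log_ratio// addrAC subrr add0r.
Qed.

(** The Kullback-Leibler divergence for one observation, that is, minus the mean
    of the log-likelihood ratio. *)
Definition drift (h : R) : R :=
  compensator tau f (fun t => expR (L (theta0 + h) t) - 1) -
  compensator tau f (L (theta0 + h)).

Local Notation I := (compensator tau f (fun t => g t ^+ 2)).

(** The integrand is e^x - 1 - x = x^2 / 2 + O(x^3) at x = h^3 (g + rho_h). *)
Lemma drift_expansion : exists2 B, 0 <= B & forall h, `|h| <= r ->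
  `|drift h - h ^+ 6 * (I / 2)| <= B * (`|h| ^+ 6 * `|h|).
Proof.
pose G := A + A * r; have G0 : 0 <= G by rewrite addr_ge0 ?mulr_ge0 ?ltW.
pose X := r ^+ 3 * G; pose B := expR X * G ^+ 3 * r ^+ 2 + A * G.
have B0 : 0 <= B.
  by rewrite addr_ge0 ?mulr_ge0 ?expR_ge0 ?exprn_ge0 ?(ltW r0) ?(ltW A0).
have tot0 : 0 <= total by exact: (compensator1_ge0 mf lo0 lam_bnd).
exists (B * total); first by rewrite mulr_ge0.
move=> h hr; have bL := bounded_measurable_log_ratio theta0_in mlam blam (Hr hr).
have b1 (c : R) : bm (fun=> c) by exact: bounded_measurable_cst.
have bE := bounded_measurableB (bounded_measurable_expR bL) (b1 1).
have bEL := bounded_measurableB bE bL.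
have bg2 := bounded_measurableZ (h ^+ 6 / 2) (bounded_measurable_sqr bounded_measurable_score3).
have E1 := compensatorB mf lo0 lam_bnd bE bL.
have E2 := compensatorB mf lo0 lam_bnd bEL bg2.
have E3 := compensatorZ mf lo0 lam_bnd (h ^+ 6 / 2) (bounded_measurable_sqr bounded_measurable_score3).
have IE : h ^+ 6 * (I / 2) = h ^+ 6 / 2 * I by rewrite mulrA mulrAC.
rewrite /drift IE.
rewrite -E1 -E3 -E2 [leRHS]mulrAC.
apply: (norm_compensator_le mf lo0 lam_bnd); first exact: bounded_measurableB.
move=> t Dt; have gA := score_le (DI Dt); have rA := cubic_remainder_le hr Dt.
rewrite log_ratioE; set p := g t + rho h t; set x := h ^+ 3 * p.
have pG : `|p| <= G.
  by rewrite (le_trans (ler_normD _ _))// lerD// (le_trans rA)// ler_pM2l.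
have gG : `|g t| <= G by rewrite (le_trans gA)// lerDl mulr_ge0 ?ltW.
have h3 : `|h ^+ 3| <= r ^+ 3 by rewrite normrX lerXn2r ?nnegrE ?(ltW r0).
have xX : `|x| <= X by rewrite /x /X normrM ler_pM.
rewrite (_ : _ - _ = (expR x - 1 - x - x ^+ 2 / 2) +
    h ^+ 6 * ((p - g t) * (p + g t)) / 2); last by rewrite /x; field.
rewrite (le_trans (ler_normD _ _))// /B [leRHS]mulrDl lerD//.
  apply: le_trans (expR_remainder xX) _.
  rewrite (_ : _ * r ^+ 2 * _ = expR X * (`|h| ^+ 6 * (`|h| * r ^+ 2) * G ^+ 3)); last by ring.
  rewrite ler_wpM2l ?expR_ge0// /x normrM exprMn normrX -exprM.
  rewrite (_ : (3 * 3 = 6 + 3)%N)// exprD ler_pM ?mulr_ge0 ?exprn_ge0//.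
    by rewrite ler_wpM2l ?exprn_ge0// exprS ler_wpM2l// lerXn2r ?nnegrE ?(ltW r0).
  by rewrite lerXn2r ?nnegrE.
have -> : p - g t = rho h t by rewrite /p addrAC subrr add0r.
have -> : `|h ^+ 6 * (rho h t * (p + g t)) / 2| = `|h| ^+ 6 * (`|rho h t| * `|p + g t|) / 2.
  by rewrite -normrX normrM [`|2^-1|]ger0_norm// normrM; congr (_ * _ / _); rewrite normrM.
have s2 : `|p + g t| <= 2 * G by rewrite (le_trans (ler_normD _ _))// mulr_natl mulr2n lerD.
rewrite (_ : A * G * _ = `|h| ^+ 6 * (A * `|h| * (2 * G)) / 2); last by field.
by rewrite ler_pM2r// ler_wpM2l ?exprn_ge0// ler_pM.
Qed.

Context (d : nat -> measure_display) (T : forall n, measurableType (d n)).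
Context (X : forall n, 'I_n -> T n -> cumulative R R).
Local Notation Y := (@empirical R tau f d T X).

Lemma log_likelihood_local n (w : T n) (h : R) : (0 < n)%N -> `|h| <= r ->
  log_likelihood_ratio tau theta0 lam (fun j => @X n j w) (theta0 + h) =
  Num.sqrt n%:R * (h ^+ 3 * (Y g w + Y (rho h) w)) - n%:R * drift h.
Proof.
move=> n0 hr; have H := sum_stoch_int tau f (@X n) (L (theta0 + h)) w n0.
have bg := bounded_measurable_score3; have br := bounded_measurable_cubic_remainder hr.
have E : Y (L (theta0 + h)) w = h ^+ 3 * (Y g w + Y (rho h) w).
  have bs := bounded_measurableD bg br.
  have e1 := empiricalZ tau0 mf lo0 lam_bnd X (h ^+ 3) w bs.
  have e2 := empiricalB tau0 mf lo0 lam_bnd X w bs br.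
  rewrite (_ : L (theta0 + h) = (fun t => h ^+ 3 * (g t + rho h t))); last first.
    by apply/funext => t; rewrite log_ratioE.
  rewrite e1; congr (_ * _); apply/eqP; rewrite -subr_eq -e2; apply/eqP.
  by congr empirical; apply/funext => t; rewrite addrK.
rewrite /log_likelihood_ratio H -E /drift mulrBr /empirical.
set a := Num.sqrt _ * _; set b := n%:R * compensator _ _ (L _); set c := n%:R * _.
by rewrite opprB addrA addrAC.
Qed.

End local_likelihood.

(** * Linearization of the estimator *)

Lemma markov_bound d (T : measurableType d) (R : realType) (P : probability T R) (U : T -> R)
    (m c : R) :
  P.-integrable [set: T] (EFin \o U) -> (forall w, 0 <= U w) -> \int[P]_w U w <= m -> 0 < c ->
  measurable [set w | c <= U w] /\ (P [set w | (c <= U w)%R] <= (m / c)%:E)%E.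
Proof.
move=> IU U0 Um c0; have mU : measurable_fun [set: T] U.
  by apply/measurable_EFinP; exact: (measurable_int P).
split.
  rewrite -[X in measurable X]setTI.
  have -> : [set w | c <= U w] = U @^-1` `[c, +oo[%classic.
    by apply/seteqP; split => w /=; rewrite in_itv/= andbT.
  exact: mU.
have H := @le_integral_comp_abse _ _ _ P _ measurableT (EFin \o U) c id
  (@measurable_id _ _ _) _ _ _ c0.
have {}H : (c%:E * P [set w | (c <= U w)%R] <= \int[P]_w (U w)%:E)%E.
  have -> : [set w | c <= U w] = [set: T] `&` [set x | (c%:E <= `|(EFin \o U) x|)%E].
    rewrite setTI; apply/seteqP; split => w /=; rewrite lee_fin ger0_norm//.
  have -> : (\int[P]_w (U w)%:E = \int[P]_w `|(EFin \o U) w|)%E.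
    by apply: eq_integral => w _ /=; rewrite ger0_norm.
  by apply: H => //; exact/measurable_EFinP.
have fU : (\int[P]_w (U w)%:E = (\int[P]_w U w)%:E)%E.
  by rewrite /Rintegral fineK//; exact: integrable_fin_num.
rewrite fU in H.
rewrite EFinM lee_pdivlMr// muleC.
by apply: le_trans H _; rewrite lee_fin.
Qed.

Section cube_root.
Context (R : realType).
Implicit Types x y : R.

Lemma cbrtK x : cbrt x ^+ 3 = x.
Proof.
have E : (`|x| `^ 3^-1) ^+ 3 = `|x|.
  by rewrite -(powR_mulrn 3 (powR_ge0 _ _)) -powRrM mulVf// powRr1.
rewrite /cbrt exprMn E.
have [->|x0] := eqVneq x 0; first by rewrite normr0 mulr0.
by rewrite exprS sqr_sg x0 mulr1 -numEsg.
Qed.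

Lemma le_cube x y : 0 <= y -> (`|x| <= y) = (`|x ^+ 3| <= y ^+ 3).
Proof. by move=> y0; rewrite normrX ler_pXn2r ?nnegrE. Qed.

End cube_root.

Section quadratic_maximizer.
Context (R : realType) (I Delta V u kappa eps : R).
Hypothesis I0 : 0 < I.
Hypothesis eps0 : 0 < eps.

(** Completing the square shows that (I / 2) (v - v')^2 is at most the
    difference of the perturbation terms. With e = |v - v'|, these are bounded
    by u (e + 2 V) + kappa (2 e^2 + 3 V^2). *)
Lemma quadratic_maximizer (v a a' k k' : R) : let v' := Delta / I in
  v' * (Delta + a') - v' ^+ 2 * (I / 2 + k') <= v * (Delta + a) - v ^+ 2 * (I / 2 + k) ->
  `|a| <= u -> `|a'| <= u -> `|k| <= kappa -> `|k'| <= kappa -> `|v'| <= V ->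
  kappa <= I / 8 -> u <= I * eps / 16 -> 2 * u * V <= I * eps ^+ 2 / 32 ->
  3 * kappa * V ^+ 2 <= I * eps ^+ 2 / 32 ->
  `|v - v'| <= eps.
Proof.
move=> v' H au a'u kk k'k v'V kI ueps uV kV.
have DE : Delta = I * v' by rewrite /v' mulrC mulfVK// gt_eqF.
have u0 : 0 <= u by apply: le_trans au.
have k0 : 0 <= kappa by apply: le_trans kk.
have V0 : 0 <= V by apply: le_trans v'V.
set e := `|v - v'|.
have ve : `|v| <= e + V.
  by rewrite -(subrK v' v) (le_trans (ler_normD _ _))// lerD2l.
have e0 : 0 <= e by rewrite normr_ge0.
have e2 : (v - v') ^+ 2 = e ^+ 2 by rewrite real_normK// num_real.
have h1 : v * a <= (e + V) * u.
  by rewrite (le_trans (ler_norm _))// normrM ler_pM.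
have h2 : - (v' * a') <= V * u.
  by rewrite (le_trans (ler_norm _))// normrN normrM ler_pM.
have sq (x y : R) : `|x| <= y -> x ^+ 2 <= y ^+ 2.
  by move=> xy; rewrite -[x ^+ 2]real_normK ?num_real// lerXn2r ?nnegrE// (le_trans _ xy).
have h3 : - (v ^+ 2 * k) <= (2 * e ^+ 2 + 2 * V ^+ 2) * kappa.
  rewrite (le_trans (ler_norm _))// normrN normrM ler_pM// ger0_norm ?sqr_ge0//.
  rewrite (le_trans (sq _ _ ve))//.
  by have := sqr_ge0 (e - V); rewrite sqrrB sqrrD; lra.
have h4 : v' ^+ 2 * k' <= V ^+ 2 * kappa.
  by rewrite (le_trans (ler_norm _))// normrM ler_pM// ger0_norm ?sqr_ge0// sq.
(* The maximality inequality, after completing the square in v. *)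
have key : I / 2 * e ^+ 2 <= (e + V) * u + V * u + (2 * e ^+ 2 + 2 * V ^+ 2) * kappa + V ^+ 2 * kappa.
  apply: (@le_trans _ _ (v * a - v' * a' - v ^+ 2 * k + v' ^+ 2 * k')); last by lra.
  rewrite -e2; move: H; rewrite DE; nra.
rewrite leNgt; apply/negP => eps_e.
have k1 : 2 * e ^+ 2 * kappa <= I / 4 * e ^+ 2.
  by have := sqr_ge0 e; nra.
have k2 : I / 4 * e ^+ 2 <= e * u + 2 * u * V + 3 * kappa * V ^+ 2 by nra.
have k3 : e * u <= I / 16 * e ^+ 2.
  apply: (@le_trans _ _ (e * (I * eps / 16))); first by rewrite ler_wpM2l.
  have -> : I / 16 * e ^+ 2 = e * (I * e / 16) by field.
  by rewrite ler_wpM2l// ler_pM2r// ler_pM2l// ltW.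
have k4 : I * eps ^+ 2 / 32 <= I * e ^+ 2 / 32.
  by rewrite ler_pM2r// ler_pM2l// lerXn2r ?nnegrE// ltW.
have e2p : 0 < I * e ^+ 2 by rewrite mulr_gt0// exprn_gt0// (lt_trans eps0).
have : I / 4 * e ^+ 2 <= I / 16 * e ^+ 2 + I * e ^+ 2 / 32 + I * e ^+ 2 / 32 by lra.
lra.
Qed.

End quadratic_maximizer.

Lemma small_radius (R : realType) (r K1 K2 K3 e1 e2 e3 : R) :
  0 < r -> 0 < e1 -> 0 < e2 -> 0 < e3 ->
  exists nu, [/\ 0 < nu, nu <= r, K1 * nu <= e1, K2 * nu <= e2 & K3 * nu <= e3].
Proof.
move=> r0 p1 p2 p3.
have K0 (K : R) : 0 < `|K| + 1 by rewrite ltr_wpDl.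
pose nu := Num.min (Num.min r (e1 / (`|K1| + 1))) (Num.min (e2 / (`|K2| + 1)) (e3 / (`|K3| + 1))).
have nu0 : 0 < nu by rewrite !lt_min r0 !divr_gt0.
have le_of (K e : R) : nu <= e / (`|K| + 1) -> K * nu <= e.
  rewrite ler_pdivlMr// mulrC => /(le_trans _); apply; rewrite ler_wpM2r ?(ltW nu0)//.
  by rewrite (le_trans (ler_norm _))// lerDl.
exists nu; split=> //; first by rewrite !ge_min lexx.
- by apply: le_of; rewrite !ge_min lexx !orbT.
- by apply: le_of; rewrite !ge_min lexx !orbT.
- by apply: le_of; rewrite !ge_min lexx !orbT.
Qed.

Lemma large_sqrt (R : realType) (K : R) : exists N : nat, forall n, (N <= n)%N ->
  (0 < n)%N /\ K <= Num.sqrt n%:R.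
Proof.
exists (Num.bound (K ^+ 2)).+1 => n Nn; split; first exact: leq_trans Nn.
rewrite (le_trans (ler_norm _))// -sqrtr_sqr ler_wsqrtr//.
rewrite (le_trans (ltW (archi_boundP (sqr_ge0 _))))// ler_nat.
exact: leq_trans (leqnSn _) Nn.
Qed.

Lemma double_ball (R : realType) (h nu r : R) : nu <= r / 3 -> 0 < nu ->
  - (2 * nu) < h < 2 * nu -> `|h| <= r.
Proof. by move=> nur nu0 /andP[h1 h2]; rewrite ler_norml; apply/andP; split; lra. Qed.

Lemma ball_double (R : realType) (h nu : R) : 0 < nu -> `|h| <= nu -> - (2 * nu) < h < 2 * nu.
Proof. by move=> nu0; rewrite ler_norml => /andP[h1 h2]; apply/andP; split; lra. Qed.

Section linearization.
Context (R : realType) (tau alpha beta theta0 : R) (lam : R -> R -> R) (lo hi M r A : R).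
Local Notation Theta := (`]alpha, beta[%classic : set R).
Hypothesis tau0 : 0 < tau.
Hypothesis theta0_in : theta0 \in `]alpha, beta[.
Hypothesis mlam : forall th, Theta th -> measurable_fun (`[0, tau]%classic : set R) (lam th).
Hypothesis blam : forall th, Theta th -> bounded_positive tau (lam th).
Hypothesis lo0 : 0 < lo.
Hypothesis lam_bnd : forall t, t \in `[0, tau] -> lo <= lam theta0 t <= hi.
Hypothesis M0 : 0 < M.
Hypothesis sqrt_lip : forall th th' t, Theta th -> Theta th' -> t \in `[0, tau] ->
  `|Num.sqrt (lam th t) - Num.sqrt (lam th' t)| <= M * `|th - th'|.
Hypothesis separated : forall nu : R, 0 < nu -> exists2 delta, 0 < delta &
  forall th, Theta th -> nu < `|th - theta0| -> delta <= hellinger tau theta0 lam th.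
Hypothesis r0 : 0 < r.
Hypothesis A0 : 0 < A.
Hypothesis Hr : forall h, `|h| <= r -> Theta (theta0 + h).
Hypothesis score_le : forall t, t \in `[0, tau] -> `|score3 theta0 lam t| <= A.
Hypothesis remainder_lip : forall h h' t, `|h| <= r -> `|h'| <= r -> t \in `[0, tau] ->
  `|cubic_remainder theta0 lam h t - cubic_remainder theta0 lam h' t| <= A * `|h - h'|.
Context (d : nat -> measure_display) (T : forall n, measurableType (d n)).
Context (P : forall n, probability (T n) R) (X : forall n, 'I_n -> T n -> cumulative R R).
Hypothesis HX : forall n j, poisson_process tau (lam theta0) (P n) (@X n j).
Hypothesis iX : forall n, mutually_independent (P n) (fun j => sigma_of_process tau (@X n j)).

Local Notation f := (lam theta0).
Local Notation g := (score3 theta0 lam).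
Local Notation rho := (cubic_remainder theta0 lam).
Local Notation L := (log_ratio theta0 lam).
Local Notation bm := (@bounded_measurable _ (measurableTypeR R) R (`]0, tau]%classic)).
Local Notation total := (compensator tau f (fun=> 1)).
Local Notation D := (`]0, tau]%classic : set R).
Local Notation I := (compensator tau f (fun t => g t ^+ 2)).
Local Notation Y := (@empirical R tau f d T X).
Local Notation ell w := (log_likelihood_ratio tau theta0 lam (fun j => @X _ j w)).

Hypothesis I0 : 0 < I.

Let mf : measurable_fun (`[0, tau]%classic : set R) f.
Proof. exact: mlam. Qed.

Let DI t : D t -> t \in `[0, tau].
Proof. by rewrite /= !in_itv/= => /andP[/ltW -> ->]. Qed.

Let norm0r : `|0 : R| <= r. Proof. by rewrite normr0 ltW. Qed.

Let rho_le (h t : R) : `|h| <= r -> D t -> `|rho h t| <= A * `|h|.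
Proof. exact: (cubic_remainder_le r0 remainder_lip). Qed.

Lemma log_ratio_lipschitz (h h' t : R) : `|h| <= r -> `|h'| <= r -> D t ->
  `|L (theta0 + h) t - L (theta0 + h') t| <= (3 * r ^+ 2 * (A + A * r) + r ^+ 3 * A) * `|h - h'|.
Proof.
move=> hr h'r Dt; rewrite !log_ratioE.
rewrite (_ : _ - _ = (h - h') * (h ^+ 2 + h * h' + h' ^+ 2) * (g t + rho h t) +
   h' ^+ 3 * (rho h t - rho h' t)); last by ring.
have n2 (x y : R) : `|x| <= r -> `|y| <= r -> `|x * y| <= r ^+ 2.
  by move=> xr yr; rewrite normrM expr2 ler_pM.
have q1 : `|h ^+ 2 + h * h' + h' ^+ 2| <= 3 * r ^+ 2.
  rewrite (_ : 3 * r ^+ 2 = r ^+ 2 + r ^+ 2 + r ^+ 2); last by ring.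
  by rewrite (le_trans (ler_normD _ _))// lerD ?n2// (le_trans (ler_normD _ _))// lerD// n2.
have q2 : `|g t + rho h t| <= A + A * r.
  rewrite (le_trans (ler_normD _ _))// lerD ?score_le ?DI// (le_trans (rho_le hr Dt))//.
  by rewrite ler_pM2l.
have q3 : `|h' ^+ 3| <= r ^+ 3 by rewrite normrX lerXn2r ?nnegrE ?(ltW r0).
rewrite (le_trans (ler_normD _ _))// [leRHS]mulrDl lerD//.
  by rewrite normrM normrM -[leLHS]mulrA [leRHS]mulrC ler_wpM2l// ler_pM.
by rewrite normrM -[leRHS]mulrA ler_pM// remainder_lip// DI.
Qed.

(** In the variable v the log-likelihood ratio is a parabola, up to the random
    perturbation Y (rho h) and the deterministic one k. *)
Lemma likelihood_quadratic : exists2 B, 0 <= B & forall n (w : T n) (h : R),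
  (0 < n)%N -> `|h| <= r -> let v := Num.sqrt n%:R * h ^+ 3 in
  exists2 k, `|k| <= B * `|h| &
    ell w (theta0 + h) = v * (Y g w + Y (rho h) w) - v ^+ 2 * (I / 2 + k).
Proof.
have [B B0 HB] := drift_expansion theta0_in mlam blam lo0 lam_bnd r0 A0 Hr score_le remainder_lip.
exists B => // n w h n0 hr v.
have E := log_likelihood_local tau0 theta0_in mlam blam lo0 lam_bnd r0 A0 Hr score_le remainder_lip
  X w n0 hr.
have nE : n%:R = Num.sqrt n%:R ^+ 2 :> R by rewrite sqr_sqrtr.
have HBh := HB h hr.
have [k kB kE] : exists2 k, `|k| <= B * `|h| &
    drift tau theta0 lam h = h ^+ 6 * (I / 2 + k).
  have [h0|h0] := eqVneq h 0.
    exists 0; first by rewrite normr0 mulr_ge0.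
    rewrite h0 expr0n/= mul0r; move: HBh.
    by rewrite h0 normr0 !mulr0 expr0n/= !mul0r subr0 normr_le0 => /eqP.
  have h6 : h ^+ 6 != 0 by rewrite expf_neq0.
  exists ((drift tau theta0 lam h - h ^+ 6 * (I / 2)) / h ^+ 6).
    rewrite normrM normfV ler_pdivrMr ?normr_gt0// normrX.
    by rewrite -[leRHS]mulrA [_ * `|h| ^+ 6]mulrC.
  by rewrite mulrDr [X in _ + X]mulrC mulfVK// addrC subrK.
exists k => //; rewrite E kE; move: nE; set s := Num.sqrt n%:R in v *; move=> ->.
by rewrite /v; ring.
Qed.

Lemma empirical_remainder0 n (w : T n) : Y (rho 0) w = 0.
Proof.
have b1 : bm (fun=> 1) by exact: bounded_measurable_cst.
have E := empiricalZ tau0 mf lo0 lam_bnd X 0 w b1.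
rewrite (_ : rho 0 = (fun t => 0 * 1)); first by rewrite E mul0r.
by apply/funext => t; rewrite cubic_remainder0 mul0r.
Qed.

(** The exceptional set E is the union of three events of probability at most
    eta / 3: the absolute value of Delta_n / I is at least V, the variable U of
    [consistency] is not below its threshold, or the bound on the oscillation of
    the empirical process of rho near 0 is at least u. The constants V, u, nu
    and N are chosen in this order. *)
Lemma mle_linearization (eps eta : R) : 0 < eps -> 0 < eta -> exists N : nat, forall n, (N <= n)%N ->
  exists E : set (T n), [/\ measurable E, (P n E <= eta%:E)%E &
    forall w (est : R), ~ E w ->
      ((exists th, maximizes_likelihood Theta tau lam (fun j => @X n j w) th) ->
        maximizes_likelihood Theta tau lam (fun j => @X n j w) est) ->
      `|Num.sqrt n%:R * (est - theta0) ^+ 3 - Y g w / I| <= eps].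
Proof.
move=> eps0 eta0; have tot0 : 0 <= total by exact: (compensator1_ge0 mf lo0 lam_bnd).
pose V := 3 * (1 + I) / (I * eta).
have V0 : 0 < V by rewrite divr_gt0 ?mulr_gt0// ltr_wpDl.
pose u := Num.min (I * eps / 16) (I * eps ^+ 2 / (64 * V)).
have Ie : 0 < I * eps by rewrite mulr_gt0.
have Ie2 : 0 < I * eps ^+ 2 by rewrite mulr_gt0// exprn_gt0.
have V64 : 0 < 64 * V by rewrite mulr_gt0.
have u0 : 0 < u by rewrite lt_min !divr_gt0.
have u1 : u <= I * eps / 16 by rewrite ge_min lexx.
have u2 : 2 * u * V <= I * eps ^+ 2 / 32.
  apply: (@le_trans _ _ (2 * (I * eps ^+ 2 / (64 * V)) * V)).
    by rewrite ler_pM2r// ler_pM2l// ge_min lexx orbT.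
  by rewrite le_eqVlt; apply/orP; left; apply/eqP; field; rewrite gt_eqF.
have [B B0 HB] := likelihood_quadratic.
have r3 : 0 < r / 3 by rewrite divr_gt0.
have p1 : 0 < I / 8 by rewrite divr_gt0.
have p2 : 0 < I * eps ^+ 2 / 32 by rewrite divr_gt0 ?mulr_gt0 ?exprn_gt0.
have p3 : 0 < u * eta / 3 by rewrite divr_gt0 ?mulr_gt0.
have [nu [nu0 nur nu1 nu2 nu3]] := small_radius B (3 * B * V ^+ 2) (A * 4 * (1 + 3 * total) * 2)
  r3 p1 p2 p3.
have [C [c [c0 HC]]] := consistency tau0 theta0_in mlam blam lo0 lam_bnd M0 sqrt_lip separated
  HX iX nu0.
have [N1 HN1] := large_sqrt (3 * C / (eta * c)).
have [N2 HN2] := large_sqrt (V / nu ^+ 3).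
exists (maxn N1 N2) => n; rewrite geq_max => /andP[/HN1[n0 sn1] /HN2[_ sn2]].
have s0 : 0 < Num.sqrt n%:R :> R by rewrite sqrtr_gt0 ltr0n.
have [U1 [IU1 U10 EU1 HU1]] := HC n n0.
have inr (h : R) : - (2 * nu) < h < 2 * nu -> `|h| <= r.
  exact: double_ball nur nu0.
have nu20 : 0 < 2 * nu by rewrite mulr_gt0.
have ab : - (2 * nu) < 2 * nu by rewrite (lt_trans _ nu20)// oppr_lt0.
have [U2 [IU2 U20 EU2 HU2]] := @empirical_oscillation _ _ _ _ _ tau0 mf lo0 lam_bnd _ _ _ _ HX iX n
  (- (2 * nu)) (2 * nu) A rho n0 ab A0
  (fun h hh => bounded_measurable_cubic_remainder theta0_in mlam blam r0 A0 Hr score_le remainder_lip (inr h hh))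
  (fun h h' t hh hh' Dt => remainder_lip (inr h hh) (inr h' hh') (DI Dt)).
have bg := bounded_measurable_score3 theta0_in mlam blam r0 A0 Hr score_le remainder_lip.
have [IY EY] := empirical_moment tau0 mf lo0 lam_bnd HX iX n bg.
have IV0 : 0 < I * V by rewrite mulr_gt0.
have [mE0 PE0] := markov_bound (integrable_norm IY) (fun w => normr_ge0 _) EY IV0.
have cs0 : 0 < c * Num.sqrt n%:R by rewrite mulr_gt0.
have [mE1 PE1] := markov_bound IU1 U10 EU1 cs0.
have [mE2 PE2] := markov_bound IU2 U20 EU2 u0.
pose E0 := [set w : T n | I * V <= `|Y g w|].
pose E1 := [set w | c * Num.sqrt n%:R <= U1 w].
pose E2 := [set w | u <= U2 w].
exists (E0 `|` E1 `|` E2); split.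
- by apply: measurableU => //; apply: measurableU.
- have e3 : (eta%:E = (eta / 3)%:E + (eta / 3)%:E + (eta / 3)%:E)%E.
    by rewrite -!EFinD; congr EFin; field.
  rewrite e3; apply: le_trans (measureU2 _ _ _) _ => //; first exact: measurableU.
  apply: leeD.
    apply: le_trans (measureU2 _ _ _) _ => //; apply: leeD.
      apply: le_trans PE0 _; rewrite lee_fin ler_pdivrMr// /V.
      rewrite (_ : _ * (I * _) = 1 + I)//; field; first by rewrite !gt_eqF.
    apply: le_trans PE1 _; rewrite lee_fin ler_pdivrMr//.
    by move: sn1; rewrite ler_pdivrMr ?mulr_gt0//; lra.
  apply: le_trans PE2 _; rewrite lee_fin ler_pdivrMr//.
  by move: nu3; lra.
move=> w est nE Hest.
have e0 : `|Y g w| < I * V by rewrite ltNge; apply/negP => h; apply: nE; left; left.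
have e1 : U1 w < c * Num.sqrt n%:R by rewrite ltNge; apply/negP => h; apply: nE; left; right.
have e2 : U2 w < u by rewrite ltNge; apply/negP => h; apply: nE; right.
have far := HU1 w e1.
have nu_r : nu < r by rewrite (le_lt_trans nur)// ltr_pdivrMr// ltr_pMr// ltr1n.
have ex := likelihood_maximizer tau0 theta0_in mlam blam lo0 lam_bnd M0 sqrt_lip nu0 nu_r Hr
  log_ratio_lipschitz far.
have /(maximizes_likelihoodP tau0 theta0_in mlam blam lo0 lam_bnd)[Test maxi] := Hest ex.
have l0 : ell w theta0 = 0.
  have [k _] := HB n w 0 n0 norm0r.
  by rewrite addr0 => ->; rewrite expr0n/= mulr0 mul0r expr0n/= mul0r subr0.
have est_near : `|est - theta0| <= nu.
  rewrite leNgt; apply/negP => /(far _ Test).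
  have := maxi theta0 theta0_in.
  by rewrite l0 leNgt => /negP.
pose v' := Y g w / I.
have v'V : `|v'| <= V.
  by rewrite normrM normfV (gtr0_norm I0) ler_pdivrMr// mulrC ltW.
(* The parameter at which v takes the value Delta_n / I. *)
pose h' := cbrt (v' / Num.sqrt n%:R).
have h'nu : `|h'| <= nu.
  rewrite (le_cube _ (ltW nu0)) cbrtK normrM normfV (gtr0_norm s0) ler_pdivrMr//.
  by rewrite (le_trans v'V)// mulrC -ler_pdivrMr ?exprn_gt0.
have v'E : Num.sqrt n%:R * h' ^+ 3 = v' by rewrite cbrtK mulrC mulfVK// gt_eqF.
have le_r (h : R) : `|h| <= nu -> `|h| <= r by move=> hh; rewrite (le_trans hh)// ltW.
have [k kB kE] := HB n w _ n0 (le_r _ est_near).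
have [k' k'B k'E] := HB n w _ n0 (le_r _ h'nu).
have osc (h : R) : `|h| <= nu -> `|Y (rho h) w| <= u.
  move=> hh; rewrite -(subr0 (Y _ w)) -(empirical_remainder0 w) (le_trans _ (ltW e2))//.
  have i0 : - (2 * nu) < 0 < 2 * nu by rewrite oppr_lt0 nu20.
  exact: (HU2 w h 0 (ball_double nu0 hh) i0).
have kap (x h : R) : `|x| <= B * `|h| -> `|h| <= nu -> `|x| <= B * nu.
  by move=> xB hh; rewrite (le_trans xB)// ler_wpM2l.
apply: (@quadratic_maximizer R I (Y g w) V u (B * nu) eps I0 eps0
  (Num.sqrt n%:R * (est - theta0) ^+ 3) (Y (rho (est - theta0)) w) (Y (rho h') w) k k') => //.
- rewrite -/v' -{1 2}v'E -k'E -kE; rewrite [theta0 + (est - theta0)]addrC subrK.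
  by apply: maxi; apply: Hr; exact: le_r.
- exact: osc.
- exact: osc.
- exact: kap kB est_near.
- exact: kap k'B h'nu.
- by rewrite (_ : 3 * (B * nu) * V ^+ 2 = 3 * B * V ^+ 2 * nu)//; ring.
Qed.

End linearization.

(** * Cube roots and Slutsky's lemma *)

Section cube_root.
Context (R : realType).
Implicit Types x y : R.

(** This is x^2 + x y + y^2 - (x - y)^2 / 4 = 3 (x + y)^2 / 4 >= 0. *)
Lemma cube_expansive x y : `|x - y| ^+ 3 <= 4 * `|x ^+ 3 - y ^+ 3|.
Proof.
rewrite (_ : x ^+ 3 - y ^+ 3 = (x - y) * (x ^+ 2 + x * y + y ^+ 2)); last by ring.
rewrite normrM [leLHS]exprS [leRHS]mulrCA ler_wpM2l//.
have -> : `|x - y| ^+ 2 = (x - y) ^+ 2 by rewrite real_normK// num_real.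
rewrite -[4]ger0_norm// -normrM (le_trans _ (ler_norm _))//.
by have := sqr_ge0 (x + y); rewrite sqrrD sqrrB; lra.
Qed.

Lemma cubeK x : cbrt (x ^+ 3) = x.
Proof.
have := cube_expansive (cbrt (x ^+ 3)) x.
rewrite cbrtK subrr normr0 mulr0 => h; apply/eqP; rewrite -subr_eq0 -normr_eq0.
have : `|cbrt (x ^+ 3) - x| ^+ 3 == 0 by rewrite eq_le h exprn_ge0.
by rewrite expf_eq0.
Qed.

Lemma cbrt_holder x y : `|cbrt x - cbrt y| ^+ 3 <= 4 * `|x - y|.
Proof. by rewrite (le_trans (cube_expansive _ _))// !cbrtK. Qed.

Lemma cbrt_continuous : continuous (@cbrt R).
Proof.
move=> x; apply/cvgrPdist_lt => e e0; apply/nbhs_ballP.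
have e3 : 0 < e ^+ 3 / 4 by rewrite divr_gt0// exprn_gt0.
exists (e ^+ 3 / 4) => // y; rewrite /ball/= => xy.
have e0' := ltW e0; rewrite -(@ltr_pXn2r _ 3) ?nnegrE//.
rewrite (le_lt_trans (cbrt_holder x y))//.
by rewrite mulrC -ltr_pdivlMr.
Qed.

Lemma cbrt_sqrt_cube n x : cbrt (Num.sqrt n%:R * x ^+ 3) = n%:R `^ (6%:R^-1) * x.
Proof.
have s3 : (n%:R `^ (6%:R^-1)) ^+ 3 = Num.sqrt n%:R :> R.
  rewrite -(powR_mulrn 3 (powR_ge0 _ _)) -powRrM.
  by rewrite (_ : 6^-1 * 3 = 2^-1 :> R) ?powR12_sqrt//; field.
by rewrite -s3 -exprMn cubeK.
Qed.

End cube_root.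

Section slutsky.
Context (R : realType) (d : nat -> measure_display) (T : forall n, measurableType (d n)).
Context (P : forall n, probability (T n) R) (Z W : forall n, T n -> R) (V : R).
Hypothesis mW : forall n, measurable_fun [set: T n] (@W n).
Hypothesis IZ : forall n, (P n).-integrable [set: T n] (EFin \o @Z n).
Hypothesis ZV : forall n, \int[P n]_w `|@Z n w| <= V.
Hypothesis close : forall eps eta : R, 0 < eps -> 0 < eta -> exists N : nat, forall n, (N <= n)%N ->
  exists E : set (T n), [/\ measurable E, (P n E <= eta%:E)%E &
    forall w, ~ E w -> `|@W n w - @Z n w| <= eps].

(** With high probability Z n lies in a compact interval, on which F is
    uniformly continuous. *)
Lemma slutsky (F : R -> R) (C l : R) : continuous F -> (forall x, `|F x| <= C) ->
  \int[P n]_w F (@Z n w) @[n --> \oo] --> l ->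
  \int[P n]_w F (@W n w) @[n --> \oo] --> l.
Proof.
move=> cF FC /cvgrPdist_lt Zl; apply/cvgrPdist_lt => e e0.
have C0 : 0 <= C by apply: le_trans (FC 0).
have mZ n : measurable_fun [set: T n] (@Z n).
  by apply/measurable_EFinP; exact: (measurable_int (P n) (IZ n)).
have V0 : 0 <= V.
  by apply: le_trans (ZV 0%N); apply: Rintegral_ge0.
have e2 : 0 < e / 2 by rewrite divr_gt0.
have e4 : 0 < e / 4 by rewrite divr_gt0.
pose eta := e / (16 * (C + 1)).
have C16 : 0 < 16 * (C + 1) by rewrite mulr_gt0// ltr_wpDl.
have eta0 : 0 < eta by rewrite divr_gt0.
pose K := (V + 1) / eta.
have K0 : 0 < K by rewrite divr_gt0// ltr_wpDl.
have [delta d0 Fd] := @locally_uniformly_continuous _ F K (e / 4) cF e4.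
have d2 : 0 < delta / 2 by rewrite divr_gt0.
have [N HN] := close d2 eta0.
near=> n.
have Nn : (N <= n)%N by near: n; exists N.
have [E [mE PE HE]] := HN n Nn.
have V1 : \int[P n]_w `|@Z n w| <= V + 1 by rewrite (le_trans (ZV n))// lerDl.
have [mG PG] := markov_bound (integrable_norm (IZ n)) (fun w => normr_ge0 _) V1 K0.
pose G := [set w : T n | K <= `|@Z n w|].
have {}PG : (P n G <= eta%:E)%E.
  apply: le_trans PG _; rewrite lee_fin /K invf_div mulrCA divff ?mulr1// gt_eqF//.
  by rewrite ltr_wpDl.
pose B := E `|` G.
have mB : measurable B by exact: measurableU.
have PB : (P n B <= (2 * eta)%:E)%E.
  apply: le_trans (measureU2 _ mE mG) _; rewrite mulr_natl mulr2n EFinD.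
  exact: leeD.
have bF (Y : T n -> R) : measurable_fun [set: T n] Y ->
    (P n).-integrable [set: T n] (EFin \o (fun w => F (Y w))).
  move=> mY; apply: (@bounded_integrable _ _ _ _ _ C) => //.
  by apply: (measurableT_comp _ mY); exact: continuous_measurable_fun.
have IW := bF _ (@mW n); have IZ' := bF _ (@mZ n).
have ID : (P n).-integrable [set: T n] (EFin \o (fun w => F (@W n w) - F (@Z n w))).
  exact: integrableB IW IZ'.
have I1 : (P n).-integrable [set: T n] (EFin \o (fun w => \1_B w : R)).
  apply: (@bounded_integrable _ _ _ _ _ 1); first exact: measurable_indic.
  by move=> w; rewrite ger0_norm indicE ?ler0n// lern1 leq_b1.
have IC : (P n).-integrable [set: T n] (EFin \o (fun w => 2 * C * \1_B w)).
  by have := integrableZl measurableT (2 * C) I1.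
have Ic : (P n).-integrable [set: T n] (EFin \o (fun=> e / 4)).
  by apply: (@bounded_integrable _ _ _ _ _ `|e / 4|).
have IS : (P n).-integrable [set: T n] (EFin \o (fun w => e / 4 + 2 * C * \1_B w)).
  exact: integrableD Ic IC.
have D : `|\int[P n]_w F (@W n w) - \int[P n]_w F (@Z n w)| <= e / 2.
  rewrite -(RintegralB measurableT IW IZ') (le_trans (le_normr_Rintegral measurableT ID))//.
  apply: (@le_trans _ _ (\int[P n]_w (e / 4 + 2 * C * \1_B w))).
    apply: le_Rintegral => //; first exact: (integrable_norm ID).
    move=> w _; have [wB|wB] := pselect (B w).
      rewrite indicE mem_set// mulr1 (le_trans (ler_normB _ _))//.
      by rewrite (@le_trans _ _ (2 * C))// ?lerDr ?(ltW e4)// mulr_natl mulr2n lerD.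
    rewrite indicE memNset// mulr0 addr0 distrC ltW// Fd//.
      by rewrite leNgt; apply/negP => h; apply: wB; right; exact: ltW.
    rewrite distrC (le_lt_trans (HE w _))//; first by move=> wE; apply: wB; left.
    by rewrite ltr_pdivrMr// ltr_pMr// ltr1n.
  have E1 : \int[P n]_w (\1_B w : R) = fine (P n B).
    by rewrite /Rintegral integral_indic// setIT.
  rewrite (RintegralD_setT Ic IC) Rintegral_setT_cst RintegralZl// E1.
  have fB : (fine (P n B) <= 2 * eta).
    rewrite -lee_fin fineK//; exact: fin_num_measure.
  apply: (@le_trans _ _ (e / 4 + 2 * C * (2 * eta))); first by rewrite lerD2l ler_wpM2l// mulr_ge0.
  rewrite (_ : e / 2 = e / 4 + e / 4); last by field.
  rewrite lerD2l /eta.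
  have -> : 2 * C * (2 * (e / (16 * (C + 1)))) = e / 4 * (C / (C + 1)).
    by field; rewrite gt_eqF// ltr_wpDl.
  by rewrite ler_piMr ?(ltW e4)// ler_pdivrMr ?ltr_wpDl// mul1r lerDl.
have Zn : `|l - \int[P n]_w F (@Z n w)| < e / 2 by near: n; exact: Zl.
move: D Zn; set x := \int[P n]_w F (@W n w); set y := \int[P n]_w _ => D Zn.
rewrite (_ : l - x = (l - y) - (x - y)); last by ring.
by rewrite (le_lt_trans (ler_normB _ _))// [ltRHS]splitr ltr_leD.
Unshelve. all: end_near. Qed.

End slutsky.

(** * From the hypotheses to the estimates *)

Section regularity.
Context (R : realType) (tau alpha beta theta0 : R) (lam : R -> R -> R) (lo hi : R).
Local Notation Theta := (`]alpha, beta[%classic : set R).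
Let sqrt_lam (th t : R) : R := Num.sqrt (lam th t).
Hypothesis tau0 : 0 < tau.
Hypothesis theta0_in : theta0 \in `]alpha, beta[.
Hypothesis mlam : forall th, Theta th -> measurable_fun (`[0, tau]%classic : set R) (lam th).
Hypothesis blam : forall th, Theta th -> bounded_positive tau (lam th).
Hypothesis lo0 : 0 < lo.
Hypothesis lam_bnd : forall t, t \in `[0, tau] -> lo <= lam theta0 t <= hi.
Local Notation f := (lam theta0).
Local Notation leb := (@lebesgue_measure R).
Local Notation D := (`]0, tau]%classic : set (measurableTypeR R)).
Local Notation bm := (@bounded_measurable _ (measurableTypeR R) R (`]0, tau]%classic)).

Let mf : measurable_fun (`[0, tau]%classic : set R) f.
Proof. exact: mlam. Qed.

Let DI t : (`]0, tau]%classic : set R) t -> t \in `[0, tau].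
Proof. by rewrite /= !in_itv/= => /andP[/ltW -> ->]. Qed.

Lemma sqrt_lipschitz (M : R) :
  continuously_differentiable Theta tau 2 sqrt_lam ->
  (forall j th t, (1 <= j <= 2)%N -> Theta th -> t \in `[0, tau] ->
     `|dtheta j sqrt_lam th t| <= M) ->
  forall th th' t, Theta th -> Theta th' -> t \in `[0, tau] ->
    `|Num.sqrt (lam th t) - Num.sqrt (lam th' t)| <= M * `|th - th'|.
Proof.
move=> [cd _] bd th th' t Th Th' t0.
have inT (x : R) : Num.min th' th <= x <= Num.max th' th -> Theta x.
  move: Th Th'; rewrite /= !in_itv/= => /andP[a1 b1] /andP[a2 b2] /andP[xl xu].
  apply/andP; split; first by apply: lt_le_trans xl; rewrite lt_min a1 a2.
  by apply: le_lt_trans xu _; rewrite gt_max b1 b2.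
apply: (@mean_value_le R (fun u => dtheta 0 sqrt_lam u t) (fun u => dtheta 1 sqrt_lam u t)).
  by move=> x /inT Tx; apply: is_derive_dtheta; exact: cd.
by move=> x /inT Tx; apply: bd.
Qed.

(** The end point 0 has Lebesgue measure 0. *)
Lemma integral_closed_compensator (phi : R -> R) (psi : R -> R) :
  bm phi -> measurable_fun D psi -> (forall t, D t -> psi t = phi t * f t) ->
  (\int[leb]_(t in `[0%R, tau]) (psi t)%:E = (compensator tau f phi)%:E)%E.
Proof.
move=> bp mpsi E; have mD : measurable D by exact: measurable_itv.
rewrite -integral_itv_obnd_cbnd; last exact/measurable_EFinP.
have bpf := bounded_measurableM bp (intensity_bounded_measurable mf lo0 lam_bnd).
have If := bounded_measurable_integrable mD (lebesgue_oc_lty 0 tau) bpf.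
have -> : (\int[leb]_(t in D) (psi t)%:E = \int[leb]_(t in D) (phi t * f t)%:E)%E.
  by apply: eq_integral => t; rewrite inE => /E ->.
rewrite /compensator /Rintegral fineK//; exact: integrable_fin_num.
Qed.

Lemma sqrt_ratio th t : Theta th -> (`]0, tau]%classic : set R) t ->
  (Num.sqrt (lam th t) - Num.sqrt (f t)) ^+ 2 =
  (expR (2^-1 * log_ratio theta0 lam th t) - 1) ^+ 2 * f t.
Proof.
move=> Th Dt; have /andP[f1 _] := lam_bnd (DI Dt); have f0 := lt_le_trans lo0 f1.
set q := expR _.
have -> : lam th t = q ^+ 2 * f t.
  rewrite -(expR_log_ratio blam lo0 lam_bnd Th Dt); congr (_ * _).
  by rewrite /q expr2 -expRD; congr expR; field.
rewrite sqrtrM ?sqr_ge0// sqrtr_sqr ger0_norm ?expR_ge0//.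
by rewrite -[X in _ - X]mul1r -mulrBl exprMn sqr_sqrtr// ltW.
Qed.

Lemma hellingerE th : Theta th ->
  (\int[leb]_(t in `[0%R, tau]) ((sqrt_lam th t - sqrt_lam theta0 t) ^+ 2)%:E =
   (hellinger tau theta0 lam th)%:E)%E.
Proof.
move=> Th; have bl := bounded_measurable_log_ratio theta0_in mlam blam Th.
have b1 : bm (fun=> 1) by exact: bounded_measurable_cst.
have bq := bounded_measurable_sqr (bounded_measurableB (bounded_measurable_expR (bounded_measurableZ 2^-1 bl)) b1).
have bqf := bounded_measurableM bq (intensity_bounded_measurable mf lo0 lam_bnd).
apply: integral_closed_compensator => //; last by move=> t Dt; exact: sqrt_ratio.
apply: eq_measurable_fun (proj1 bqf) => t; rewrite inE => Dt.
by rewrite /sqrt_lam sqrt_ratio.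
Qed.

Lemma hellinger_separated :
  (forall nu : R, 0 < nu ->
     (0 < ereal_inf
        [set \int[leb]_(t in `[0%R, tau]) ((sqrt_lam th t - sqrt_lam theta0 t) ^+ 2)%:E
        | th in Theta `&` [set th | nu < `|th - theta0|]%R])%E) ->
  forall nu : R, 0 < nu -> exists2 delta, 0 < delta &
    forall th, Theta th -> nu < `|th - theta0| -> delta <= hellinger tau theta0 lam th.
Proof.
move=> H nu nu0; have := H nu nu0; set e := ereal_inf _ => e0.
have lb th : Theta th -> nu < `|th - theta0| -> (e <= (hellinger tau theta0 lam th)%:E)%E.
  by move=> Th far; rewrite -hellingerE//; apply: ereal_inf_lbound; exists th.
case: e e0 lb => [x|_|]; rewrite ?lte_fin//.
  by move=> x0 lb; exists x => // th Th far; rewrite -lee_fin; exact: lb.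
by move=> lb; exists 1 => // th Th far; have := lb th Th far; rewrite leye_eq.
Qed.

Lemma info3E (r A : R) : 0 < r -> 0 < A -> (forall h, `|h| <= r -> Theta (theta0 + h)) ->
  (forall t, t \in `[0, tau] -> `|score3 theta0 lam t| <= A) ->
  (forall h h' t, `|h| <= r -> `|h'| <= r -> t \in `[0, tau] ->
     `|cubic_remainder theta0 lam h t - cubic_remainder theta0 lam h' t| <= A * `|h - h'|) ->
  info3 tau lam theta0 = (compensator tau f (fun t => score3 theta0 lam t ^+ 2))%:E.
Proof.
move=> r0 A0 Hr sA rl.
have bg2 := bounded_measurable_sqr (bounded_measurable_score3 theta0_in mlam blam r0 A0 Hr sA rl).
have bgf := bounded_measurableM bg2 (intensity_bounded_measurable mf lo0 lam_bnd).
have E (t : R) : (`]0, tau]%classic : set R) t -> dtheta 3 lam theta0 t ^+ 2 / (3`!%:R ^+ 2 * f t) =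
    score3 theta0 lam t ^+ 2 * f t.
  move=> Dt; have /andP[f1 _] := lam_bnd (DI Dt); have f0 := lt_le_trans lo0 f1.
  by rewrite /score3 (_ : 3`! = 6%N)//; field; rewrite gt_eqF.
apply: integral_closed_compensator => //.
by apply: eq_measurable_fun (proj1 bgf) => t; rewrite inE => Dt; rewrite E.
Qed.

End regularity.

Lemma expectation_bounded d (T : measurableType d) (R : realType) (P : probability T R)
    (f : T -> R) (C : R) : measurable_fun [set: T] f -> (forall w, `|f w| <= C) ->
  ('E_P[f] = (\int[P]_w f w)%:E)%E.
Proof.
move=> mf fC; rewrite unlock /Rintegral fineK//.
by apply: integrable_fin_num => //; exact: bounded_integrable mf fC.
Qed.

(** * The limit theorem *)

Theorem mainTheorem2 (R : realType) (tau alpha beta theta0 : R)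
    (lam : R -> R -> R)
    (d : nat -> measure_display) (Omega : forall n, measurableType (d n))
    (P : forall n, probability (Omega n) R)
    (X : forall n, 'I_n -> Omega n -> cumulative R R)
    (mle : forall n, {RV (P n) >-> R})
    (d' : measure_display) (Omega' : measurableType d')
    (Q : probability Omega' R) (zeta : {RV Q >-> R}) :
  let Theta : set R := `]alpha, beta[%classic in
  let sqrt_lam := fun th t => Num.sqrt (lam th t) in
  let I3 := fine (info3 tau lam theta0) in
  0 < tau ->
  theta0 \in `]alpha, beta[ ->
  (forall th, Theta th ->
     measurable_fun `[0, tau]%classic (lam th) /\
     bounded_positive tau (lam th)) ->
  (forall n j, poisson_process tau (lam theta0) (P n) (X n j)) ->
  (forall n, mutually_independent (P n)
     (fun j => sigma_of_process tau (X n j))) ->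
  continuously_differentiable Theta tau 2 sqrt_lam ->
  (exists M : R, forall j th t, (1 <= j <= 2)%N -> Theta th ->
     t \in `[0, tau] -> `|dtheta j sqrt_lam th t| <= M) ->
  continuously_differentiable Theta tau 4 lam ->
  (forall nu : R, 0 < nu ->
     (0 < ereal_inf
        [set \int[lebesgue_measure]_(t in `[0%R, tau])
               ((sqrt_lam th t - sqrt_lam theta0 t) ^+ 2)%:E
        | th in Theta `&` [set th | nu < `|th - theta0|]%R])%E) ->
  (forall t, t \in `[0, tau] ->
     dtheta 1 lam theta0 t = 0 /\ dtheta 2 lam theta0 t = 0) ->
  (0 < info3 tau lam theta0 < +oo)%E ->
  (forall n, is_mle Theta tau lam (X n) (mle n)) ->
  (forall B : set R, measurable B ->
     distribution Q zeta B = normal_prob 0 (Num.sqrt I3) B) ->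
  cvg_in_distribution P
    (fun n w => n%:R `^ (6%:R^-1) * (mle n w - theta0))
    Q (fun w => cbrt (zeta w / I3)).
Proof.
move=> Theta sqrt_lam I3 tau0 theta0_in reg HX iX cd2 [M0 bM] cd4 hell flat info_bnd Hmle zetaE.
have mlam th : Theta th -> measurable_fun (`[0, tau]%classic : set R) (lam th) by case/reg.
have blam th : Theta th -> bounded_positive tau (lam th) by case/reg.
have Th0 : Theta theta0 by [].
have [lo [hi [lo0 lam_bnd]]] := blam _ Th0.
pose M := `|M0| + 1; have Mpos : 0 < M by rewrite ltr_wpDl.
have bM' j th t : (1 <= j <= 2)%N -> Theta th -> t \in `[0, tau] -> `|dtheta j sqrt_lam th t| <= M.
  by move=> j12 Th t0; rewrite (le_trans (bM j th t j12 Th t0))// (le_trans (ler_norm _))// lerDl.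
have sl := sqrt_lipschitz cd2 bM'.
have sep := hellinger_separated theta0_in mlam blam lo0 lam_bnd hell.
have [r [A [r0 A0 Hr sA rl']]] := local_expansion theta0_in cd4 flat lo0 lam_bnd.
have rl h h' t : `|h| <= r -> `|h'| <= r -> t \in `[0, tau] ->
    `|cubic_remainder theta0 lam h t - cubic_remainder theta0 lam h' t| <= A * `|h - h'|.
  by move=> hr h'r t0; case: (rl' h h' t hr h'r t0).
have infoE := info3E theta0_in mlam blam lo0 lam_bnd r0 A0 Hr sA rl.
pose I := compensator tau (lam theta0) (fun t => score3 theta0 lam t ^+ 2).
have I3E : I3 = I by rewrite /I3 infoE.
have I0 : 0 < I by move: info_bnd; rewrite infoE lte_fin => /andP[].
have sI0 : 0 < Num.sqrt I by rewrite sqrtr_gt0.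
rewrite I3E in zetaE *.
have mf := mlam _ Th0.
have bg := bounded_measurable_score3 theta0_in mlam blam r0 A0 Hr sA rl.
pose Y n := @empirical R tau (lam theta0) d Omega X n (score3 theta0 lam).
pose Z n w := Y n w / I.
pose W n w := Num.sqrt n%:R * (mle n w - theta0) ^+ 3.
have EY n := empirical_moment tau0 mf lo0 lam_bnd HX iX n bg.
have E_div S (dS : measure_display) (TS : measurableType dS) (PS : probability TS R) (y : TS -> R) :
    PS.-integrable [set: TS] (EFin \o y) -> \int[PS]_w `|y w| <= S ->
    PS.-integrable [set: TS] (EFin \o (fun w => y w / I)) /\ \int[PS]_w `|y w / I| <= S / I.
  move=> Iy yS; have E : (fun w => y w / I) = (fun w => I^-1 * y w) by apply/funext => w; rewrite mulrC.
  split; first by rewrite E; have := integrableZl measurableT I^-1 Iy.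
  have -> : \int[PS]_w `|y w / I| = \int[PS]_w (I^-1 * `|y w|).
    by apply: eq_Rintegral => w _; rewrite normrM mulrC gtr0_norm ?invr_gt0.
  rewrite RintegralZl//; last exact: (integrable_norm Iy).
  by rewrite mulrC ler_pM2r ?invr_gt0.
have IZ n := E_div (1 + I) _ _ _ _ (proj1 (EY n)) (proj2 (EY n)).
have Izeta0 := normal_variable_first_moment sI0 zetaE.
have [Izeta zetaV] := E_div _ _ _ _ _ Izeta0 (lexx _).
pose V := Num.max ((1 + I) / I) (\int[Q]_w `|zeta w| / I).
have mY n : measurable_fun [set: Omega n] (Y n).
  by apply/measurable_EFinP; exact: (measurable_int _ (proj1 (EY n))).
have mZ n : measurable_fun [set: Omega n] (Z n).
  by apply: measurable_funM => //; exact: measurable_cst.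
have mW n : measurable_fun [set: Omega n] (W n).
  apply: measurable_funM; first exact: measurable_cst.
  apply: measurable_funX; apply: measurable_funB => //; exact: measurable_cst.
have mzI : measurable_fun [set: Omega'] (fun w => zeta w / I).
  by apply: measurable_funM => //; exact: measurable_cst.
have ZV n : \int[P n]_w `|Z n w| <= V by rewrite le_max (proj2 (IZ n)).
have zV : \int[Q]_w `|zeta w / I| <= V by rewrite le_max zetaV orbT.
have assoc (a y : R) : a * (y / I) = a / I * y by rewrite mulrA mulrAC.
have cosines (a b : R) :
    \int[P n]_w cos (a * Z n w + b) @[n --> \oo] --> \int[Q]_w cos (a * (zeta w / I) + b).
  have -> : \int[Q]_w cos (a * (zeta w / I) + b) = expR (- ((a / I) ^+ 2 * I / 2)) * cos b.
    have nv := normal_variable_cos sI0 zetaE (a / I) b; rewrite (sqr_sqrtr (ltW I0)) in nv.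
    by rewrite -nv; apply: eq_Rintegral => w _; rewrite assoc.
  have -> : (fun n => \int[P n]_w cos (a * Z n w + b)) =
      (fun n => \int[P n]_w cos (a / I * Y n w + b)).
    by apply/funext => n; apply: eq_Rintegral => w _; rewrite /Z assoc.
  have moments n j := centered_int_moments tau0 mf lo0 lam_bnd (HX n j) bg.
  have [gm [G gG]] := bg.
  have gG' t : (`]0, tau]%classic : set (measurableTypeR R)) t -> `|score3 theta0 lam t| <= `|G|.
    by move=> /gG /le_trans; apply; exact: ler_norm.
  have moment3 n j := centered_int_moment3 tau0 mf lo0 lam_bnd (HX n j) bg gG' (normr_ge0 G).
  pose L := mean_count (lam theta0) tau.
  apply: (@central_limit_cos R d Omega P
    (fun n j => centered_int tau (lam theta0) (X n j) (score3 theta0 lam)) I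
    (4 * `|G| ^+ 3 * (2 * L ^+ 3 + 3 * L ^+ 2 + L))).
  - by move=> n j; exact: (measurable_centered_int tau0 mf lo0 lam_bnd HX j bg).
  - by move=> n; exact: (independent_centered_int tau0 iX bg).
  - by move=> n j; case: (moments n j).
  - by move=> n j; case: (moments n j).
  - by move=> n j; case: (moment3 n j).
  - by move=> n j; case: (moments n j).
  - by move=> n j; case: (moments n j).
  - by move=> n j; case: (moment3 n j).
have close (eps eta : R) : 0 < eps -> 0 < eta -> exists N : nat, forall n, (N <= n)%N ->
    exists E : set (Omega n), [/\ measurable E, (P n E <= eta%:E)%E &
      forall w, ~ E w -> `|W n w - Z n w| <= eps].
  move=> eps0 eta0.
  have [N HN] := mle_linearization tau0 theta0_in mlam blam lo0 lam_bnd Mpos sl sep r0 A0 Hr sA rl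
    HX iX I0 eps0 eta0.
  exists N => n /HN[E [mE PE HE]]; have [B [mB PB HB]] := Hmle n.
  exists (E `|` B); split; first exact: measurableU.
    apply: le_trans (measureU2 _ mE mB) _; rewrite -[leRHS]adde0; apply: leeD; first exact: PE.
    by rewrite le_eqVlt; apply/orP; left; apply/eqP; exact: PB.
  move=> w nEB; apply: HE; first by move=> Ew; apply: nEB; left.
  by apply: contrapT => h; apply: nEB; right; apply: HB.
move=> F cF [C FC].
(* As n^(1/6) (mle n - theta0) is the cube root of W n, the test function F at
   the rescaled estimator is G at W n. *)
pose G x := F (cbrt x).
have cG : continuous G by move=> x; apply: continuous_comp; [exact: cbrt_continuous|exact: cF].
have GC x : `|G x| <= C by exact: FC.
have wc := weak_convergence_of_cosines mZ mzI (fun n => proj1 (IZ n)) Izeta ZV zV cosines cG GC.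
have sc := slutsky mW (fun n => proj1 (IZ n)) ZV close cG GC wc.
have mG : measurable_fun [set: R] G by exact: continuous_measurable_fun.
have mGz : measurable_fun [set: Omega'] (fun w => G (zeta w / I)) by exact: (measurableT_comp mG mzI).
have mGW n : measurable_fun [set: Omega n] (fun w => G (W n w)).
  exact: (measurableT_comp mG (mW n)).
have -> : 'E_Q[F \o (fun w => cbrt (zeta w / I))]%E = (\int[Q]_w G (zeta w / I))%:E.
  by apply: (@expectation_bounded _ _ _ _ _ C); [exact: mGz|move=> w; exact: GC].
have -> : (fun n => 'E_(P n)[F \o (fun w => (n%:R `^ 6%:R^-1 * (mle n w - theta0))%R)]%E) =
    (fun n => (\int[P n]_w G (W n w))%:E).
  apply/funext => n; have -> : F \o (fun w => n%:R `^ 6%:R^-1 * (mle n w - theta0)) = G \o W n.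
    by apply/funext => w; rewrite /G /W /= cbrt_sqrt_cube.
  by apply: (@expectation_bounded _ _ _ _ _ C); [exact: mGW|move=> w; exact: GC].
apply: cvg_EFin; last exact: sc.
by near=> n.
Unshelve. all: end_near. Qed.
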